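(* Let $A$ be a commutative Banach Tate ring with the weak (resp. strong) Nullstellensatz property. Then for every nonnegative integer $n$, the following statements hold. (a) The ring $A\langle T_1,\dots,T_n\rangle$ has the weak (resp. strong) Nullstellensatz property. (b) For every finite morphism of commutative rings $\phi\colon A\langle T_1,\dots,T_n\rangle \to B_n$ and every maximal ideal $\mathfrak{m}_n$ of $B_n$, the induced ring homomorphism $A/(\phi^{-1}(\mathfrak{m}_n)\cap A)\to B_n/\mathfrak{m}_n$ is finite.
   Context: A commutative Banach Tate ring is a commutative ring complete with respect to a submultiplicative nonarchimedean norm and containing a topologically nilpotent unit. $A\langle T_1,\dots,T_n\rangle$ is the ring of power series over $A$ whose coefficients tend to $0$, with the Gauss norm (maximum of the norms of the coefficients). A ring homomorphism is finite if the target is a finitely generated module over the source. For a commutative Banach Tate ring $A$, a rational localization of $A$ is a morphism $A\to B$ with $B$ (up to isomorphism) the quotient of $A\langle X_1,\dots,X_k\rangle$ by the closure of the ideal $(gX_1-f_1,\dots,gX_k-f_k)$, where $f_1,\dots,f_k,g\in A$ generate the unit ideal. For a ring $C$ equipped with a map $A\to C$ and an ideal $I\subseteq C$, $I\cap A$ denotes the preimage of $I$ in $A$; thus $\phi^{-1}(\mathfrak{m}_n)\cap A$ is the preimage of $\mathfrak{m}_n$ under the composite $A\to A\langle T_1,\dots,T_n\rangle\to B_n$. A commutative Banach Tate ring $A$ has the weak Nullstellensatz property if for every rational localization $A\to B$ and every maximal ideal $\mathfrak{m}$ of $B$, the ring homomorphism $A/(\mathfrak{m}\cap A)\to B/\mathfrak{m}$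 is finite. It has the strong Nullstellensatz property if it has the weak one and in addition, for every maximal ideal $\mathfrak{n}$ of $A$, the (quotient) topology on $A/\mathfrak{n}$ is defined by some multiplicative norm. *)

(* Defs.v *)
From HB Require Import structures.
From mathcomp Require Import all_boot all_order all_algebra.
From mathcomp Require Import finmap generic_quotient.
From mathcomp Require Import all_classical all_reals all_analysis.

Set Implicit Arguments.
Unset Strict Implicit.
Unset Printing Implicit Defensive.

Import Order.TTheory GRing.Theory Num.Theory.
Import numFieldNormedType.Exports.

Local Open Scope classical_set_scope.
Local Open Scope ring_scope.
Local Open Scope quotient_scope.

(* Rings are comPzRingType throughout: quotients and rational localizations   *)
(* may be the zero ring.                                                      *)

Definition finite_hom (R S : comPzRingType) (f : R -> S) : Prop :=
  exists (r : nat) (s : 'I_r -> S),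
    forall y, exists c : 'I_r -> R, y = \sum_i f (c i) * s i.

Section Ideals.
Variable R : comPzRingType.

Record ideal : Type := Ideal {
  ideal_set :> R -> Prop;
  ideal0 : ideal_set 0;
  idealD : forall x y, ideal_set x -> ideal_set y -> ideal_set (x + y);
  idealM : forall a x, ideal_set x -> ideal_set (a * x) }.

Definition maximal_ideal (m : ideal) : Prop :=
  ~ m 1 /\ forall J : ideal, m `<=` J -> ~ J 1 -> J `<=` m.

Lemma idealN (I : ideal) x : I x -> I (- x).
Proof. by move=> Ix; rewrite -mulN1r; apply: idealM. Qed.

Lemma idealB (I : ideal) x y : I x -> I y -> I (x - y).
Proof. by move=> Ix Iy; apply: idealD => //; apply: idealN. Qed.

Definition span_set k (x : 'I_k -> R) : set R :=
  [set y | exists c : 'I_k -> R, y = \sum_i c i * x i].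

Lemma span0 k (x : 'I_k -> R) : span_set x 0.
Proof. by exists (fun=> 0); rewrite big1 // => i _; rewrite mul0r. Qed.

Lemma spanD k (x : 'I_k -> R) y z :
  span_set x y -> span_set x z -> span_set x (y + z).
Proof.
move=> [c ->] [d ->]; exists (fun i => c i + d i).
by rewrite -big_split; apply: eq_bigr => i _; rewrite mulrDl.
Qed.

Lemma spanM k (x : 'I_k -> R) a z : span_set x z -> span_set x (a * z).
Proof.
move=> [c ->]; exists (fun i => a * c i).
by rewrite big_distrr; apply: eq_bigr => i _; rewrite /= mulrA.
Qed.

Definition span_ideal k (x : 'I_k -> R) : ideal :=
  Ideal (span0 x) (@spanD k x) (@spanM k x).

End Ideals.

Section PreimIdeal.
Variables (R S : comPzRingType) (f : {rmorphism R -> S}) (I : ideal S).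

Lemma preim0 : (f @^-1` I) 0.
Proof. by rewrite /preimage /= rmorph0; exact: ideal0. Qed.
Lemma preimD x y : (f @^-1` I) x -> (f @^-1` I) y -> (f @^-1` I) (x + y).
Proof. by rewrite /preimage /= rmorphD; exact: idealD. Qed.
Lemma preimM a x : (f @^-1` I) x -> (f @^-1` I) (a * x).
Proof. by rewrite /preimage /= rmorphM; exact: idealM. Qed.

Definition preim_ideal : ideal R := Ideal preim0 preimD preimM.
End PreimIdeal.

(* mathcomp's ring_quotient requires a proper ideal of a nontrivial ring, so  *)
(* the quotient by an arbitrary ideal is built here on the same pattern.      *)
Section Quotient.
Variables (R : comPzRingType) (I : ideal R).

Definition ideal_eq (x y : R) : bool := `[< I (x - y) >].

Lemma ideal_eq_refl : reflexive ideal_eq.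
Proof. by move=> x; apply/asboolP; rewrite subrr; exact: ideal0. Qed.
Lemma ideal_eq_sym : symmetric ideal_eq.
Proof.
by move=> x y; apply/idP/idP => /asboolP h; apply/asboolP;
  rewrite -opprB; exact: idealN.
Qed.
Lemma ideal_eq_trans : transitive ideal_eq.
Proof.
move=> y x z /asboolP h1 /asboolP h2; apply/asboolP.
by rewrite -(subrKA y); exact: idealD.
Qed.

Canonical ideal_equiv :=
  EquivRel ideal_eq ideal_eq_refl ideal_eq_sym ideal_eq_trans.

Definition quot := {eq_quot ideal_equiv}.
HB.instance Definition _ := EqQuotient.on quot.
HB.instance Definition _ := Choice.on quot.

Definition quot_pi (x : R) : quot := \pi_quot x.

Lemma quot_piP x y : quot_pi x = quot_pi y <-> I (x - y).
Proof.
rewrite /quot_pi; split => [/eqmodP|] h; last by apply/eqmodP/asboolP.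
by apply/asboolP.
Qed.

Lemma quot_ind (P : quot -> Prop) : (forall x, P (quot_pi x)) -> forall x, P x.
Proof. by move=> h x; rewrite -[x]reprK; exact: h. Qed.

Lemma quot_repr x : I (repr (quot_pi x) - x).
Proof. by apply/quot_piP; rewrite /quot_pi reprK. Qed.

Definition quot_opp (x : quot) : quot := quot_pi (- repr x).
Definition quot_add (x y : quot) : quot := quot_pi (repr x + repr y).
Definition quot_mul (x y : quot) : quot := quot_pi (repr x * repr y).

Lemma quot_oppE x : quot_opp (quot_pi x) = quot_pi (- x).
Proof. by apply/quot_piP; rewrite -opprD; apply: idealN; exact: quot_repr. Qed.
Lemma quot_addE x y : quot_add (quot_pi x) (quot_pi y) = quot_pi (x + y).
Proof.
apply/quot_piP; rewrite opprD addrACA.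
by apply: idealD; exact: quot_repr.
Qed.
Lemma quot_mulE x y : quot_mul (quot_pi x) (quot_pi y) = quot_pi (x * y).
Proof.
apply/quot_piP; set x' := repr _; set y' := repr _.
have -> : x' * y' - x * y = x' * (y' - y) + y * (x' - x).
  by rewrite !mulrBr (mulrC y x') (mulrC y x) subrKA.
by apply: idealD; apply: idealM; exact: quot_repr.
Qed.

Lemma quot_addA : associative quot_add.
Proof.
elim/quot_ind=> x; elim/quot_ind=> y; elim/quot_ind=> z.
by rewrite !quot_addE addrA.
Qed.
Lemma quot_addC : commutative quot_add.
Proof.
by elim/quot_ind=> x; elim/quot_ind=> y; rewrite !quot_addE addrC.
Qed.
Lemma quot_add0 : left_id (quot_pi 0) quot_add.
Proof. by elim/quot_ind=> x; rewrite quot_addE add0r. Qed.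
Lemma quot_addN : left_inverse (quot_pi 0) quot_opp quot_add.
Proof. by elim/quot_ind=> x; rewrite quot_oppE quot_addE addNr. Qed.

HB.instance Definition _ := GRing.isZmodule.Build quot
  quot_addA quot_addC quot_add0 quot_addN.

Lemma quot_mulA : associative quot_mul.
Proof.
elim/quot_ind=> x; elim/quot_ind=> y; elim/quot_ind=> z.
by rewrite !quot_mulE mulrA.
Qed.
Lemma quot_mulC : commutative quot_mul.
Proof.
by elim/quot_ind=> x; elim/quot_ind=> y; rewrite !quot_mulE mulrC.
Qed.
Lemma quot_mul1 : left_id (quot_pi 1) quot_mul.
Proof. by elim/quot_ind=> x; rewrite quot_mulE mul1r. Qed.
Lemma quot_mulD : left_distributive quot_mul (@GRing.add quot).
Proof.
elim/quot_ind=> x; elim/quot_ind=> y; elim/quot_ind=> z.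
rewrite -[_ + quot_pi y]/(quot_add _ _) -[RHS]/(quot_add _ _).
by rewrite quot_addE !quot_mulE quot_addE mulrDl.
Qed.

HB.instance Definition _ := GRing.Zmodule_isComPzRing.Build quot
  quot_mulA quot_mulC quot_mul1 quot_mulD.

Lemma quot_pi_is_zmod_morphism : zmod_morphism quot_pi.
Proof.
by move=> x y; rewrite -[RHS]/(quot_add _ (quot_opp _)) quot_oppE quot_addE.
Qed.
Lemma quot_pi_is_monoid_morphism : monoid_morphism quot_pi.
Proof. by split=> // x y; rewrite -[RHS]/(quot_mul _ _) quot_mulE. Qed.

HB.instance Definition _ := GRing.isZmodMorphism.Build R quot quot_pi
  quot_pi_is_zmod_morphism.
HB.instance Definition _ := GRing.isMonoidMorphism.Build R quot quot_pi
  quot_pi_is_monoid_morphism.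

End Quotient.

(* The homomorphism R / (f^-1 I) -> S / I induced by f : R -> S.              *)
Section QuotMap.
Variables (R S : comPzRingType) (f : {rmorphism R -> S}) (I : ideal S).

Definition quot_map (x : quot (preim_ideal f I)) : quot I :=
  quot_pi I (f (repr x)).

Lemma quot_mapE x : quot_map (quot_pi _ x) = quot_pi I (f x).
Proof.
apply/quot_piP; rewrite -rmorphB.
exact: (@quot_repr _ (preim_ideal f I) x).
Qed.

Lemma quot_map_is_zmod_morphism : zmod_morphism quot_map.
Proof.
elim/quot_ind=> x; elim/quot_ind=> y.
by rewrite -rmorphB !quot_mapE -rmorphB -rmorphB.
Qed.
Lemma quot_map_is_monoid_morphism : monoid_morphism quot_map.
Proof.
split; first by rewrite -(rmorph1 (quot_pi _)) quot_mapE !rmorph1.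
elim/quot_ind=> x; elim/quot_ind=> y.
by rewrite -rmorphM !quot_mapE -rmorphM -rmorphM.
Qed.

HB.instance Definition _ := GRing.isZmodMorphism.Build _ _ quot_map
  quot_map_is_zmod_morphism.
HB.instance Definition _ := GRing.isMonoidMorphism.Build _ _ quot_map
  quot_map_is_monoid_morphism.
End QuotMap.
Arguments quot_map {R S} f I x.

Section Norms.
Variables (R : realType) (V : zmodType) (N : V -> R).

Definition nonarch_norm : Prop :=
  [/\ forall x, 0 <= N x,
      forall x, N x = 0 <-> x = 0 &
      forall x y, N (x - y) <= Num.max (N x) (N y)].

Definition norm_open (U : set V) : Prop :=
  forall x, U x -> exists2 e, 0 < e & forall y, N (y - x) < e -> U y.

Definition norm_closure (S : set V) : set V :=
  [set x | forall e, 0 < e -> exists2 y, S y & N (x - y) < e].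

Definition norm_complete : Prop :=
  forall u : nat -> V,
    (forall e, 0 < e -> exists K : nat, forall i j,
       (K <= i)%N -> (K <= j)%N -> N (u i - u j) < e) ->
    exists l, N (u i - l) @[i --> \oo] --> (0 : R).

Hypothesis NP : nonarch_norm.

Lemma nnorm_ge0 x : 0 <= N x. Proof. by case: NP. Qed.
Lemma nnorm_eq0 x : N x = 0 -> x = 0.
Proof. by case: NP => _ h _ /h. Qed.
Lemma nnorm0 : N 0 = 0. Proof. by case: NP => _ h _; apply: (h 0).2. Qed.
Lemma nnormB x y : N (x - y) <= Num.max (N x) (N y).
Proof. by case: NP. Qed.
Lemma nnormN x : N (- x) = N x.
Proof.
have le y : N (- y) <= N y.
  by have := nnormB 0 y; rewrite sub0r nnorm0 (max_idPr (nnorm_ge0 y)).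
by apply/eqP; rewrite eq_le le/= -{1}[x]opprK le.
Qed.
Lemma nnormD x y : N (x + y) <= Num.max (N x) (N y).
Proof. by rewrite -{1}[y]opprK -(nnormN y); exact: nnormB. Qed.

Lemma nnorm_sum_le (J : eqType) (s : seq J) (F : J -> V) c : 0 <= c ->
  (forall i, i \in s -> N (F i) <= c) -> N (\sum_(i <- s) F i) <= c.
Proof.
move=> c0; elim: s => [|a s IH] h; first by rewrite big_nil nnorm0.
rewrite big_cons (le_trans (nnormD _ _))// ge_max h ?mem_head//=.
by apply: IH => i si; apply: h; rewrite inE si orbT.
Qed.

Lemma nnorm_sum_lt (J : eqType) (s : seq J) (F : J -> V) c : 0 < c ->
  (forall i, i \in s -> N (F i) < c) -> N (\sum_(i <- s) F i) < c.
Proof.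
move=> c0; elim: s => [|a s IH] h; first by rewrite big_nil nnorm0.
rewrite big_cons (le_lt_trans (nnormD _ _))// gt_max h ?mem_head//=.
by apply: IH => i si; apply: h; rewrite inE si orbT.
Qed.

End Norms.

HB.mixin Record isBanachTate (R : realType) A of GRing.ComPzRing A := {
  bnorm : A -> R;
  bnormP : nonarch_norm bnorm;
  bnormM_le : forall x y : A, bnorm (x * y) <= bnorm x * bnorm y;
  bnorm_complete : norm_complete bnorm;
  bnorm_tate : exists2 u : A, exists v : A, u * v = 1 &
    bnorm (u ^+ k) @[k --> \oo] --> (0 : R)
}.

#[short(type="banachTateType")]
HB.structure Definition BanachTate (R : realType) :=
  {A of GRing.ComPzRing A & isBanachTate R A}.

Section ClosureIdeal.
Variables (R : realType) (A : banachTateType R) (I : ideal A).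
Local Notation N := (@bnorm R A).

Lemma closure0 : norm_closure N I 0.
Proof.
move=> e e0; exists 0; first exact: ideal0.
by rewrite subrr (nnorm0 bnormP).
Qed.
Lemma closureD x y :
  norm_closure N I x -> norm_closure N I y -> norm_closure N I (x + y).
Proof.
move=> hx hy e e0; have [x' Ix xx] := hx e e0; have [y' Iy yy] := hy e e0.
exists (x' + y'); first exact: idealD.
by rewrite opprD addrACA (le_lt_trans (nnormD bnormP _ _))// gt_max xx.
Qed.
Lemma closureM a x : norm_closure N I x -> norm_closure N I (a * x).
Proof.
move=> hx e e0; have Na0 : 0 < N a + 1 by rewrite ltr_wpDl// (nnorm_ge0 bnormP).
have [x' Ix xx] := hx (e / (N a + 1)) (divr_gt0 e0 Na0).
exists (a * x'); first exact: idealM.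
rewrite -mulrBr (le_lt_trans (bnormM_le _ _))//.
rewrite (@le_lt_trans _ _ ((N a + 1) * N (x - x')))//.
  by rewrite ler_wpM2r// ?(nnorm_ge0 bnormP)// lerDl.
by rewrite mulrC -ltr_pdivlMr.
Qed.

Definition closure_ideal : ideal A := Ideal closure0 closureD closureM.
End ClosureIdeal.

(* mon n is the type of exponents of monomials in n variables.                *)
Notation mon n := {ffun 'I_n -> nat}.

Section Monomials.
Variable n : nat.
Implicit Types a b m : mon n.

Definition mon_le a m := [forall i, (a i <= m i)%N].
Definition mon_sub m a : mon n := [ffun i => (m i - a i)%N].
Definition mon_below m : seq (mon n) :=
  undup [seq a <- [seq [ffun i => val (b i)]
                  | b : {ffun 'I_n -> 'I_(\max_i m i).+1}]
        | mon_le a m].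

Lemma mon_belowE m a : (a \in mon_below m) = mon_le a m.
Proof.
rewrite mem_undup mem_filter; case: (boolP (mon_le a m)) => //= /forallP h.
apply/mapP; exists [ffun i => inord (a i)]; first by rewrite mem_enum.
apply/ffunP => i; rewrite !ffunE inordK// ltnS (leq_trans (h i))//.
exact: leq_bigmax.
Qed.
Lemma mon_below_uniq m : uniq (mon_below m). Proof. exact: undup_uniq. Qed.

Lemma monDE a b i : (a + b) i = (a i + b i)%N. Proof. by rewrite ffunE. Qed.

Lemma mon_le_addr a b : mon_le a (a + b).
Proof. by apply/forallP => i; rewrite monDE leq_addr. Qed.
Lemma mon_addK a b : mon_sub (a + b) a = b.
Proof. by apply/ffunP => i; rewrite ffunE monDE addKn. Qed.
Lemma mon_subK m a : mon_le a m -> a + mon_sub m a = m.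
Proof. by move=> /forallP h; apply/ffunP => i; rewrite monDE ffunE subnKC. Qed.
Lemma mon_le_sub m a : mon_le (mon_sub m a) m.
Proof. by apply/forallP => i; rewrite ffunE leq_subr. Qed.
Lemma mon_subKn m a : mon_le a m -> mon_sub m (mon_sub m a) = a.
Proof. by move=> h; rewrite -{1}(mon_subK h) addrC mon_addK. Qed.
Lemma mon_le_trans a b m : mon_le a b -> mon_le b m -> mon_le a m.
Proof.
by move=> /forallP h1 /forallP h2; apply/forallP => i; exact: leq_trans (h1 i) _.
Qed.
Lemma mon_sub_add m a b : mon_sub m (a + b) = mon_sub (mon_sub m a) b.
Proof. by apply/ffunP => i; rewrite !ffunE subnDA. Qed.
Lemma mon_addI a : injective (fun b => a + b : mon n).
Proof. by move=> b c h; rewrite -(mon_addK a b) h mon_addK. Qed.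
Lemma mon_le_add2 m a b : mon_le a m -> mon_le (a + b) m = mon_le b (mon_sub m a).
Proof.
move=> /forallP h; apply/forallP/forallP => k i; have := k i;
  by rewrite monDE ffunE leq_subRL.
Qed.

End Monomials.

Section PowerSeries.
Variables (n : nat) (A : comPzRingType).
Implicit Types f g h : mon n -> A.

Definition cauchy_prod f g : mon n -> A :=
  fun m => \sum_(p \in [set p : mon n * mon n | p.1 + p.2 = m]) f p.1 * g p.2.

Lemma cauchy_prodE f g m :
  cauchy_prod f g m = \sum_(a <- mon_below m) f a * g (mon_sub m a).
Proof.
rewrite /cauchy_prod (fsbigE [seq (a, mon_sub m a) | a <- mon_below m]).
- by rewrite big_map [LHS]big_mkcond [RHS]big_seq [LHS]big_seq;
    apply: eq_bigr => a; rewrite mon_belowE => h; rewrite ifT// inE/= mon_subK.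
- by rewrite map_inj_uniq ?mon_below_uniq// => a b [].
- by move=> _ /= /mapP[a + ->]; rewrite mon_belowE => /= /mon_subK.
- move=> [a b] /= <- /mapP[]; exists a; first by rewrite mon_belowE mon_le_addr.
  by rewrite mon_addK.
Qed.

Definition const_series (c : A) : mon n -> A := fun m => if m == 0 then c else 0.

Lemma cauchy_prodC f g : cauchy_prod f g = cauchy_prod g f.
Proof.
apply/funext => m; rewrite !cauchy_prodE.
rewrite (perm_big [seq mon_sub m a | a <- mon_below m]); last first.
  apply: uniq_perm; rewrite ?mon_below_uniq//.
    rewrite map_inj_in_uniq ?mon_below_uniq// => a b.
    by rewrite !mon_belowE => ha hb hab; rewrite -(mon_subKn ha) hab mon_subKn.
  move=> a; rewrite mon_belowE; apply/idP/mapP => [h|[b _ ->]].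
    exists (mon_sub m a); first by rewrite mon_belowE mon_le_sub.
    by rewrite mon_subKn.
  exact: mon_le_sub.
rewrite big_map big_seq [RHS]big_seq; apply: eq_bigr => a.
by rewrite mon_belowE => ha; rewrite mon_subKn// mulrC.
Qed.

Lemma cauchy_prodCl c f m : cauchy_prod (const_series c) f m = c * f m.
Proof.
rewrite cauchy_prodE (bigD1_seq 0) ?mon_below_uniq//=; last first.
  by rewrite mon_belowE; apply/forallP => i; rewrite ffunE.
rewrite big1 ?addr0 => [|a a0]; last first.
  by rewrite /const_series (negbTE a0) mul0r.
by rewrite /const_series eqxx -{1}[m]add0r mon_addK.
Qed.

Lemma cauchy_prodDl f g h :
  cauchy_prod (f \+ g) h = cauchy_prod f h \+ cauchy_prod g h.
Proof.
apply/funext => m /=; rewrite !cauchy_prodE -big_split.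
by apply: eq_bigr => a _; rewrite mulrDl.
Qed.

Lemma cauchy_prodA f g h :
  cauchy_prod f (cauchy_prod g h) = cauchy_prod (cauchy_prod f g) h.
Proof.
apply/funext => m; rewrite !cauchy_prodE.
pose s := mon_below m.
transitivity (\sum_(a <- s) \sum_(p <- s | mon_le a p)
                f a * (g (mon_sub p a) * h (mon_sub m p))); last first.
  rewrite [LHS](exchange_big_dep xpredT)//=.
  rewrite big_seq [RHS]big_seq; apply: eq_bigr => p.
  rewrite mon_belowE => hp; rewrite cauchy_prodE big_distrl/=.
  rewrite -big_filter; apply: etrans.
    apply: perm_big; apply: (@uniq_perm _ _ (mon_below p)).
    - by rewrite filter_uniq ?mon_below_uniq.
    - exact: mon_below_uniq.
    - move=> a; rewrite mem_filter !mon_belowE andb_idr// => h1.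
      exact: mon_le_trans h1 hp.
  by apply: eq_bigr => a _; rewrite mulrA.
rewrite big_seq [RHS]big_seq; apply: eq_bigr => a.
rewrite mon_belowE => ha; rewrite cauchy_prodE big_distrr/=.
rewrite -[RHS]big_filter.
rewrite [RHS](perm_big [seq a + b | b <- mon_below (mon_sub m a)]).
  rewrite big_map; apply: eq_bigr => b _.
  by rewrite mon_addK mon_sub_add.
apply: uniq_perm.
- by rewrite filter_uniq ?mon_below_uniq.
- by rewrite (map_inj_uniq (@mon_addI _ a)) mon_below_uniq.
- move=> p; rewrite mem_filter mon_belowE; apply/andP/mapP => [[h1 h2]|[b]].
    exists (mon_sub p a); last by rewrite mon_subK.
    by rewrite mon_belowE -mon_le_add2// mon_subK.
  by rewrite mon_belowE => h1 ->; rewrite mon_le_addr mon_le_add2.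
Qed.

End PowerSeries.

(* A<T_1, ..., T_n>: the coefficients tend to 0 along the cofinite filter on  *)
(* exponents; the norm (instance below) is the Gauss norm.                    *)
Record tate (R : realType) (A : banachTateType R) (n : nat) : Type := Tate {
  coef :> mon n -> A;
  coef_to0 : forall e : R, 0 < e -> finite_set [set m | e <= bnorm (coef m)] }.

Section TateAlgebra.
Variables (R : realType) (A : banachTateType R) (n : nat).
Local Notation N := (@bnorm R A).
Local Notation to0 F :=
  (forall e : R, 0 < e -> finite_set [set m | e <= N (F m)]).
Implicit Types f g h : tate A n.

HB.instance Definition _ := gen_eqMixin (tate A n).
HB.instance Definition _ := gen_choiceMixin (tate A n).

Lemma tateP f g : (forall m, f m = g m) -> f = g.
Proof.
case: f g => [f pf] [g pg] /= /funext fg; case: _ / fg pg => pg.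
by congr Tate; exact: Prop_irrelevance.
Qed.

Definition gauss_norm f : R := sup (range (fun m => N (f m))).

Lemma gauss_ubound f : has_ubound (range (fun m => N (f m))).
Proof.
have D := @coef_to0 _ _ _ f 1 ltr01.
exists (1 + \sum_(m <- fset_set [set m | 1 <= N (f m)]) N (f m)).
move=> _ [m _ <-]; have [lt1|le1] := ltP (N (f m)) 1.
  apply: (le_trans (ltW lt1)); rewrite lerDl sumr_ge0// => a _.
  exact: nnorm_ge0 bnormP _.
rewrite (bigD1_seq m) ?fset_uniq//=; last by rewrite in_fset_set// inE.
rewrite addrCA lerDl addr_ge0// sumr_ge0// => a _.
exact: nnorm_ge0 bnormP _.
Qed.

Lemma coef_le_gauss f m : N (f m) <= gauss_norm f.
Proof. by apply: ub_le_sup; [exact: gauss_ubound|exists m]. Qed.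

Lemma gauss_le f c : (forall m, N (f m) <= c) -> gauss_norm f <= c.
Proof.
move=> h; apply: ge_sup; first by exists (N (f 0)), 0.
by move=> _ [m _ <-].
Qed.

Lemma gauss_ge0 f : 0 <= gauss_norm f.
Proof. by apply: le_trans (coef_le_gauss f 0); exact: nnorm_ge0 bnormP _. Qed.

Lemma tate_zero_to0 : to0 (fun _ : mon n => 0 : A).
Proof.
move=> e e0; rewrite (_ : mkset _ = set0)//; apply/seteqP; split => // m /=.
by rewrite (nnorm0 bnormP) leNgt e0.
Qed.
Lemma tate_opp_to0 f : to0 (fun m => - f m).
Proof.
move=> e e0; under eq_set do rewrite (nnormN bnormP).
exact: coef_to0.
Qed.
Lemma tate_add_to0 f g : to0 (fun m => f m + g m).
Proof.
move=> e e0; apply: (@sub_finite_set _ _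
  ([set m | e <= N (f m)] `|` [set m | e <= N (g m)])).
  move=> m /= h; have := le_trans h (nnormD bnormP _ _).
  by rewrite le_max => /orP[]; [left|right].
by rewrite finite_setU; split; exact: coef_to0.
Qed.
Lemma tate_const_to0 (c : A) : to0 (@const_series n A c).
Proof.
move=> e e0; apply: (@sub_finite_set _ _ [set 0]); last exact: finite_set1.
move=> m /=; rewrite /const_series; case: eqP => // _.
by rewrite (nnorm0 bnormP) leNgt e0.
Qed.
Lemma tate_mul_to0 f g : to0 (cauchy_prod f g).
Proof.
move=> e e0; pose C := gauss_norm f + gauss_norm g + 1.
have C0 : 0 < C by rewrite ltr_wpDl// addr_ge0 ?gauss_ge0.
have fC m : N (f m) <= C.
  by rewrite (le_trans (coef_le_gauss f m))// /C -addrA lerDl addr_ge0 ?gauss_ge0.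
have gC m : N (g m) <= C.
  rewrite (le_trans (coef_le_gauss g m))// /C addrAC lerDr addr_ge0//.
  exact: gauss_ge0.
have eC0 : 0 < e / C by exact: divr_gt0.
pose S f := [set m | e / C <= N (f m)].
apply: (@sub_finite_set _ _ ((fun p => p.1 + p.2) @` (S f `*` S g))); last first.
  by apply: finite_image; apply: finite_setX; exact: coef_to0.
move=> m /= em; apply: contrapT => nh; move: em; apply/negP; rewrite -ltNge.
rewrite cauchy_prodE; apply: (nnorm_sum_lt bnormP) => // a.
rewrite mon_belowE => am; rewrite (le_lt_trans (bnormM_le _ _))//.
rewrite ltNge; apply/negP => le; apply: nh.
exists (a, mon_sub m a); last by rewrite /= mon_subK.
split => /=; rewrite /S /= ler_pdivrMr// (le_trans le)//.
  by rewrite ler_wpM2l// (nnorm_ge0 bnormP).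
by rewrite mulrC ler_wpM2l// (nnorm_ge0 bnormP).
Qed.

Definition tate_zero := Tate tate_zero_to0.
Definition tate_opp f := Tate (tate_opp_to0 f).
Definition tate_add f g := Tate (tate_add_to0 f g).
Definition tateC (c : A) : tate A n := Tate (tate_const_to0 c).
Definition tate_mul f g := Tate (tate_mul_to0 f g).

Lemma tate_addA : associative tate_add.
Proof. by move=> f g h; apply: tateP => m /=; rewrite addrA. Qed.
Lemma tate_addC : commutative tate_add.
Proof. by move=> f g; apply: tateP => m /=; rewrite addrC. Qed.
Lemma tate_add0 : left_id tate_zero tate_add.
Proof. by move=> f; apply: tateP => m /=; rewrite add0r. Qed.
Lemma tate_addN : left_inverse tate_zero tate_opp tate_add.
Proof. by move=> f; apply: tateP => m /=; rewrite addNr. Qed.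

HB.instance Definition _ := GRing.isZmodule.Build (tate A n)
  tate_addA tate_addC tate_add0 tate_addN.

Lemma tate_mulA : associative tate_mul.
Proof. by move=> f g h; apply: tateP => m /=; rewrite cauchy_prodA. Qed.
Lemma tate_mulC : commutative tate_mul.
Proof. by move=> f g; apply: tateP => m /=; rewrite cauchy_prodC. Qed.
Lemma tate_mul1 : left_id (tateC 1) tate_mul.
Proof. by move=> f; apply: tateP => m /=; rewrite cauchy_prodCl mul1r. Qed.
Lemma tate_mulD : left_distributive tate_mul +%R.
Proof.
move=> f g h; apply: tateP => m /=.
exact: (congr1 (fun F => F m) (cauchy_prodDl _ _ _)).
Qed.

HB.instance Definition _ := GRing.Zmodule_isComPzRing.Build (tate A n)
  tate_mulA tate_mulC tate_mul1 tate_mulD.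

Lemma tateC_is_zmod_morphism : zmod_morphism tateC.
Proof.
move=> a b; apply: tateP => m /=; rewrite /const_series.
by case: eqP; rewrite ?subr0.
Qed.
Lemma tateC_is_monoid_morphism : monoid_morphism tateC.
Proof.
split=> // a b; apply: tateP => m /=.
by rewrite cauchy_prodCl /const_series; case: eqP; rewrite ?mulr0.
Qed.
HB.instance Definition _ := GRing.isZmodMorphism.Build A (tate A n) tateC
  tateC_is_zmod_morphism.
HB.instance Definition _ := GRing.isMonoidMorphism.Build A (tate A n) tateC
  tateC_is_monoid_morphism.

Definition var_series (i : 'I_n) : mon n -> A :=
  fun m => if m == [ffun j => (j == i) : nat] then 1 else 0.

Lemma tate_var_to0 i : to0 (var_series i).
Proof.
move=> e e0; apply: (@sub_finite_set _ _ [set [ffun j => (j == i) : nat]]);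
  last exact: finite_set1.
move=> m /=; rewrite /var_series; case: eqP => // _.
by rewrite (nnorm0 bnormP) leNgt e0.
Qed.
Definition tateX i : tate A n := Tate (tate_var_to0 i).

Lemma gauss_normP : nonarch_norm gauss_norm.
Proof.
split; first exact: gauss_ge0.
  move=> f; split=> [f0|->].
    apply: tateP => m; apply: (nnorm_eq0 bnormP); apply/eqP.
    by rewrite eq_le (nnorm_ge0 bnormP) -f0 coef_le_gauss.
  apply/eqP; rewrite eq_le gauss_ge0 gauss_le// => m.
  by rewrite (nnorm0 bnormP).
move=> f g; apply: gauss_le => m; rewrite (le_trans (nnormB bnormP _ _))//.
by rewrite ge_max !le_max !coef_le_gauss orbT.
Qed.

Lemma gauss_normM_le f g : gauss_norm (f * g) <= gauss_norm f * gauss_norm g.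
Proof.
apply: gauss_le => m; rewrite [X in N X]cauchy_prodE.
apply: (nnorm_sum_le bnormP); first by rewrite mulr_ge0 ?gauss_ge0.
move=> a _; rewrite (le_trans (bnormM_le _ _))//.
by rewrite ler_pM ?coef_le_gauss// (nnorm_ge0 bnormP).
Qed.

Lemma cvg0P (u : nat -> R) : (forall i, 0 <= u i) ->
  u i @[i --> \oo] --> (0 : R) <->
  forall e, 0 < e -> exists K : nat, forall i, (K <= i)%N -> u i < e.
Proof.
move=> u0; split.
  move=> /cvgrPdist_lt h e e0; have [K _ hK] := h e e0; exists K => i Ki.
  by have := hK i Ki; rewrite /= sub0r normrN ger0_norm.
move=> h; apply/cvgrPdist_lt => e e0; have [K hK] := h e e0.
by exists K => // i Ki; rewrite /= sub0r normrN ger0_norm// hK.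
Qed.

Lemma gauss_complete : norm_complete gauss_norm.
Proof.
move=> u cu.
have cum m e : 0 < e -> exists K : nat, forall i j,
    (K <= i)%N -> (K <= j)%N -> N (u i m - u j m) < e.
  move=> e0; have [K hK] := cu e e0; exists K => i j Ki Kj.
  exact: le_lt_trans (coef_le_gauss (u i - u j) m) (hK i j Ki Kj).
have /choice[l hl] m := @bnorm_complete R A (fun i => u i m) (cum m).
have key e : 0 < e -> exists K : nat, forall i m,
    (K <= i)%N -> N (u i m - l m) < e.
  move=> e0; have [K hK] := cu e e0; exists K => i m Ki.
  have [K' hK'] := (cvg0P (fun i => nnorm_ge0 bnormP _)).1 (hl m) e e0.
  pose j := maxn K K'.
  rewrite -(subrKA (u j m)) (le_lt_trans (nnormD bnormP _ _))// gt_max.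
  rewrite hK' ?leq_maxr// andbT.
  by rewrite (le_lt_trans (coef_le_gauss (u i - u j) m))// hK// leq_maxl.
have l0 : to0 l.
  move=> e e0; have [K hK] := key e e0.
  apply: sub_finite_set (@coef_to0 _ _ _ (u K) e e0) => m /= em.
  rewrite leNgt; apply/negP => uKm; move: em; apply/negP; rewrite -ltNge.
  have -> : l m = u K m - (u K m - l m) by rewrite subKr.
  by rewrite (le_lt_trans (nnormB bnormP _ _))// gt_max uKm hK.
exists (Tate l0); apply/cvg0P => [i|e e0]; first exact: gauss_ge0.
have e20 : 0 < e / 2 by rewrite divr_gt0.
have [K hK] := key _ e20; exists K => i Ki.
apply: (@le_lt_trans _ _ (e / 2)); last by rewrite gtr_pMr// invf_lt1// ltr1n.
by apply: gauss_le => m; exact: ltW (hK i m Ki).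
Qed.

Lemma gauss_normC c : gauss_norm (tateC c) = N c.
Proof.
apply/eqP; rewrite eq_le; apply/andP; split.
  apply: gauss_le => m /=; rewrite /const_series; case: eqP => // _.
  by rewrite (nnorm0 bnormP) (nnorm_ge0 bnormP).
by apply: le_trans (coef_le_gauss _ 0); rewrite /= /const_series eqxx.
Qed.

Lemma gauss_tate : exists2 u : tate A n, exists v, u * v = 1 &
  gauss_norm (u ^+ k) @[k --> \oo] --> (0 : R).
Proof.
have [u [v uv] u0] := @bnorm_tate R A; exists (tateC u).
  by exists (tateC v); rewrite -rmorphM uv rmorph1.
by under eq_cvg do rewrite -rmorphXn gauss_normC.
Qed.

HB.instance Definition _ := isBanachTate.Build R (tate A n)
  gauss_normP gauss_normM_le gauss_complete gauss_tate.

End TateAlgebra.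

Section RationalLocalization.
Variables (R : realType) (A : banachTateType R).

Definition rat_ideal k (f : 'I_k -> A) (g : A) : ideal (tate A k) :=
  closure_ideal (span_ideal (fun i => tateC k g * tateX A i - tateC k (f i))).

(* Only the underlying A-algebra of a rational localization is recorded; B is *)
(* determined up to isomorphism of A-algebras.                                *)
Definition is_rational_localization (B : comPzRingType)
    (h : {rmorphism A -> B}) : Prop :=
  exists (k : nat) (f : 'I_k -> A) (g : A),
    (exists (c : 'I_k -> A) (d : A), \sum_i c i * f i + d * g = 1) /\
    exists2 psi : {rmorphism quot (rat_ideal f g) -> B}, bijective psi &
      forall a, h a = psi (quot_pi (rat_ideal f g) (tateC k a)).

Definition weak_nullstellensatz : Prop :=
  forall (B : comPzRingType) (h : {rmorphism A -> B}),
    is_rational_localization h ->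
    forall m : ideal B, maximal_ideal m -> finite_hom (quot_map h m).

(* The quotient topology on A / I.                                            *)
Definition quot_open (I : ideal A) (U : set (quot I)) : Prop :=
  norm_open (@bnorm R A) (quot_pi I @^-1` U).

Definition strong_nullstellensatz : Prop :=
  weak_nullstellensatz /\
  forall m : ideal A, maximal_ideal m ->
    exists alpha : quot m -> R,
      [/\ nonarch_norm alpha,
          forall x y, alpha (x * y) = alpha x * alpha y &
          forall U : set (quot m), quot_open U <-> norm_open alpha U].

End RationalLocalization.

(* Main.v *)
Require Import Defs.
From HB Require Import structures.
From mathcomp Require Import all_boot all_order all_algebra.
From mathcomp Require Import all_classical all_reals all_analysis.
From mathcomp Require Import ring zify.
Set Implicit Arguments.
Unset Strict Implicit.
Unset Printing Implicit Defensive.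
Import Order.TTheory GRing.Theory Num.Theory.
Local Open Scope ring_scope.

(* Preimages of maximal ideals under surjective or finite maps are maximal, and *)
(* a rational localization of A<T_1, ..., T_n> is a quotient of some            *)
(* A<T_1, ..., T_N>; so both (a, weak) and (b) follow once every maximal ideal  *)
(* M of A<T_1, ..., T_n> has residue field K finite over A. By induction on n,  *)
(* and for relative Tate algebras over rational localizations of A: choose a    *)
(* rank-one valuation on K (a maximal subring of K containing the image of the  *)
(* unit ball but not the inverse of a topologically nilpotent unit u). Some     *)
(* p in M has a nonzero coefficient in K; localizing A rationally so that the   *)
(* ratios of the coefficients of p to its dominant one become integral, and     *)
(* shearing the variables (T_j |-> T_j + T_1^(D^j)), p becomes                  *)
(* Weierstrass-distinguished in T_1, which removes one variable.                *)
(* For the strong property, K is finite over the complete valued field          *)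
(* A/(M \cap A), and the norm attached to the same valuation ring of K defines  *)
(* the quotient topology because any two separated topologies on a              *)
(* finite-dimensional space over a complete valued field agree.                 *)

(** * Ideals and finite modules *)

(** The induction runs on [finite_residue], which allows a rational localization of [A] in the base.
    Its case without variables is the weak property itself ([finite_residue0]). Rational
    localizations need no quotient: maximal ideals are closed ([maximal_closed]), so one that
    contains the relations g X_i - f_i contains the closure of the ideal they generate.

    The step [finite_residueS] is a Noether normalization. A relation p in M becomes monic in one
    variable only after division by a dominant coefficient. [valuation_above] and [dominant_term]
    say which coefficient dominates. The ratios lie in the fraction field of the image of [A], so
    they live on a finer rational localization, and [residue_extension] adjoins them as new
    variables without enlarging M. Then [shear_finite] removes a variable by [weierstrass_finite], a
    successive approximation ([topological_nakayama]).

    For the strong property, two lattices in the residue field are compared. The valuation ring V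
    contains the image of the unit ball, and [lattice_bounded] puts u^N V inside that image. The
    latter uses the completeness of [A] and the multiplicative norm downstairs
    ([bounded_or_inverse]). So the norm of V ([val_norm]) defines the quotient topology. *)

Definition subring_pred (Z : comPzRingType) (O : Z -> Prop) : Prop :=
  [/\ O 1, forall x y, O x -> O y -> O (x - y) &
      forall x y, O x -> O y -> O (x * y)].

Section SubringPred.
Variables (Z : comPzRingType) (O : Z -> Prop).
Hypothesis OP : subring_pred O.

Lemma subring1 : O 1. Proof. by case: OP. Qed.
Lemma subringB x y : O x -> O y -> O (x - y).
Proof. by case: OP => _ h _; exact: h. Qed.
Lemma subringM x y : O x -> O y -> O (x * y).
Proof. by case: OP => _ _; apply. Qed.
Lemma subring0 : O 0.
Proof. by rewrite -(subrr 1); apply: subringB; exact: subring1. Qed.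
Lemma subringN x : O x -> O (- x).
Proof. by rewrite -sub0r; apply: subringB; exact: subring0. Qed.
Lemma subringD x y : O x -> O y -> O (x + y).
Proof. by move=> Ox Oy; rewrite -[y]opprK; apply/subringB/subringN. Qed.
Lemma subringX x n : O x -> O (x ^+ n).
Proof.
move=> Ox; elim: n => [|n IH]; first by rewrite expr0; exact: subring1.
by rewrite exprS; exact: subringM.
Qed.
Lemma subring_sum (I : Type) (s : seq I) (P : pred I) (F : I -> Z) :
  (forall i, P i -> O (F i)) -> O (\sum_(i <- s | P i) F i).
Proof. by move=> h; apply: big_ind => //; [exact: subring0|exact: subringD]. Qed.
Lemma subring_prod (I : Type) (s : seq I) (P : pred I) (F : I -> Z) :
  (forall i, P i -> O (F i)) -> O (\prod_(i <- s | P i) F i).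
Proof. by move=> h; apply: big_ind => //; [exact: subring1|exact: subringM]. Qed.
End SubringPred.

Section IdealExtra.
Variables (R : comPzRingType) (I : ideal R).

Lemma ideal_sum (J : Type) (s : seq J) (P : pred J) (F : J -> R) :
  (forall i, P i -> I (F i)) -> I (\sum_(i <- s | P i) F i).
Proof. by move=> h; apply: big_ind => //; [exact: ideal0|exact: idealD]. Qed.

Lemma ideal_mulr x a : I x -> I (x * a).
Proof. by rewrite mulrC; exact: idealM. Qed.

Lemma quot_pi0 x : quot_pi I x = 0 <-> I x.
Proof. by rewrite -(rmorph0 (quot_pi I)) quot_piP subr0. Qed.

Lemma maximal_inv : maximal_ideal I ->
  forall x, ~ I x -> exists y, I (1 - x * y).
Proof.
move=> [I1 maxI] x nIx.
pose J := [set y | exists a b, I a /\ y = a + b * x]%classic.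
have J0 : J 0 by exists 0, 0; rewrite mul0r addr0; split=> //; exact: ideal0.
have JD y z : J y -> J z -> J (y + z).
  move=> [a [b [Ia ->]]] [a' [b' [Ia' ->]]]; exists (a + a'), (b + b').
  by split; [exact: idealD|ring].
have JM c y : J y -> J (c * y).
  move=> [a [b [Ia ->]]]; exists (c * a), (c * b).
  by split; [exact: idealM|ring].
apply: contrapT => h; apply: nIx; apply: (maxI (Ideal J0 JD JM)).
- by move=> y Iy; exists y, 0; rewrite mul0r addr0.
- move=> [a [b [Ia e]]]; apply: h; exists b.
  by rewrite {1}e mulrC addrK.
- by exists 0, 1; rewrite add0r mul1r; split=> //; exact: ideal0.
Qed.

Lemma inv_maximal : ~ I 1 ->
  (forall x, ~ I x -> exists y, I (1 - x * y)) -> maximal_ideal I.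
Proof.
move=> I1 inv; split=> // J IJ J1 x Jx; apply: contrapT => /inv[y Iy].
apply: J1; rewrite -(subrK (x * y) 1); apply: idealD; first exact: IJ.
by rewrite mulrC; exact: idealM.
Qed.

Lemma quot_field : maximal_ideal I ->
  forall x : quot I, x <> 0 -> exists y, x * y = 1.
Proof.
move=> maxI; elim/quot_ind => x x0.
have [|y Iy] := @maximal_inv maxI x; first by move=> /quot_pi0.
exists (quot_pi I y); rewrite -rmorphM -(rmorph1 (quot_pi I)).
by apply/esym/quot_piP.
Qed.

Lemma quot_one_neq0 : ~ I 1 -> (1 : quot I) <> 0.
Proof. by rewrite -(rmorph1 (quot_pi I)) => I1 /quot_pi0. Qed.
End IdealExtra.

Lemma quot_surj (R : comPzRingType) (I : ideal R) (z : quot I) :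
  exists x, z = quot_pi I x.
Proof. by elim/quot_ind: z => x; exists x. Qed.

Local Open Scope classical_set_scope.
Lemma Zorn_above (T : Type) (P : set (set T)) (S0 : set T) : P S0 ->
  (forall F : set (set T), F !=set0 -> F `<=` P -> total_on F subset ->
     P (\bigcup_(X in F) X)) ->
  exists S, [/\ P S, S0 `<=` S & forall S', P S' -> S `<=` S' -> S' `<=` S].
Proof.
(* Maximizing over the X with S0 [|] X in P forces the result to contain S0, and the empty chain
   then corresponds to S0 itself. *)
move=> PS0 chain; pose Q := [set X | P (S0 `|` X)]%classic.
have [F FQ totF|X [QX maxX]] := @Zorn_bigcup T Q.
  have [[X FX]|/nonemptyPn ->] := pselect (F !=set0)%classic; last first.
    by rewrite /Q /= bigcup_set0 setU0.
  have -> : Q (\bigcup_(X in F) X)%classic =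
      P (\bigcup_(Y in [set S0 `|` X | X in F]) Y)%classic.
    congr P; apply/seteqP; split=> t.
      move=> [S0t|[Y FY Yt]].
        by exists (S0 `|` X)%classic; [exists X|left].
      by exists (S0 `|` Y)%classic; [exists Y|right].
    by move=> [_ [Y FY <-]] [S0t|Yt]; [left|right; exists Y].
  apply: chain; first by exists (S0 `|` X)%classic, X.
    by move=> _ [Y FY <-]; exact: FQ.
  move=> _ _ [Y FY <-] [Y' FY' <-].
  by case: (totF _ _ FY FY') => h; [left|right]; exact: setUS.
exists (S0 `|` X)%classic; split=> //.
move=> S' PS' sub t S't; apply: contrapT => nt; apply: (maxX S').
  split=> [s Xs|sub']; first by apply: sub; right.
  by apply: nt; right; exact: sub'.
by rewrite /Q /= setUidr// => s S0s; apply: sub; left.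
Qed.
Local Close Scope classical_set_scope.

Lemma maximal_above (R : comPzRingType) (I : ideal R) : ~ I 1 ->
  exists2 M : ideal R, maximal_ideal M & forall x, I x -> M x.
Proof.
move=> I1.
pose P := [set S : set R | [/\ S 0, forall x y, S x -> S y -> S (x + y),
  forall a x, S x -> S (a * x) & ~ S 1]]%classic.
have [||S [[S0 SD SM S1] IS maxS]] := @Zorn_above R P I.
- by split=> //; [exact: ideal0|exact: idealD|exact: idealM].
- move=> F [S FS] FP totF; split.
  + by exists S => //; case: (FP _ FS).
  + move=> x y [X FX Xx] [Y FY Yy].
    have [XY|YX] := totF _ _ FX FY.
      by exists Y => //; have [_ D _ _] := FP _ FY; apply: D => //; exact: XY.
    by exists X => //; have [_ D _ _] := FP _ FX; apply: D => //; exact: YX.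
  + by move=> a x [X FX Xx]; exists X => //; have [_ _ M _] := FP _ FX; exact: M.
  + by move=> [X FX X1]; have [_ _ _] := FP _ FX; apply.
exists (Ideal S0 SD SM) => //; split=> // J SJ J1.
by apply: maxS => //; split=> //; [exact: ideal0|exact: idealD|exact: idealM].
Qed.

Section PreimMaximal.
Variables (R S : comPzRingType) (f : {rmorphism R -> S}).

Lemma preim_maximal_surj (M : ideal S) : (forall y, exists x, y = f x) ->
  maximal_ideal M -> maximal_ideal (preim_ideal f M).
Proof.
move=> surj maxM; apply: inv_maximal.
  by rewrite /= /preimage /= rmorph1; case: maxM.
move=> x nMx; have [y My] := maximal_inv maxM nMx.
have [z zE] := surj y; exists z.
by rewrite /= /preimage /= rmorphB rmorph1 rmorphM -zE.
Qed.
End PreimMaximal.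

(** Finiteness of S / I over R, phrased by congruences modulo I so that no quotient type is needed;
    [fin_mod_quot_map] is the bridge to [finite_hom]. *)
Definition fin_mod (R S : comPzRingType) (f : R -> S) (I : ideal S) : Prop :=
  exists (r : nat) (s : 'I_r -> S),
    forall y, exists c : 'I_r -> R, I (y - \sum_i f (c i) * s i).

Section FinMod.
Variables (R S : comPzRingType) (f : {rmorphism R -> S}) (I : ideal S).

Lemma fin_mod_quot_map : fin_mod f I <-> finite_hom (quot_map f I).
Proof.
split=> [[r [s h]]|[r [s h]]].
  exists r, (fun i => quot_pi I (s i)); elim/quot_ind => y.
  have [c Ic] := h y; exists (fun i => quot_pi _ (c i)).
  under eq_bigr do rewrite quot_mapE -rmorphM.
  by rewrite -raddf_sum; apply/quot_piP.
exists r, (fun i => repr (s i)) => y.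
have [c yE] := h (quot_pi I y); exists (fun i => repr (c i)).
apply/quot_piP; rewrite yE raddf_sum; apply: eq_bigr => i _.
rewrite [RHS]rmorphM /=; congr (_ * _); last by rewrite /quot_pi reprK.
Qed.

Lemma finite_fin_mod : finite_hom f -> fin_mod f I.
Proof.
move=> [r [s h]]; exists r, s => y; have [c ->] := h y; exists c.
by rewrite subrr; exact: ideal0.
Qed.

(* Nakayama's trick: if [c] is invertible in [S / I], then [S / I = c (S / I)], *)
(* so some [1 - c a] kills [S / I].                                           *)
Lemma preim_maximal_fin : fin_mod f I -> maximal_ideal I ->
  maximal_ideal (preim_ideal f I).
Proof.
move=> [r [s h]] maxI; apply: inv_maximal.
  by rewrite /= /preimage /= rmorph1; case: maxI.
move=> c nIc; have [y0 Iy0] := maximal_inv maxI nIc.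
(* Some 1 - c a maps S / I into the span of the first q generators; q descends from r, where a = 0
   works, to 0. *)
suff key q : (q <= r)%N -> exists a, forall y, exists d : 'I_r -> R,
    I (f (1 - c * a) * y - \sum_(i < r | (i < q)%N) f (d i) * s i).
  have [a /(_ 1)[d]] := key 0%N isT.
  by rewrite big1 // subr0 mulr1; exists a.
move=> qr; rewrite -(subKn qr); elim: (r - q)%N (leq_subr q r) => [|p IH] pr.
  rewrite subn0; exists 0 => y; have [d Id] := h y; exists d.
  rewrite mulr0 subr0 rmorph1 mul1r (eq_bigl xpredT) // => i.
  exact: ltn_ord.
have [a ha] := IH (ltnW pr).
have lt : (r - p.+1 < r)%N by rewrite ltn_subrL; case: (r) pr.
pose j := Ordinal lt.
have split_sum d : \sum_(i < r | (i < r - p)%N) f (d i) * s i =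
    f (d j) * s j + \sum_(i < r | (i < r - p.+1)%N) f (d i) * s i.
  rewrite (bigD1 j) /=; last by rewrite ltn_sub2l.
  congr (_ + _); apply: eq_bigl => i.
  by rewrite -val_eqE /= andbC -(subnSK pr) ltnS -ltn_neqAle.
have [d Id] := ha (y0 * s j).
(* As c y0 = 1 modulo I, the relation for y0 s_j gives (1 - c a - c d_j) s_j = c S1 there. The
   witness is the a' with 1 - c a' = (1 - c a) (1 - c a - c d_j), which eliminates s_j. *)
exists (a + a + d j - c * a * a - c * a * d j) => y.
have [d' Id'] := ha y.
exists (fun i => (1 - c * a - c * d j) * d' i + c * d' j * d i).
have -> : \sum_(i < r | (i < r - p.+1)%N)
    f ((1 - c * a - c * d j) * d' i + c * d' j * d i) * s i =
  f (1 - c * a - c * d j) * (\sum_(i < r | (i < r - p.+1)%N) f (d' i) * s i) +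
  f (c * d' j) * \sum_(i < r | (i < r - p.+1)%N) f (d i) * s i.
  rewrite !mulr_sumr -big_split; apply: eq_bigr => i _.
  by rewrite rmorphD !rmorphM /=; ring.
rewrite split_sum in Id; rewrite split_sum in Id'.
set S1 := \sum_(i < r | _) _ in Id *; set S2 := \sum_(i < r | _) _ in Id' *.
have -> : f (1 - c * (a + a + d j - c * a * a - c * a * d j)) * y -
    (f (1 - c * a - c * d j) * S2 + f (c * d' j) * S1) =
  f (1 - c * a - c * d j) * (f (1 - c * a) * y - (f (d' j) * s j + S2)) +
  f (c * d' j) * (f (1 - c * a) * (y0 * s j) - (f (d j) * s j + S1)) +
  f (d' j) * f (1 - c * a) * s j * (1 - f c * y0).
  by rewrite !(rmorphB, rmorphD, rmorphM, rmorph1) /=; ring.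
by apply: idealD; [apply: idealD|]; exact: idealM.
Qed.
End FinMod.

Lemma fin_mod_finType (R S : comPzRingType) (f : R -> S) (I : ideal S)
    (J : finType) (s : J -> S) :
  (forall y, exists c : J -> R, I (y - \sum_i f (c i) * s i)) -> fin_mod f I.
Proof.
move=> h; exists #|J|, (fun i => s (enum_val i)) => y.
have [c Ic] := h y; exists (fun i => c (enum_val i)).
by rewrite -(big_enum_val (fun i : J => f (c i) * s i)).
Qed.

Lemma fin_mod_le (R S : comPzRingType) (f : R -> S) (I J : ideal S) :
  (forall x, I x -> J x) -> fin_mod f I -> fin_mod f J.
Proof.
move=> IJ [r [s h]]; exists r, s => y; have [c Ic] := h y.
by exists c; exact: IJ.
Qed.

Lemma fin_mod_comp (R S T : comPzRingType) (f : R -> S) (g : {rmorphism S -> T})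
    (h : R -> T) (I : ideal T) : (forall a, h a = g (f a)) ->
  fin_mod f (preim_ideal g I) -> fin_mod g I -> fin_mod h I.
Proof.
move=> hE [r [s hs]] [q [t ht]].
apply: (@fin_mod_finType _ _ _ _ ('I_q * 'I_r)%type
  (fun p => g (s p.2) * t p.1)) => y.
have [c Ic] := ht y.
have /choice[d Id] i := hs (c i).
exists (fun p => d p.1 p.2).
rewrite -(pair_bigA _ (fun i j => h (d i j) * (g (s j) * t i))) /=.
rewrite -(subrKA (\sum_i g (c i) * t i)); apply: idealD => //.
rewrite -sumrB; apply: ideal_sum => i _.
have -> : \sum_j h (d i j) * (g (s j) * t i) =
    g (\sum_j f (d i j) * s j) * t i.
  rewrite rmorph_sum mulr_suml; apply: eq_bigr => j _.
  by rewrite hE rmorphM mulrA.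
by rewrite -mulrBl -rmorphB mulrC; apply: idealM; exact: Id.
Qed.

Lemma fin_mod_right (R S T : comPzRingType) (f : R -> S) (g : S -> T)
    (h : R -> T) (I : ideal T) : (forall a, h a = g (f a)) ->
  fin_mod h I -> fin_mod g I.
Proof.
move=> hE [r [s hs]]; exists r, s => y; have [c Ic] := hs y.
by exists (fun i => f (c i)); under eq_bigr do rewrite -hE.
Qed.

Lemma fin_mod_surj (R S T : comPzRingType) (f : R -> S) (g : {rmorphism S -> T})
    (h : R -> T) (I : ideal T) : (forall a, h a = g (f a)) ->
  (forall y, exists x, y = g x) ->
  fin_mod f (preim_ideal g I) <-> fin_mod h I.
Proof.
move=> hE surj; split=> [[r [s hs]]|[r [s hs]]].
  exists r, (fun i => g (s i)) => y; have [x ->] := surj y.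
  have [c Ic] := hs x; exists c; under eq_bigr do rewrite hE -rmorphM.
  by rewrite -rmorph_sum -rmorphB.
have /choice[t tE] i := surj (s i).
exists r, t => y; have [c Ic] := hs (g y); exists c.
rewrite /= /preimage /= rmorphB rmorph_sum.
by under eq_bigr do rewrite rmorphM -hE -tE.
Qed.

Section FinSub.
Variables (R S : comPzRingType) (f : {rmorphism R -> S}) (I : ideal S).
Hypothesis inv : forall c, ~ I (f c) -> exists d, I (1 - f (c * d)).

(** Subspaces of a finite-dimensional space are finite-dimensional. An element of [H] with nonzero
    last coordinate joins the generators and clears that coordinate in the others; if there is none,
    the last generator is dropped. *)
Lemma fin_mod_subspace r (s : nat -> S) (H : S -> Prop) :
  (forall x y, H x -> H y -> H (x + y)) -> (forall a x, H x -> H (f a * x)) ->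
  (forall y, H y -> exists c : nat -> R, I (y - \sum_(i < r) f (c i) * s i)) ->
  exists r' (s' : nat -> S), (forall i, (i < r')%N -> H (s' i)) /\
    forall y, H y -> exists c : nat -> R, I (y - \sum_(i < r') f (c i) * s' i).
Proof.
elim: r H => [|r IH] H HD HM Hs; first by exists 0%N, s.
pose spn y := exists c : nat -> R, I (y - \sum_(i < r) f (c i) * s i).
have [[x [c [Hx Ix nIc]]]|no] := pselect (exists x (c : nat -> R),
  [/\ H x, I (x - \sum_(i < r.+1) f (c i) * s i) & ~ I (f (c r))]); last first.
  apply: IH => // y Hy; have [c Ic] := Hs y Hy; exists c.
  have Icr : I (f (c r)) by apply: contrapT => h; apply: no; exists y, c.
  rewrite big_ord_recr /= opprD addrA in Ic.
  rewrite -(subrK (f (c r) * s r) (_ - _)); apply: idealD => //; exact: ideal_mulr.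
have [d Id] := inv nIc.
pose H' y := H y /\ spn y.
have HN y : H y -> H (- y).
  by move=> Hy; rewrite -mulN1r -(rmorph1 f) -rmorphN; exact: HM.
have [|||r' [s' [Hs' gen]]] := IH H'.
- move=> y z [Hy [c1 I1]] [Hz [c2 I2]]; split; first exact: HD.
  exists (fun i => c1 i + c2 i).
  under eq_bigr do rewrite rmorphD mulrDl.
  by rewrite big_split /= opprD addrACA; exact: idealD.
- move=> a y [Hy [c1 I1]]; split; first exact: HM.
  exists (fun i => a * c1 i); under eq_bigr do rewrite rmorphM -mulrA.
  by rewrite -mulr_sumr -mulrBr; exact: idealM.
- by move=> y [].
exists r'.+1, (fun i => if i is i'.+1 then s' i' else f d * x); split.
  by case=> [_|i /Hs'[]//]; exact: HM.
move=> y Hy; have [e Ie] := Hs y Hy.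
have [|c' Ic'] := gen (y - f (e r) * (f d * x)).
  split; first by apply: HD => //; apply/HN/HM/HM.
  exists (fun i => e i - e r * d * c i).
  have -> : \sum_(i < r) f (e i - e r * d * c i) * s i =
      \sum_(i < r) f (e i) * s i - f (e r) * f d * \sum_(i < r) f (c i) * s i.
    rewrite mulr_sumr -sumrB; apply: eq_bigr => i _.
    by rewrite !(rmorphB, rmorphM) /=; ring.
  rewrite big_ord_recr /= in Ie; rewrite big_ord_recr /= in Ix.
  set S1 := \sum_(i < r) _ in Ie *; set S2 := \sum_(i < r) _ in Ix *.
  have -> : y - f (e r) * (f d * x) - (S1 - f (e r) * f d * S2) =
      (y - (S1 + f (e r) * s r)) - f (e r) * f d * (x - (S2 + f (c r) * s r)) +
      f (e r) * s r * (1 - f (c r * d)) by rewrite rmorphM; ring.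
  by apply: idealD; [apply: idealB => //|]; exact: idealM.
exists (fun i => if i is i'.+1 then c' i' else e r).
by rewrite big_ord_recl /= opprD addrA.
Qed.
End FinSub.

(** The image of S0 in S / I is a subspace of a finite-dimensional space over R / f^-1 I, which is a
    field by [preim_maximal_fin]. *)
Lemma fin_mod_sub (R S0 S : comPzRingType) (f0 : R -> S0)
    (j : {rmorphism S0 -> S}) (f : {rmorphism R -> S}) (I : ideal S) :
  (forall a, f a = j (f0 a)) -> maximal_ideal I ->
  fin_mod f I -> fin_mod f0 (preim_ideal j I).
Proof.
move=> fE maxI fin.
have inv c : ~ I (f c) -> exists d, I (1 - f (c * d)).
  move=> nIc; have [d Id] := maximal_inv (preim_maximal_fin fin maxI) nIc.
  by exists d; move: Id; rewrite /= /preimage /= rmorphB rmorph1.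
have [r [s hs]] := fin.
pose s1 k := if insub k is Some i then s i else 0.
pose H y := exists x, y = j x.
have [|||r' [s' [Hs' gen]]] := @fin_mod_subspace _ _ f I inv r s1 H.
- by move=> _ _ [x ->] [y ->]; exists (x + y); rewrite rmorphD.
- by move=> a _ [x ->]; exists (f0 a * x); rewrite rmorphM fE.
- move=> y _; have [c Ic] := hs y.
  exists (fun k => if insub k is Some i then c i else 0).
  by under eq_bigr do rewrite /s1 valK.
have /choice[t tE] (i : 'I_r') := Hs' i (ltn_ord i).
exists r', t => y; have [|c Ic] := gen (j y); first by exists y.
exists c; rewrite /= /preimage /= rmorphB rmorph_sum.
by under eq_bigr do rewrite rmorphM -fE -tE.
Qed.

(** * Rank-one valuation rings in a field *)

Section ValuationRing.
Variables (K : comPzRingType) (D : K -> Prop) (u v : K).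
Hypothesis Kfield : forall x : K, x <> 0 -> exists y, x * y = 1.
Hypotheses (DP : subring_pred D) (uv : u * v = 1) (Du : D u) (Dv : ~ D v).

(* [adjoin V x n] is V + V x + ... + V x^n, in Horner form *)
Fixpoint adjoin (V : K -> Prop) (x : K) (n : nat) (z : K) : Prop :=
  if n is n'.+1 then exists c w, [/\ V c, adjoin V x n' w & z = c + x * w]
  else V z.

Section Adjoin.
Variables (V : K -> Prop) (x : K).
Hypothesis VP : subring_pred V.

Lemma adjoinV n c : V c -> adjoin V x n c.
Proof.
elim: n c => [//|n IH] c Vc; exists c, 0; split=> //; last by rewrite mulr0 addr0.
by apply: IH; exact: subring0.
Qed.

Lemma adjoin_leq n m z : (n <= m)%N -> adjoin V x n z -> adjoin V x m z.
Proof.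
elim: n m z => [|n IH] [|m] z //; first by move=> _; exact: adjoinV.
by rewrite ltnS => nm [c [w [Vc /(IH m w nm) hw ->]]]; exists c, w.
Qed.

Lemma adjoinD n y z : adjoin V x n y -> adjoin V x n z -> adjoin V x n (y + z).
Proof.
elim: n y z => [|n IH] y z /=; first exact: subringD.
move=> [c [w [Vc hw ->]]] [c' [w' [Vc' hw' ->]]]; exists (c + c'), (w + w').
by split; [exact: subringD|exact: IH|ring].
Qed.

Lemma adjoinM n c z : V c -> adjoin V x n z -> adjoin V x n (c * z).
Proof.
elim: n z => [|n IH] z Vc /=; first exact: subringM.
move=> [c' [w [Vc' hw ->]]]; exists (c * c'), (c * w).
by split; [exact: subringM|exact: IH|ring].
Qed.

Lemma adjoinX n z : adjoin V x n z -> adjoin V x n.+1 (x * z).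
Proof. by exists 0, z; rewrite add0r; split=> //; exact: subring0. Qed.

Lemma adjoin_mul n m y z :
  adjoin V x n y -> adjoin V x m z -> adjoin V x (n + m) (y * z).
Proof.
elim: n y => [|n IH] y /=; first exact: adjoinM.
move=> [c [w [Vc hw ->]]] hz; rewrite mulrDl -mulrA.
apply: (@adjoinD (n + m).+1); last by apply: adjoinX; exact: IH.
by apply: (adjoin_leq (leq_addl n.+1 m)); exact: adjoinM.
Qed.

Lemma adjoin_pow n : adjoin V x n (x ^+ n).
Proof.
elim: n => [|n IH]; first exact: subring1.
by rewrite exprS; exact: adjoinX.
Qed.

Lemma adjoin_last n z : adjoin V x n.+1 z ->
  exists c w, [/\ V c, adjoin V x n w & z = w + c * x ^+ n.+1].
Proof.
elim: n z => [|n IH] z /=.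
  by move=> [c [w [Vc Vw ->]]]; exists w, c; split=> //; rewrite expr1 mulrC.
move=> [c [w [Vc /IH[c' [w' [Vc' hw' ->]]] ->]]].
exists c', (c + x * w'); split=> //; first by exists c, w'.
by rewrite (exprS _ n.+1); ring.
Qed.

(** A polynomial in y = x^-1 of degree at most k becomes one in x after multiplication by x^k: the
    coefficients are reversed. *)
Lemma adjoin_rev y k j w : x * y = 1 -> (j <= k)%N ->
  adjoin V y j w -> adjoin V x k (x ^+ k * w).
Proof.
move=> xy; elim: j k w => [|j IH] k w.
  by move=> _ Vw; rewrite mulrC; apply: adjoinM => //; exact: adjoin_pow.
case: k => [//|k]; rewrite ltnS => jk [c [w' [Vc hw ->]]].
have -> : x ^+ k.+1 * (c + y * w') = c * x ^+ k.+1 + x ^+ k * w'.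
  by rewrite exprS; ring: xy.
apply: adjoinD; first by apply: adjoinM => //; exact: adjoin_pow.
by apply: (adjoin_leq (leqnSn k)); exact: IH.
Qed.
End Adjoin.

(* A maximal subring avoiding [v = u^-1] is a valuation ring, of rank one     *)
(* because [v] is a polynomial in any [x] outside it.                         *)
Lemma valuation_above : exists V : K -> Prop,
  [/\ subring_pred V, forall x, D x -> V x, ~ V v,
      forall x y, x * y = 1 -> V x \/ V y &
      forall x y, x * y = 1 -> ~ V x -> exists d w, V w /\ y ^+ d = u * w].
Proof.
pose P := [set S : set K | subring_pred S /\ ~ S v]%classic.
have [//|F [S FS] FP totF|V [[VP Vv] DV maxV]] := @Zorn_above K P D.
  have ext X Y : F X -> F Y -> exists Z, [/\ F Z, X `<=` Z & Y `<=` Z]%classic.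
    by move=> FX FY; case: (totF _ _ FX FY) => h; [exists Y|exists X]; split.
  split; last by move=> [X FX Xv]; case: (FP _ FX).
  split.
  - by exists S => //; case: (FP _ FS) => SP _; exact: subring1.
  - move=> x y [X FX Xx] [Y FY Yy]; have [Z [FZ XZ YZ]] := ext _ _ FX FY.
    exists Z => //; have [ZP _] := FP _ FZ.
    by apply: (subringB ZP); [exact: XZ|exact: YZ].
  - move=> x y [X FX Xx] [Y FY Yy]; have [Z [FZ XZ YZ]] := ext _ _ FX FY.
    exists Z => //; have [ZP _] := FP _ FZ.
    by apply: (subringM ZP); [exact: XZ|exact: YZ].
(* Otherwise V[x] would be a larger subring avoiding v. *)
have adj x : ~ V x -> exists n, adjoin V x n v.
  move=> nVx; apply: contrapT => no.
  pose W := [set z | exists n, adjoin V x n z]%classic.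
  have WM y z : W y -> W z -> W (y * z).
    by move=> [n hn] [m hm]; exists (n + m)%N; exact: adjoin_mul.
  have WV c : V c -> W c by exists 0%N.
  have WD y z : W y -> W z -> W (y + z).
    move=> [n hn] [m hm]; exists (n + m)%N; apply: (adjoinD VP).
      by apply: (adjoin_leq VP _ hn); rewrite leq_addr.
    by apply: (adjoin_leq VP _ hm); rewrite leq_addl.
  apply: nVx; apply: (maxV W) => //.
    split=> //; split=> //; first by apply: WV; exact: subring1.
    move=> y z Wy Wz; apply: WD => //; rewrite -mulN1r; apply: WM => //.
    by apply: WV; apply: (subringN VP); exact: subring1.
  by exists 1%N; rewrite -(expr1 x); exact: adjoin_pow.
have Vu : V u by exact: DV.
(* Elements of 1 + u V are units of V. If the inverse e of x = 1 - u s were outside V, then v would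
   be a polynomial in e of some degree n. Multiplying by x^n, which is 1 modulo u V, would put v in
   V. *)
have unit1 s : V s -> exists2 e, V e & (1 - u * s) * e = 1.
  move=> Vs; have [|e ee] := Kfield (x := 1 - u * s).
    move=> e0; apply: Vv; suff -> : v = s by [].
    by rewrite -[v]mulr1 (subr0_eq e0); ring: uv.
  exists e => //; apply: contrapT => /adj[n hn].
  have hx : e * (1 - u * s) = 1 by rewrite mulrC.
  pose x := 1 - u * s.
  have [t [Vt xnE]] : exists t, V t /\ x ^+ n = 1 - u * t.
    elim: (n) => [|k [t [Vt IH]]].
      by exists 0; rewrite mulr0 subr0; split=> //; exact: subring0.
    exists (s + t - u * s * t); split; last by rewrite exprS IH /x; ring.
    by apply: (subringB VP); [apply: subringD|do 2?apply: subringM].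
  have Vx : V x.
    by apply: (subringB VP); [exact: subring1|exact: subringM].
  have polyV k z : adjoin V e k z -> V (x ^+ k * z).
    elim: k z => [|k IH] z /=; first by rewrite mul1r.
    move=> [c [w [Vc /IH hw ->]]].
    have -> : x ^+ k.+1 * (c + e * w) = x ^+ k.+1 * c + x ^+ k * w.
      by rewrite exprS -[in RHS](mulr1 w) -ee -/x; ring.
    by apply: subringD => //; apply: subringM => //; exact: subringX.
  apply: Vv; have -> : v = x ^+ n * v + t by rewrite xnE; ring: uv.
  by apply: subringD => //; exact: polyV.
(* The relation v = d + y z, solved for v with the unit 1 - u d, gives v = y (e z) and hence x = u
   (e z). Substituting one such x into the top term of the relation in x lowers the degree. *)
have descent x y n m : x * y = 1 -> (m <= n)%N -> adjoin V x n v ->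
    adjoin V y m v -> exists2 n', (n' < n)%N & adjoin V x n' v.
  move=> xy; case: m => [//|m]; case: n => [//|n]; rewrite ltnS => mn hx.
  move=> [d [z [Vd hz vE]]].
  have [e Ve ee] := unit1 d Vd.
  have vE' : v = y * (e * z).
    have vd : v * (1 - u * d) = v - d by ring: uv.
    by rewrite -[LHS]mulr1 -ee [LHS]mulrA vd {1}vE; ring.
  have xE : x = u * (e * z) by rewrite -[LHS]mulr1 -uv {1}vE'; ring: xy.
  exists n => //; have [c [w [Vc hw wE]]] := adjoin_last hx.
  have -> : v = w + u * c * (x ^+ n * (e * z)).
    by rewrite {1}wE exprS {1}xE; ring.
  apply: (adjoinD VP) => //; apply: (adjoinM VP); first exact: subringM.
  by apply: (adjoin_rev VP xy mn); exact: adjoinM.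
have val x y : x * y = 1 -> V x \/ V y.
  move=> xy; apply: contrapT => no.
  have nVx : ~ V x by move=> ?; apply: no; left.
  have nVy : ~ V y by move=> ?; apply: no; right.
  have [n hn] := adj _ nVx; have [m hm] := adj _ nVy.
  have yx : y * x = 1 by rewrite mulrC.
  have [N Nnm] : exists N, (n + m <= N)%N by exists (n + m)%N.
  elim: N n m hn hm Nnm => [|N IH] n m hn hm Nnm.
    by move: hn; rewrite (_ : n = 0%N) // ; lia.
  have [mn|/ltnW nm] := leqP m n.
    have [n' n'n hn'] := descent _ _ _ _ xy mn hn hm.
    by apply: (IH n' m) => //; lia.
  have [m' m'm hm'] := descent _ _ _ _ yx nm hm hn.
  by apply: (IH n m') => //; lia.
exists V; split=> // x y xy nVx; have [n hn] := adj _ nVx.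
have Vy : V y by case: (val _ _ xy).
have polyV k z : adjoin V x k z -> V (y ^+ k * z).
  elim: k z => [|k IH] z /=; first by rewrite mul1r.
  move=> [c [w [Vc /IH hw ->]]].
  have -> : y ^+ k.+1 * (c + x * w) = y ^+ k.+1 * c + y ^+ k * w.
    by rewrite exprS; ring: xy.
  by apply: subringD => //; apply: subringM => //; exact: subringX.
exists n, (y ^+ n * v); split; first exact: polyV.
by ring: uv.
Qed.
End ValuationRing.

(** * Unit balls and topologically nilpotent units *)

(** The filtration u^k O replaces the norm, so that the same estimates apply in a residue field,
    where only a valuation ring is available. *)
Definition small (Z : comPzRingType) (O : Z -> Prop) (u : Z) (k : nat) (x : Z) :=
  exists2 w, O w & x = u ^+ k * w.

Section Small.
Variables (Z : comPzRingType) (O : Z -> Prop) (u v : Z).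
Hypotheses (OP : subring_pred O) (Ou : O u) (uv : u * v = 1).
Local Notation small := (small O u).

Lemma smallE k x : small k x <-> O (v ^+ k * x).
Proof.
have uvk : u ^+ k * v ^+ k = 1 by rewrite -exprMn uv expr1n.
split=> [[w Ow ->]|h]; first by rewrite mulrA (mulrC (v ^+ k)) uvk mul1r.
by exists (v ^+ k * x) => //; rewrite mulrA uvk mul1r.
Qed.

Lemma small_O x : small 0 x <-> O x.
Proof. by rewrite smallE expr0 mul1r. Qed.
Lemma small0 k : small k 0.
Proof. by exists 0; rewrite ?mulr0 //; exact: subring0. Qed.
Lemma smallB k x y : small k x -> small k y -> small k (x - y).
Proof. by rewrite !smallE mulrBr; exact: subringB. Qed.
Lemma smallN k x : small k x -> small k (- x).
Proof. by rewrite !smallE mulrN; exact: subringN. Qed.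
Lemma smallD k x y : small k x -> small k y -> small k (x + y).
Proof. by rewrite !smallE mulrDr; exact: subringD. Qed.
Lemma smallM k l x y : small k x -> small l y -> small (k + l) (x * y).
Proof.
rewrite !smallE exprD mulrACA; exact: subringM.
Qed.
Lemma small_mulO k x y : O x -> small k y -> small k (x * y).
Proof. by rewrite -small_O; exact: smallM. Qed.
Lemma small_leq k l x : (k <= l)%N -> small l x -> small k x.
Proof.
move=> kl [w Ow ->]; exists (u ^+ (l - k) * w); last first.
  by rewrite mulrA -exprD subnKC.
by apply: subringM => //; exact: subringX.
Qed.
Lemma small_exp k w : O w -> small k (u ^+ k * w).
Proof. by exists w. Qed.
Lemma small_sum k (I : Type) (s : seq I) (P : pred I) (F : I -> Z) :
  (forall i, P i -> small k (F i)) -> small k (\sum_(i <- s | P i) F i).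
Proof. by move=> h; apply: big_ind => //; [exact: small0|exact: smallD]. Qed.
Lemma small_mul_bounded k K x y :
  O (u ^+ k * x) -> small (k + K) y -> small K (x * y).
Proof.
move=> Okx /smallE h; apply/smallE.
have -> : v ^+ K * (x * y) = (u ^+ k * x) * (v ^+ (k + K) * y).
  have uvk : u ^+ k * v ^+ k = 1 by rewrite -exprMn uv expr1n.
  by rewrite exprD; ring: uvk.
exact: subringM.
Qed.
Lemma bounded_leq k l x : (k <= l)%N -> O (u ^+ k * x) -> O (u ^+ l * x).
Proof.
move=> kl h; rewrite -(subnK kl) exprD -mulrA.
by apply: subringM => //; exact: subringX.
Qed.
End Small.

Section Contractive.
Variables (R : realType) (Q : banachTateType R).
Local Notation N := (@bnorm R Q).

(* Operator norm at most 1; unlike [bnorm x <= 1], this holds for [x = 1] even *)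
(* when [bnorm 1 > 1].                                                        *)
Definition pbd (x : Q) : Prop := forall y, N (x * y) <= N y.

Lemma pbd_subring : subring_pred pbd.
Proof.
split=> [y|x y hx hy z|x y hx hy z]; first by rewrite mul1r.
  by rewrite mulrBl (le_trans (nnormB bnormP _ _)) // ge_max hx hy.
by rewrite -mulrA (le_trans (hx _)).
Qed.

Lemma pbd_norm1 x : N x <= 1 -> pbd x.
Proof.
move=> x1 y; rewrite (le_trans (bnormM_le _ _)) //.
by rewrite ler_piMl // (nnorm_ge0 bnormP).
Qed.

Definition pseudo_unif (u v : Q) : Prop :=
  [/\ u * v = 1, pbd u &
      forall e, 0 < e -> exists K : nat, forall k, (K <= k)%N -> N (u ^+ k) < e].

Lemma pseudo_unif_exists : exists u v, pseudo_unif u v.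
Proof.
have [u [v uv] u0] := @bnorm_tate R Q.
have h := (cvg0P (fun k => nnorm_ge0 bnormP (u ^+ k))).1 u0.
(* The successor keeps the exponent positive, so that the powers of the new unit still tend to 0. *)
have [K hK] := h 1 ltr01; exists (u ^+ K.+1), (v ^+ K.+1); split.
- by rewrite -exprMn uv expr1n.
- by apply: pbd_norm1; apply/ltW/hK.
move=> e e0; have [K' hK'] := h e e0; exists K' => k Kk; rewrite -exprM.
by apply: hK'; rewrite (leq_trans Kk) // leq_pmull.
Qed.

Variables (u v : Q).
Hypothesis U : pseudo_unif u v.
Local Notation small := (small pbd u).

Let uv : u * v = 1. Proof. by case: U. Qed.
Let Ou : pbd u. Proof. by case: U. Qed.
Let OP := pbd_subring.

(** With [small_norm], this identifies the norm topology with the one defined by the u^k O. *)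
Lemma norm_small k : exists2 e, 0 < e & forall x, N x < e -> small k x.
Proof.
have e0 : 0 < (N (v ^+ k) + 1)^-1.
  by rewrite invr_gt0 ltr_wpDl // (nnorm_ge0 bnormP).
exists (N (v ^+ k) + 1)^-1 => // x xe; apply/(smallE _ uv)/pbd_norm1.
rewrite (le_trans (bnormM_le _ _)) //.
rewrite (le_trans (y := (N (v ^+ k) + 1) * N x)) //.
  by rewrite ler_wpM2r ?(nnorm_ge0 bnormP) // lerDl.
rewrite mulrC -ler_pdivlMr ?div1r ?(ltW xe) //.
by rewrite ltr_wpDl // (nnorm_ge0 bnormP).
Qed.

Lemma small_norm e : 0 < e -> exists k, forall x, small k x -> N x < e.
Proof.
case: U => _ _ h e0; have [K hK] := h e e0; exists K => _ [w hw ->].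
by rewrite mulrC (le_lt_trans (hw _)) // hK.
Qed.

Lemma pbd_bounded x : exists k, pbd (u ^+ k * x).
Proof.
case: U => _ _ h; have x0 : 0 < (N x + 1)^-1.
  by rewrite invr_gt0 ltr_wpDl // (nnorm_ge0 bnormP).
have [K /(_ K (leqnn K)) hK] := h _ x0; exists K; apply: pbd_norm1.
rewrite (le_trans (bnormM_le _ _)) //.
rewrite (le_trans (y := N (u ^+ K) * (N x + 1))) //.
  by rewrite ler_wpM2l ?(nnorm_ge0 bnormP) // lerDl.
rewrite -ler_pdivlMr ?div1r ?(ltW hK) //.
by rewrite ltr_wpDl // (nnorm_ge0 bnormP).
Qed.

Lemma small_sep x : (forall k, small k x) -> x = 0.
Proof.
move=> h; apply: (nnorm_eq0 bnormP); apply/eqP.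
rewrite eq_le (nnorm_ge0 bnormP) andbT leNgt; apply/negP => x0.
by have [k hk] := small_norm x0; have := hk _ (h k); rewrite ltxx.
Qed.

Lemma small_series (w : nat -> Q) : (forall k, pbd (w k)) ->
  exists l, forall K, small K (l - \sum_(k < K) u ^+ k * w k).
Proof.
move=> hw; pose S K := \sum_(k < K) u ^+ k * w k.
have tail K i : (K <= i)%N -> small K (S i - S K).
  move=> Ki; rewrite /S -(subnKC Ki); elim: (i - K)%N => [|d IH].
    by rewrite addn0 subrr; exact: small0.
  rewrite addnS big_ord_recr /= addrAC; apply: (smallD OP uv) => //.
  by apply: (small_leq OP Ou (leq_addr d K)); exact: small_exp.
have [e e0|l hl] := @bnorm_complete R Q S.
  have [K hK] := small_norm e0; exists K => i j Ki Kj; apply: hK.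
  have -> : S i - S j = (S i - S K) - (S j - S K) by ring.
  by apply: (smallB OP uv); exact: tail.
exists l => K; have [e e0 he] := norm_small K.
have [K' hK'] := (cvg0P (fun i => nnorm_ge0 bnormP (S i - l))).1 hl e e0.
pose i := maxn K K'; rewrite -/(S K) -(subrKA (S i)).
apply: (smallD OP uv); last by apply: tail; exact: leq_maxl.
rewrite -opprB; apply: (smallN OP uv); apply: he; apply: hK'.
exact: leq_maxr.
Qed.

Lemma one_sub_unit w : pbd w -> exists y, (1 - u * w) * y = 1.
Proof.
move=> hw; have [|l hl] := @small_series (fun k => w ^+ k).
  by move=> k; exact: (subringX OP).
exists l; apply/eqP; rewrite -subr_eq0; apply/eqP/small_sep => K.
have geom : (1 - u * w) * (\sum_(k < K) u ^+ k * w ^+ k) = 1 - u ^+ K * w ^+ K.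
  elim: (K) => [|d IH]; first by rewrite big_ord0 !expr0 mulr0 mulr1 subrr.
  by rewrite big_ord_recr mulrDr IH /= !exprS; ring.
have -> : (1 - u * w) * l - 1 =
    (1 - u * w) * (l - \sum_(k < K) u ^+ k * w ^+ k) - u ^+ K * w ^+ K.
  by rewrite mulrBr geom; ring.
apply: (smallB OP uv); last by apply: small_exp; exact: (subringX OP).
apply: (small_mulO OP uv) => //; apply: (subringB OP); first exact: (subring1 OP).
exact: (subringM OP).
Qed.

(** An x in the closure but not in M has an inverse y modulo M. Approximating x closely enough puts
    some 1 - u z with z in the unit ball into M, and this is a unit by the geometric series. *)
Lemma maximal_closed (M : ideal Q) : maximal_ideal M ->
  forall x, (forall k, exists2 w, pbd w & M (x - u ^+ k * w)) -> M x.
Proof.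
move=> maxM x hx; apply: contrapT => /(maximal_inv maxM)[y My].
have [j hj] := pbd_bounded y; have [w hw Mw] := hx j.+1.
have [|z hz] := @one_sub_unit ((u ^+ j * y) * w); first exact: (subringM OP).
case: maxM => M1 _; apply: M1; rewrite -hz; apply: ideal_mulr.
have -> : 1 - u * (u ^+ j * y * w) = (1 - x * y) + y * (x - u ^+ j.+1 * w).
  by rewrite exprS; ring.
by apply: idealD => //; exact: idealM.
Qed.

(** This keeps v out of the image of the unit ball in Q / M, as [valuation_above] requires. *)
Lemma pseudo_unif_not_small (M : ideal Q) w :
  ~ M 1 -> pbd w -> ~ M (1 - u * w).
Proof.
move=> M1 hw Mw; have [y hy] := one_sub_unit hw.
by apply: M1; rewrite -hy; exact: ideal_mulr.
Qed.
End Contractive.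

(** * Coefficients, monomials and density of polynomials in Tate algebras *)

Section TateBasics.
Variables (R : realType) (A : banachTateType R) (m : nat).
Local Notation P := (tate A m).
Implicit Types (f g : P) (a b : A) (d e : mon m) (i : 'I_m).

Lemma tcoefB f g e : (f - g) e = f e - g e. Proof. by []. Qed.
Lemma tcoefM f g e : (f * g) e = \sum_(d <- mon_below e) f d * g (mon_sub e d).
Proof. exact: cauchy_prodE. Qed.
Lemma tcoefCM a f e : (tateC m a * f) e = a * f e.
Proof. exact: cauchy_prodCl. Qed.
Lemma tcoefC a e : tateC m a e = if e == 0 then a else 0. Proof. by []. Qed.
Lemma tcoef1 e : (1 : P) e = if e == 0 then 1 else 0. Proof. by []. Qed.
Lemma tcoef_sum (I : Type) (s : seq I) (Q : pred I) (F : I -> P) e :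
  (\sum_(i <- s | Q i) F i) e = \sum_(i <- s | Q i) (F i) e.
Proof. by elim/big_rec2: _ => // i x y _ <-. Qed.

(** Multiplying f by constants and reading off one coefficient bounds that coefficient as an
    operator; the converse is the ultrametric estimate for the product. *)
Lemma pbd_tateP f : pbd f <-> forall e, pbd (f e).
Proof.
split=> [hf e a|hf g].
  rewrite -(gauss_normC m a) mulrC -tcoefCM.
  by apply: le_trans (hf (tateC m a)); rewrite mulrC; exact: coef_le_gauss.
apply: gauss_le => e; rewrite tcoefM; apply: (nnorm_sum_le bnormP).
  exact: gauss_ge0.
by move=> d _; apply: le_trans (hf d _) _; exact: coef_le_gauss.
Qed.

Lemma pbd_tateC a : pbd a -> pbd (tateC m a).
Proof.
move=> ha; apply/pbd_tateP => e; rewrite tcoefC; case: eqP => // _.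
exact: (subring0 (pbd_subring _)).
Qed.

Lemma pbd_tateX i : pbd (tateX A i).
Proof.
apply/pbd_tateP => e; rewrite /= /var_series; case: eqP => _.
  exact: (subring1 (pbd_subring _)).
exact: (subring0 (pbd_subring _)).
Qed.

Lemma pseudo_unif_tateC (u v : A) : pseudo_unif u v ->
  pseudo_unif (tateC m u) (tateC m v).
Proof.
move=> [uv hu h]; split; first by rewrite -rmorphM uv rmorph1.
  exact: pbd_tateC.
move=> e /h[K hK]; exists K => k /hK.
by rewrite -rmorphXn (gauss_normC m (u ^+ k) : bnorm (tateC m _) = _).
Qed.

Lemma tmono_to0 a d (eps : R) : 0 < eps ->
  finite_set [set e | eps <= bnorm (if e == d then a else 0)].
Proof.
move=> eps0; apply: (@sub_finite_set _ _ [set d]%classic); last exact: finite_set1.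
move=> e /=; case: eqP => // _.
by rewrite (nnorm0 bnormP) leNgt eps0.
Qed.
Definition tmono a d : P := Tate (@tmono_to0 a d).

Lemma tcoef_tmono a d e : tmono a d e = if e == d then a else 0. Proof. by []. Qed.

Lemma tmonoC a : tmono a 0 = tateC m a. Proof. exact: tateP. Qed.

Lemma tmonoX i : tateX A i = tmono 1 [ffun j => (j == i) : nat].
Proof. exact: tateP. Qed.

Lemma tmonoM a b d e : tmono a d * tmono b e = tmono (a * b) (d + e).
Proof.
apply: tateP => x; rewrite tcoefM tcoef_tmono.
have [->|xde] := eqVneq x (d + e).
  rewrite (bigD1_seq d) ?mon_below_uniq ?mon_belowE ?mon_le_addr //=.
  rewrite eqxx mon_addK eqxx big1 ?addr0 // => d' /negbTE->.
  by rewrite mul0r.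
rewrite big1_seq // => d' /andP[_]; rewrite mon_belowE => d'x.
rewrite !tcoef_tmono; case: eqP => [dd|_]; last by rewrite mul0r.
case: eqP => [ee|_]; last by rewrite mulr0.
by rewrite -(mon_subK d'x) dd -ee dd eqxx in xde.
Qed.

Lemma tmonoX_exp i k : tateX A i ^+ k = tmono 1 [ffun j => if j == i then k else 0%N].
Proof.
elim: k => [|k IH].
  rewrite expr0; apply: tateP => e; rewrite tcoef1 tcoef_tmono.
  by congr (if e == _ then _ else _); apply/ffunP => j; rewrite !ffunE; case: eqP.
rewrite exprS IH tmonoX tmonoM mulr1; congr tmono; apply/ffunP => j.
by rewrite !ffunE; case: eqP.
Qed.

Lemma tmonoE a d : tmono a d = tateC m a * \prod_i tateX A i ^+ d i.
Proof.
have -> : \prod_i tateX A i ^+ d i = tmono 1 d.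
  under eq_bigr do rewrite tmonoX_exp.
  have dE : d = \sum_i [ffun j => if j == i then d i else 0%N].
    apply/ffunP => j; rewrite sum_ffunE (bigD1 j) //= ffunE eqxx.
    by rewrite big1 ?addr0 // => i ij; rewrite ffunE eq_sym (negbTE ij).
  rewrite [in RHS]dE.
  elim/big_rec2: _ => [|i e x _ ->]; first by rewrite tmonoC rmorph1.
  by rewrite tmonoM mulr1.
by rewrite -tmonoC tmonoM mulr1 add0r.
Qed.
End TateBasics.

Section TateSmall.
Variables (R : realType) (A : banachTateType R) (m : nat) (u v : A).
Hypothesis U : pseudo_unif u v.
Local Notation P := (tate A m).
Local Notation smallA := (small (@pbd R A) u).
Local Notation smallP := (small (@pbd R P) (tateC m u)).
Let uv : u * v = 1. Proof. by case: U. Qed.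
Let uvP : tateC m u * tateC m v = 1. Proof. by rewrite -rmorphM uv rmorph1. Qed.

Lemma small_tateP (f : P) k : smallP k f <-> forall e, smallA k (f e).
Proof.
rewrite (smallE _ uvP); split.
  move=> /pbd_tateP h e; apply/(smallE _ uv).
  by have := h e; rewrite -rmorphXn tcoefCM.
move=> h; apply/pbd_tateP => e; rewrite -rmorphXn tcoefCM.
by apply/(smallE _ uv).
Qed.

Lemma tate_supp (f : P) k :
  exists s : seq (mon m), uniq s /\ forall e, e \notin s -> smallA k (f e).
Proof.
have [eps eps0 h] := norm_small U k.
have /finite_seqP[s sE] := @coef_to0 _ _ _ f eps eps0.
exists (undup s); split=> [|e]; first exact: undup_uniq.
rewrite mem_undup => /negP nin; apply: h; rewrite ltNge; apply/negP => h'.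
by have : [set` s]%classic e by rewrite -sE.
Qed.

Lemma tcoef_trunc (s : seq (mon m)) (f : P) e : uniq s ->
  (\sum_(d <- s) tmono (f d) d) e = if e \in s then f e else 0.
Proof.
move=> us; rewrite tcoef_sum; case: ifP => es.
  rewrite (bigD1_seq e) //= eqxx big1 ?addr0 // => d /negbTE.
  by rewrite eq_sym => ->.
rewrite big1_seq // => d /andP[_ ds]; rewrite tcoef_tmono; case: eqP => // ed.
by rewrite ed ds in es.
Qed.

Lemma trunc_small (s : seq (mon m)) (f : P) k : uniq s ->
  (forall e, e \notin s -> smallA k (f e)) ->
  smallP k (f - \sum_(d <- s) tmono (f d) d).
Proof.
move=> us h; apply/small_tateP => e; rewrite tcoefB tcoef_trunc //.
case: ifP => es; first by rewrite subrr; apply: (small0 u (pbd_subring _)).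
by rewrite subr0; apply: h; rewrite es.
Qed.

Lemma poly_dense (S : P -> Prop) : subring_pred S ->
  (forall a, S (tateC m a)) -> (forall i, S (tateX A i)) ->
  forall (f : P) k, exists2 g, S g & smallP k (f - g).
Proof.
move=> SP SC SX f k; have [s [us hs]] := tate_supp f k.
exists (\sum_(d <- s) tmono (f d) d); last exact: trunc_small.
apply: (subring_sum SP) => d _; rewrite tmonoE; apply: (subringM SP) => //.
by apply: (subring_prod SP) => i _; exact: (subringX SP).
Qed.
End TateSmall.

(** * Evaluation of restricted power series *)

Lemma sum_partition (V : nmodType) (I J : eqType) (s : seq I) (t : seq J)
    (p : I -> J) (F : I -> V) : uniq t -> (forall i, i \in s -> p i \in t) ->
  \sum_(i <- s) F i = \sum_(j <- t) \sum_(i <- s | p i == j) F i.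
Proof.
move=> ut h; rewrite (exchange_big_dep xpredT) //= big_seq [RHS]big_seq.
by apply: eq_bigr => i /h pi; under eq_bigl do rewrite eq_sym;
  rewrite -big_filter (filter_pred1_uniq ut pi) big_seq1.
Qed.

Section PolyEval.
Variables (R : realType) (A : banachTateType R) (m : nat).
Local Notation poly := (seq (A * mon m)).

Section Eval.
Variables (Z : comPzRingType) (th : {rmorphism A -> Z}) (y : 'I_m -> Z).

Definition mon_eval (d : mon m) : Z := \prod_i y i ^+ d i.
Definition poly_eval (s : poly) : Z := \sum_(p <- s) th p.1 * mon_eval p.2.

Lemma mon_evalD d e : mon_eval (d + e) = mon_eval d * mon_eval e.
Proof.
by rewrite /mon_eval -big_split; apply: eq_bigr => i _; rewrite monDE exprD.
Qed.
Lemma mon_eval0 : mon_eval 0 = 1.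
Proof. by rewrite /mon_eval big1 // => i _; rewrite ffunE. Qed.

Definition poly_opp (s : poly) : poly := [seq (- p.1, p.2) | p <- s].
Definition poly_mul (s t : poly) : poly :=
  [seq (p.1 * q.1, p.2 + q.2) | p <- s, q <- t].

Lemma poly_eval_cat s t : poly_eval (s ++ t) = poly_eval s + poly_eval t.
Proof. exact: big_cat. Qed.
Lemma poly_eval_opp s : poly_eval (poly_opp s) = - poly_eval s.
Proof.
rewrite /poly_eval big_map -sumrN; apply: eq_bigr => p _.
by rewrite rmorphN mulNr.
Qed.
Lemma poly_eval_mul s t : poly_eval (poly_mul s t) = poly_eval s * poly_eval t.
Proof.
rewrite /poly_eval /poly_mul big_allpairs_dep /= big_distrl; apply: eq_bigr => p _.
rewrite big_distrr; apply: eq_bigr => q _ /=.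
by rewrite rmorphM mon_evalD mulrACA.
Qed.
Lemma poly_eval_const a : poly_eval [:: (a, 0)] = th a.
Proof. by rewrite /poly_eval big_seq1 mon_eval0 mulr1. Qed.
Lemma poly_eval_var i :
  poly_eval [:: (1, [ffun j => (j == i) : nat])] = y i.
Proof.
rewrite /poly_eval big_seq1 rmorph1 mul1r /mon_eval (bigD1 i) //= ffunE eqxx.
rewrite expr1 big1 ?mulr1 // => j ji.
by rewrite ffunE (negbTE ji).
Qed.
End Eval.

Definition poly_tate (s : poly) : tate A m := poly_eval (tateC m) (@tateX R A m) s.

Lemma poly_tateE s : poly_tate s = \sum_(p <- s) tmono p.1 p.2.
Proof. by apply: eq_bigr => p _; rewrite tmonoE. Qed.

Lemma poly_eval_coef (Z : comPzRingType) (th : {rmorphism A -> Z})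
    (y : 'I_m -> Z) (s : poly) :
  poly_eval th y s =
  \sum_(d <- undup [seq p.2 | p <- s]) th (poly_tate s d) * mon_eval y d.
Proof.
rewrite /poly_eval (sum_partition _ (undup_uniq [seq p.2 | p <- s])
  (p := snd)); last by move=> p ps; rewrite mem_undup map_f.
apply: eq_bigr => d _; rewrite poly_tateE tcoef_sum rmorph_sum mulr_suml.
rewrite [LHS]big_mkcond; apply: eq_bigr => p _; rewrite tcoef_tmono eq_sym.
by case: eqP => [->|_] //; rewrite rmorph0 mul0r.
Qed.
End PolyEval.

(* The graph of evaluation of restricted power series at [y]: the closure of  *)
(* the graph of evaluation of polynomials, for the topology given by the      *)
(* [u ^ k O]; it makes sense even when the target is not complete.            *)
Section EvalGraph.
Variables (R : realType) (A : banachTateType R) (m : nat) (u v : A).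
Hypothesis U : pseudo_unif u v.
Variables (Z : comPzRingType) (th : {rmorphism A -> Z}) (y : 'I_m -> Z).
Variable O : Z -> Prop.
Hypotheses (OP : subring_pred O) (Oth : forall a, pbd a -> O (th a)).
Hypothesis Oy : forall i, O (y i).
Hypothesis Obnd : forall z, exists k, O (th u ^+ k * z).

Local Notation P := (tate A m).
Local Notation smallA := (small (@pbd R A) u).
Local Notation smallP := (small (@pbd R P) (tateC m u)).
Local Notation smallZ := (small O (th u)).
Let uv : u * v = 1. Proof. by case: U. Qed.
Let UP : pseudo_unif (tateC m u : P) (tateC m v). Proof. exact: pseudo_unif_tateC. Qed.
Let uvP : tateC m u * tateC m v = 1. Proof. by case: UP. Qed.
Let uvZ : th u * th v = 1. Proof. by rewrite -rmorphM uv rmorph1. Qed.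
Let OuP : pbd (tateC m u : P). Proof. by case: UP. Qed.
Let OuZ : O (th u). Proof. by apply: Oth; case: U. Qed.
Let PP := pbd_subring P.
Local Notation evZ := (poly_eval th y).
Local Notation evP := (@poly_tate R A m).

Lemma small_th a k : smallA k a -> smallZ k (th a).
Proof.
by move=> [w /Oth hw ->]; exists (th w) => //; rewrite rmorphM rmorphXn.
Qed.

Lemma mon_eval_O d : O (mon_eval y d).
Proof. by apply: (subring_prod OP) => i _; exact: (subringX OP). Qed.

Lemma poly_eval_small s k : smallP k (evP s) -> smallZ k (evZ s).
Proof.
move=> /(small_tateP U) h; rewrite poly_eval_coef; apply: (small_sum OP uvZ) => d _.
by rewrite mulrC; apply: (small_mulO OP uvZ); [exact: mon_eval_O|exact: small_th].
Qed.

Definition eval_graph (f : P) (z : Z) : Prop :=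
  forall k, exists s, smallP k (f - evP s) /\ smallZ k (z - evZ s).

Lemma eval_graph_poly s : eval_graph (evP s) (evZ s).
Proof.
by move=> k; exists s; rewrite !subrr; split; exact: small0.
Qed.

Lemma eval_graphC a : eval_graph (tateC m a) (th a).
Proof.
have := eval_graph_poly [:: (a, 0)].
by rewrite /poly_tate !poly_eval_const.
Qed.

Lemma eval_graphX i : eval_graph (tateX A i) (y i).
Proof.
have := eval_graph_poly [:: (1, [ffun j => (j == i) : nat])].
by rewrite /poly_tate !poly_eval_var.
Qed.

Lemma eval_graphB f g z w :
  eval_graph f z -> eval_graph g w -> eval_graph (f - g) (z - w).
Proof.
move=> hf hg k; have [s [s1 s2]] := hf k; have [t [t1 t2]] := hg k.
exists (s ++ poly_opp t); rewrite /poly_tate !poly_eval_cat !poly_eval_opp.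
rewrite -/(evP s) -/(evP t); split.
  have -> : f - g - (evP s - evP t) = (f - evP s) - (g - evP t) by ring.
  exact: (smallB PP uvP).
have -> : z - w - (evZ s - evZ t) = (z - evZ s) - (w - evZ t) by ring.
exact: (smallB OP uvZ).
Qed.

Lemma eval_graph0 : eval_graph 0 0.
Proof. by have := eval_graphB (eval_graphC 0) (eval_graphC 0); rewrite !subrr. Qed.

Lemma eval_graphD f g z w :
  eval_graph f z -> eval_graph g w -> eval_graph (f + g) (z + w).
Proof.
move=> hf hg; rewrite -[g]opprK -[w]opprK; apply: eval_graphB => //.
by rewrite -[- g]sub0r -[- w]sub0r; apply: eval_graphB => //; exact: eval_graph0.
Qed.

Lemma eval_graph_sum (I : Type) (s : seq I) (Q : pred I) (F : I -> P) (G : I -> Z) :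
  (forall i, Q i -> eval_graph (F i) (G i)) ->
  eval_graph (\sum_(i <- s | Q i) F i) (\sum_(i <- s | Q i) G i).
Proof.
move=> h; apply: (big_rec2 eval_graph) => [|i f z Qi]; first exact: eval_graph0.
by apply: eval_graphD; exact: h.
Qed.

Lemma eval_graph_closed f z :
  (forall k, exists g w, [/\ eval_graph g w, smallP k (f - g) & smallZ k (z - w)]) ->
  eval_graph f z.
Proof.
move=> h k; have [g [w [gw s1 s2]]] := h k; have [s [t1 t2]] := gw k.
exists s; rewrite -(subrKA g f) -(subrKA w z).
by split; [exact: (smallD PP uvP)|exact: (smallD OP uvZ)].
Qed.

(** Continuity of evaluation. For f = 0 it says that all values of 0 are infinitely small, which
    makes the graph functional when the target is separated. *)
Lemma eval_graph_small f z k : eval_graph f z -> smallP k f -> smallZ k z.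
Proof.
move=> h hf; have [s [s1 s2]] := h k.
rewrite -(subrK (evZ s) z); apply: (smallD OP uvZ) => //.
apply: poly_eval_small; rewrite -(subKr f (evP s)); apply: (smallB PP uvP) => //.
Qed.

Lemma eval_graphM f g z w :
  eval_graph f z -> eval_graph g w -> eval_graph (f * g) (z * w).
Proof.
move=> hf hg.
have [k1 hk1] := pbd_bounded UP f; have [k2 hk2] := pbd_bounded UP g.
have [k3 hk3] := Obnd z; have [k4 hk4] := Obnd w.
pose k0 := (k1 + k2 + k3 + k4)%N => k.
have [s [s1 s2]] := hf (k0 + k)%N; have [t [t1 t2]] := hg (k0 + k)%N.
have bP f' i : (i <= k0)%N -> pbd (tateC m u ^+ i * f') -> pbd (tateC m u ^+ k0 * f').
  by move=> ik; exact: bounded_leq ik.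
have bZ z' i : (i <= k0)%N -> O (th u ^+ i * z') -> O (th u ^+ k0 * z').
  by move=> ik; exact: bounded_leq ik.
have sP : smallP k (f - evP s) by apply: (small_leq PP OuP _ s1); rewrite leq_addl.
have sZ : smallZ k (z - evZ s) by apply: (small_leq OP OuZ _ s2); rewrite leq_addl.
exists (poly_mul s t); rewrite /poly_tate !poly_eval_mul -/(evP s) -/(evP t); split.
  have -> : f * g - evP s * evP t =
      f * (g - evP t) + g * (f - evP s) - (f - evP s) * (g - evP t) by ring.
  apply: (smallB PP uvP).
    apply: (smallD PP uvP); apply: (small_mul_bounded PP uvP (k := k0)) => //.
      by apply: bP hk1; rewrite /k0; lia.
    by apply: bP hk2; rewrite /k0; lia.
  apply: (small_leq PP OuP (l := (k + (k0 + k))%N)); first by rewrite leq_addr.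
  exact: (smallM PP uvP).
have -> : z * w - evZ s * evZ t =
    z * (w - evZ t) + w * (z - evZ s) - (z - evZ s) * (w - evZ t) by ring.
apply: (smallB OP uvZ).
  apply: (smallD OP uvZ); apply: (small_mul_bounded OP uvZ (k := k0)) => //.
    by apply: bZ hk3; rewrite /k0; lia.
  by apply: bZ hk4; rewrite /k0; lia.
apply: (small_leq OP OuZ (l := (k + (k0 + k))%N)); first by rewrite leq_addr.
exact: (smallM OP uvZ).
Qed.

Lemma eval_graph_exp f z d : eval_graph f z -> eval_graph (f ^+ d) (z ^+ d).
Proof.
move=> h; elim: d => [|d IH].
  by rewrite !expr0; have := eval_graphC 1; rewrite !rmorph1.
by rewrite !exprS; exact: eval_graphM.
Qed.

Lemma eval_graph_prod (I : Type) (s : seq I) (F : I -> P) (G : I -> Z) :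
  (forall i, eval_graph (F i) (G i)) ->
  eval_graph (\prod_(i <- s) F i) (\prod_(i <- s) G i).
Proof.
move=> h; apply: (big_rec2 eval_graph) => [|i f z _].
  by have := eval_graphC 1; rewrite !rmorph1.
by apply: eval_graphM; exact: h.
Qed.

Lemma eval_graph_dense f k : exists g w, eval_graph g w /\ smallP k (f - g).
Proof.
pose S g := exists w, eval_graph g w.
have SP : subring_pred S.
  split.
  - by exists 1; have := eval_graphC 1; rewrite !rmorph1.
  - by move=> g1 g2 [w1 h1] [w2 h2]; exists (w1 - w2); exact: eval_graphB.
  - by move=> g1 g2 [w1 h1] [w2 h2]; exists (w1 * w2); exact: eval_graphM.
have [||g [w gw] hg] := poly_dense U SP _ _ f k.
- by move=> a; exists (th a); exact: eval_graphC.
- by move=> i; exists (y i); exact: eval_graphX.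
by exists g, w.
Qed.

(** In a target that is not complete, g may have no value. It is approximated by a g' with a value
    w, and g' f has value w 0 = 0. *)
Lemma eval_graph_kerM g f : eval_graph f 0 -> eval_graph (g * f) 0.
Proof.
move=> hf; apply: eval_graph_closed => k.
have [k1 hk1] := pbd_bounded UP f.
have [g' [w [gw hg]]] := eval_graph_dense g (k1 + k).
exists (g' * f), (w * 0); split; first exact: eval_graphM.
  by rewrite -mulrBl mulrC; exact: (small_mul_bounded PP uvP hk1).
by rewrite mulr0 subr0; exact: (small0 _ OP).
Qed.

Lemma eval_graph_kerD f g : eval_graph f 0 -> eval_graph g 0 -> eval_graph (f + g) 0.
Proof. by move=> hf hg; rewrite -(addr0 0); exact: eval_graphD. Qed.

Definition eval_kernel : ideal P :=
  @Ideal P (fun f => eval_graph f 0) eval_graph0 eval_graph_kerD eval_graph_kerM.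
End EvalGraph.

Lemma rmorphism_of (S T : comPzRingType) (f : S -> T) :
  zmod_morphism f -> monoid_morphism f -> exists g : {rmorphism S -> T}, g =1 f.
Proof.
move=> fB fM.
pose mB := GRing.isZmodMorphism.Build _ _ f fB.
pose mM := GRing.isMonoidMorphism.Build _ _ f fM.
by exists (HB.pack f mB mM : {rmorphism S -> T}).
Qed.

Section Evaluation.
Variables (R : realType) (A : banachTateType R) (m : nat) (u v : A).
Hypothesis U : pseudo_unif u v.
Variables (Q : banachTateType R) (th : {rmorphism A -> Q}) (y : 'I_m -> Q).
Hypotheses (UQ : pseudo_unif (th u) (th v)) (Oth : forall a, pbd a -> pbd (th a)).
Hypothesis Oy : forall i, pbd (y i).

(** The graph is functional because the target is separated, and total because it is complete: the
    values of successive approximants of f differ by elements of u^k O, so they converge. *)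
Lemma tate_eval : exists ev : {rmorphism tate A m -> Q},
  [/\ forall a, ev (tateC m a) = th a, forall i, ev (tateX A i) = y i &
      forall f, pbd f -> pbd (ev f)].
Proof.
pose OP := pbd_subring Q.
have uvQ : th u * th v = 1 by case: UQ.
have Ou : pbd (th u) by case: UQ.
have UP := pseudo_unif_tateC m U.
have uvP : tateC m u * tateC m v = 1 by case: UP.
have OuP : pbd (tateC m u) by case: UP.
have bnd := pbd_bounded UQ.
pose G := eval_graph u th y (@pbd R Q).
have funct f z w : G f z -> G f w -> z = w.
  move=> fz fw; apply/eqP; rewrite -subr_eq0; apply/eqP/(small_sep UQ) => k.
  apply: (eval_graph_small U OP Oth Oy (f := f - f)).
    exact: (eval_graphB U OP).
  by rewrite subrr; exact: (small0 _ (pbd_subring _)).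
have total f : exists z, G f z.
  have /choice[gw gwP] k : exists p : tate A m * Q,
      G p.1 p.2 /\ small (@pbd R _) (tateC m u) k (f - p.1).
    by have [g [w [h1 h2]]] := eval_graph_dense U y OP Oth bnd f k; exists (g, w).
  have /choice[d hd] k : exists d, pbd d /\ (gw k.+1).2 - (gw k).2 = th u ^+ k * d.
    have [|d d1 d2] := eval_graph_small U OP Oth Oy (k := k)
        (eval_graphB U OP (gwP k.+1).1 (gwP k).1); last by exists d.
    have -> : (gw k.+1).1 - (gw k).1 = (f - (gw k).1) - (f - (gw k.+1).1) by ring.
    apply: (smallB (pbd_subring _) uvP); first by case: (gwP k).
    by apply: (small_leq (pbd_subring _) OuP (leqnSn k)); case: (gwP k.+1).
  have [|l hl] := small_series UQ (w := d); first by move=> k; case: (hd k).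
  exists ((gw 0).2 + l); apply: (eval_graph_closed U OP) => k.
  exists (gw k).1, (gw k).2; split; [by case: (gwP k)..|].
  have -> : (gw 0).2 + l - (gw k).2 = l - \sum_(i < k) th u ^+ i * d i.
    rewrite (_ : \sum_(i < k) _ = (gw k).2 - (gw 0).2); first by ring.
    elim: (k) => [|k' IH]; first by rewrite big_ord0 subrr.
    by rewrite big_ord_recr /= IH -(hd k').2; ring.
  exact: hl.
have /choice[ev evG] := total.
have evB : zmod_morphism ev.
  by move=> f g; exact: funct (evG _) (eval_graphB U OP (evG f) (evG g)).
have evM : monoid_morphism ev.
  split; first by apply: funct (evG _) _; have := eval_graphC u th y OP 1;
    rewrite !rmorph1.
  by move=> f g; exact: funct (evG _) (eval_graphM U OP Oth bnd (evG f) (evG g)).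
have [F FE] := rmorphism_of evB evM.
exists F; split=> [a|i|f].
- by rewrite FE; apply: funct (evG _) _; exact: (eval_graphC u th y OP).
- by rewrite FE; apply: funct (evG _) _; exact: (eval_graphX u th y OP).
rewrite FE => /(small_O _ uvP) hf; apply/(small_O _ uvQ).
exact: (eval_graph_small U OP Oth Oy (evG f)).
Qed.
End Evaluation.

(** * Finiteness from Weierstrass division *)

Section MonicPolynomials.
Variables (K : comPzRingType) (V : K -> Prop) (x : K).
Hypothesis VP : subring_pred V.

Definition adjoin_lt (d : nat) (z : K) : Prop :=
  if d is d'.+1 then adjoin V x d' z else z = 0.

(** The element z is the value at x of some monic polynomial of degree d over V. The polynomial, and
    hence d, is not determined by z. *)
Definition monic_in (d : nat) (z : K) : Prop := adjoin_lt d (z - x ^+ d).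

Lemma adjoin_lt0 d : adjoin_lt d 0.
Proof. by case: d => [//|d]; apply: (adjoinV _ VP); exact: subring0. Qed.
Lemma adjoin_ltD d y z : adjoin_lt d y -> adjoin_lt d z -> adjoin_lt d (y + z).
Proof.
case: d => [/= -> ->|d]; first by rewrite addr0.
exact: (adjoinD VP).
Qed.
Lemma adjoin_ltM d c z : V c -> adjoin_lt d z -> adjoin_lt d (c * z).
Proof. by case: d => [_ /= ->|d]; [rewrite mulr0|exact: (adjoinM VP)]. Qed.
Lemma adjoin_ltN d z : adjoin_lt d z -> adjoin_lt d (- z).
Proof.
by rewrite -mulN1r; apply: adjoin_ltM; apply: (subringN VP); exact: subring1.
Qed.
Lemma adjoin_lt_leq d e z : (d <= e)%N -> adjoin_lt d z -> adjoin_lt e z.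
Proof.
case: d => [_ /= ->|d]; first exact: adjoin_lt0.
by case: e => [//|e]; rewrite ltnS; exact: (adjoin_leq VP).
Qed.
Lemma adjoin_lt_adjoin d z : adjoin_lt d z -> adjoin V x d z.
Proof.
case: d => [/= ->|d]; first exact: subring0.
exact: (adjoin_leq VP (leqnSn d)).
Qed.
Lemma adjoin_lt_mul d e w z :
  adjoin_lt d w -> adjoin V x e z -> adjoin_lt (d + e) (w * z).
Proof.
case: d => [/= -> _|d]; first by rewrite mul0r; exact: adjoin_lt0.
exact: (adjoin_mul VP).
Qed.
Lemma adjoin_lt_monic d e z : (d < e)%N -> monic_in d z -> adjoin_lt e z.
Proof.
move=> de mz; apply: (adjoin_lt_leq de) => /=; rewrite -(subrK (x ^+ d) z).
by apply: (adjoinD VP); [exact: adjoin_lt_adjoin|exact: adjoin_pow].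
Qed.

Lemma monic_in_pow d : monic_in d (x ^+ d).
Proof. by rewrite /monic_in subrr; exact: adjoin_lt0. Qed.
Lemma monic_in1 : monic_in 0 1.
Proof. by rewrite /monic_in expr0 subrr. Qed.
Lemma monic_inD d y z : adjoin_lt d y -> monic_in d z -> monic_in d (y + z).
Proof. by rewrite /monic_in -addrA; exact: adjoin_ltD. Qed.
Lemma monic_inM d e y z : monic_in d y -> monic_in e z -> monic_in (d + e) (y * z).
Proof.
rewrite /monic_in => hy hz.
have -> : y * z - x ^+ (d + e) = (y - x ^+ d) * x ^+ e +
    (y - x ^+ d) * (z - x ^+ e) + (z - x ^+ e) * x ^+ d.
  by rewrite exprD; ring.
apply: adjoin_ltD; first apply: adjoin_ltD.
- by apply: adjoin_lt_mul => //; exact: adjoin_pow.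
- by apply: adjoin_lt_mul => //; exact: adjoin_lt_adjoin.
- by rewrite addnC; apply: adjoin_lt_mul => //; exact: adjoin_pow.
Qed.
Lemma monic_inX d n z : monic_in d z -> monic_in (d * n) (z ^+ n).
Proof.
move=> hz; elim: n => [|n IH]; first by rewrite muln0 expr0; exact: monic_in1.
by rewrite mulnS exprS; exact: monic_inM.
Qed.
Lemma monic_in_prod (I : Type) (s : seq I) (d : I -> nat) (F : I -> K) :
  (forall i, monic_in (d i) (F i)) ->
  monic_in (\sum_(i <- s) d i) (\prod_(i <- s) F i).
Proof.
move=> h; apply: (big_rec2 monic_in) => [|i a b _]; first exact: monic_in1.
exact: monic_inM.
Qed.

Lemma adjoin_lt_sum d z : adjoin_lt d z ->
  exists c : nat -> K, (forall j, V (c j)) /\ z = \sum_(j < d) c j * x ^+ j.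
Proof.
case: d => [/= ->|d].
  by exists (fun=> 0); rewrite big_ord0; split=> // _; exact: subring0.
elim: d z => [|d IH] z /=.
  by move=> Vz; exists (fun=> z); rewrite big_ord1 mulr1.
move=> [c [w [Vc /IH[b [Vb ->]] ->]]].
exists (fun j => if j is j'.+1 then b j' else c); split; first by case.
rewrite [RHS]big_ord_recl mulr1 mulr_sumr; congr (_ + _).
by apply: eq_bigr => j _; rewrite /= exprS; ring.
Qed.

Lemma adjoin_lt_mulx d z : adjoin_lt d z ->
  exists c r, [/\ V c, adjoin_lt d r & x * z = r + c * x ^+ d].
Proof.
case: d => [/= ->|d].
  by exists 0, 0; rewrite mulr0 mul0r addr0; split=> //; exact: subring0.
by move=> hz; apply: adjoin_last; exact: (adjoinX VP).
Qed.
End MonicPolynomials.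

Lemma poly_dense_pbd (R : realType) (A : banachTateType R) (m : nat) (u v : A)
    (S : tate A m -> Prop) : pseudo_unif u v -> subring_pred S ->
  (forall a, pbd a -> S (tateC m a)) -> (forall i, S (tateX A i)) ->
  forall (f : tate A m) k, pbd f ->
    exists2 g, S g & small (@pbd R _) (tateC m u) k (f - g).
Proof.
move=> U SP SC SX f k hf; have [s [us hs]] := tate_supp U f k.
exists (\sum_(d <- s) tmono (f d) d); last exact: (trunc_small U).
apply: (subring_sum SP) => d _; rewrite tmonoE; apply: (subringM SP).
  by apply: SC; exact: (pbd_tateP f).1 hf d.
by apply: (subring_prod SP) => i _; exact: (subringX SP).
Qed.

Section Nakayama.
Variables (R : realType) (C Q : banachTateType R) (h : {rmorphism C -> Q}).
Variables (u v : C) (M : ideal Q) (d : nat) (t : nat -> Q).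
Hypotheses (U : pseudo_unif u v) (UQ : pseudo_unif (h u) (h v)).
Hypothesis hO : forall c, pbd c -> pbd (h c).
Hypothesis Mclosed :
  forall x, (forall k, exists2 w, pbd w & M (x - h u ^+ k * w)) -> M x.
Hypothesis tO : forall j, pbd (t j).
Hypothesis gen : forall f, pbd f -> exists c : nat -> C, (forall j, pbd (c j)) /\
  exists2 w, pbd w & M (f - \sum_(j < d) h (c j) * t j - h u * w).

(** Feeding the remainder of [gen] back into [gen] produces coefficients that are power series in u.
    These converge in the complete ring C, and the closedness of M passes to the limit. A general f
    is first scaled into the unit ball. *)
Lemma topological_nakayama f :
  exists c : nat -> C, M (f - \sum_(j < d) h (c j) * t j).
Proof.
have OP := pbd_subring Q; have uvQ : h u * h v = 1 by case: UQ.
have OuQ : pbd (h u) by case: UQ.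
have /choice[F FP] g : exists p : (nat -> C) * Q, pbd g ->
    [/\ forall j, pbd (p.1 j), pbd p.2 &
        M (g - \sum_(j < d) h (p.1 j) * t j - h u * p.2)].
  have [hf|nf] := pselect (pbd g); last by exists (fun=> 0, 0).
  by have [c [hc [w hw Mw]]] := gen hf; exists (c, w).
have key g : pbd g -> exists c : nat -> C, M (g - \sum_(j < d) h (c j) * t j).
  move: g => {}f hf; pose fs k := iter k (fun g => (F g).2) f.
  have fsO k : pbd (fs k).
    elim: k => [|k IH]; first exact: hf.
    by have [_ h2 _] := FP _ IH; exact: h2.
  pose c k j := (F (fs k)).1 j.
  have cO k j : pbd (c k j) by have [h1 _ _] := FP _ (fsO k); exact: h1.
  have /choice[l hl] j := small_series U (fun k => cO k j).
  exists l; apply: Mclosed => k.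
  have part K : M (f - \sum_(i < K) h u ^+ i * (\sum_(j < d) h (c i j) * t j)
      - h u ^+ K * fs K).
    elim: K => [|K IH].
      by rewrite big_ord0 subr0 mul1r subrr; exact: ideal0.
    rewrite big_ord_recr /=.
    have [_ _ hM] := FP _ (fsO K).
    set S1 := \sum_(i < K) _ in IH *.
    rewrite (_ : _ - _ = (f - S1 - h u ^+ K * fs K) + h u ^+ K *
      (fs K - \sum_(j < d) h (c K j) * t j - h u * (F (fs K)).2)).
      by apply: idealD => //; exact: idealM.
    by rewrite exprSr; ring.
  have [w hw wE] : small (@pbd R Q) (h u) k
      (\sum_(i < k) h u ^+ i * (\sum_(j < d) h (c i j) * t j)
        - \sum_(j < d) h (l j) * t j).
    have -> : \sum_(i < k) h u ^+ i * (\sum_(j < d) h (c i j) * t j)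
        - \sum_(j < d) h (l j) * t j
        = - \sum_(j < d) t j * h (l j - \sum_(i < k) u ^+ i * c i j).
      under eq_bigr do rewrite mulr_sumr.
      rewrite exchange_big -sumrB -sumrN /=; apply: eq_bigr => j _.
      rewrite rmorphB rmorph_sum mulrBr opprB mulr_sumr [t j * _]mulrC.
      congr (_ - _); apply: eq_bigr => i _.
      by rewrite rmorphM rmorphXn; ring.
    apply: (smallN OP uvQ); apply: (small_sum OP uvQ) => j _.
    apply: (small_mulO OP uvQ) => //; have [w hw ->] := hl j k.
    by rewrite rmorphM rmorphXn; apply: small_exp; exact: hO.
  exists (fs k + w); first exact: (subringD OP).
  rewrite (_ : _ - _ =
    f - \sum_(i < k) h u ^+ i * (\sum_(j < d) h (c i j) * t j)
      - h u ^+ k * fs k) //.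
  by rewrite mulrDr -wE; ring.
have [k hk] := pbd_bounded UQ f; have [c Mc] := key _ hk.
exists (fun j => v ^+ k * c j).
have -> : f - \sum_(j < d) h (v ^+ k * c j) * t j =
    h v ^+ k * (h u ^+ k * f - \sum_(j < d) h (c j) * t j).
  rewrite mulrBr mulrA -exprMn (mulrC (h v)) uvQ expr1n mul1r mulr_sumr.
  by congr (_ - _); apply: eq_bigr => j _; rewrite rmorphM rmorphXn mulrA.
exact: idealM.
Qed.
End Nakayama.

Section WeierstrassFinite.
Variables (R : realType) (C Q : banachTateType R) (h : {rmorphism C -> Q}).
Variables (u v : C) (M : ideal Q) (d : nat) (x W : Q).
Hypotheses (U : pseudo_unif u v) (UQ : pseudo_unif (h u) (h v)).
Hypothesis hO : forall c, pbd c -> pbd (h c).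
Hypothesis maxM : maximal_ideal M.
Hypothesis xO : pbd x.
Let V (y : Q) : Prop := exists2 c, pbd c & y = h c.
Hypothesis Wmonic : monic_in V x d W.
Hypothesis WM : exists2 w, pbd w & M (W - h u * w).
Hypothesis gen_dense : forall S : Q -> Prop, subring_pred S ->
  (forall c, pbd c -> S (h c)) -> S x ->
  forall f, pbd f -> exists2 g, S g & small (@pbd R _) (h u) 1 (f - g).

(* The set [L] of elements that are polynomials in [x] of degree < d modulo   *)
(* [M + u Q°] is stable under [h C°] and [x], so it is everything.            *)
Lemma weierstrass_finite : fin_mod h M.
Proof.
have OP := pbd_subring Q.
have VP : subring_pred V.
  split.
  - by exists 1; rewrite ?rmorph1 //; exact: (subring1 (pbd_subring _)).
  - move=> _ _ [a ha ->] [b hb ->]; exists (a - b); rewrite ?rmorphB //.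
    exact: (subringB (pbd_subring _)).
  - move=> _ _ [a ha ->] [b hb ->]; exists (a * b); rewrite ?rmorphM //.
    exact: (subringM (pbd_subring _)).
pose L y := exists r w, [/\ adjoin_lt V x d r, pbd w & M (y - r - h u * w)].
have LD y z : L y -> L z -> L (y + z).
  move=> [r [w [hr hw Mw]]] [r' [w' [hr' hw' Mw']]]; exists (r + r'), (w + w').
  split; [exact: (adjoin_ltD VP)|exact: (subringD OP)|].
  have -> : y + z - (r + r') - h u * (w + w') =
    (y - r - h u * w) + (z - r' - h u * w') by ring.
  exact: idealD.
have LV c y : pbd c -> L y -> L (h c * y).
  move=> hc [r [w [hr hw Mw]]]; exists (h c * r), (h c * w); split.
  - by apply: (adjoin_ltM VP) => //; exists c.
  - by apply: (subringM OP) => //; exact: hO.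
  - have -> : h c * y - h c * r - h u * (h c * w) = h c * (y - r - h u * w) by ring.
    exact: idealM.
have LN y : L y -> L (- y).
  move=> Ly; rewrite -mulN1r -(rmorph1 h) -rmorphN; apply: LV => //.
  by apply: (subringN (pbd_subring _)); exact: (subring1 (pbd_subring _)).
have Lx y : L y -> L (x * y).
  move=> [r [w [hr hw Mw]]].
  have [_ [r' [[c hc ->] hr' xr]]] := adjoin_lt_mulx VP hr.
  have [w0 hw0 Mw0] := WM.
  (* Here x r = r' + c x^d, and c x^d = c W - c (W - x^d) with W in M + u Q°. *)
  exists (r' - h c * (W - x ^+ d)), (x * w + h c * w0); split.
  - apply: (adjoin_ltD VP) => //; apply: (adjoin_ltN VP).
    by apply: (adjoin_ltM VP) => //; exists c.
  - by apply: (subringD OP); apply: (subringM OP) => //; exact: hO.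
  - have -> : x * y - (r' - h c * (W - x ^+ d)) - h u * (x * w + h c * w0) =
      x * (y - r - h u * w) + h c * (W - h u * w0) by ring: xr.
    by apply: idealD; exact: idealM.
have L1 : L 1.
  (* For d = 0 the only remainder is 0, but W is then 1, so 1 itself lies in M + u Q°. *)
  case: d Wmonic @L LD LV LN Lx => [|d'] mW L LD LV LN Lx.
    have [w hw Mw] := WM; exists 0, w; split=> //.
    by rewrite subr0 -(expr0 x) -(subr0_eq mW).
  exists 1, 0; split; first by apply: (adjoinV _ VP); exact: subring1.
    exact: (subring0 OP).
  by rewrite mulr0 subr0 subrr; exact: ideal0.
pose S z := forall y, L y -> L (z * y).
have SP : subring_pred S.
  split=> [y|a b Sa Sb y Ly|a b Sa Sb y Ly]; first by rewrite mul1r.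
    by rewrite mulrBl; apply: LD; [exact: Sa|apply/LN/Sb].
  by rewrite -mulrA; apply/Sa/Sb.
suff nak f : exists c : nat -> C, M (f - \sum_(j < d) h (c j) * x ^+ j).
  by exists d, (fun j => x ^+ j) => f; have [c Mc] := nak f; exists c.
apply: (@topological_nakayama _ _ _ h u v M d (fun j => x ^+ j)) => //.
- exact: (maximal_closed UQ).
- by move=> j; exact: (subringX OP).
move=> {}f hf; have [||g Sg [w' hw' gE]] := gen_dense SP _ _ hf.
- by move=> c hc y; exact: LV.
- by move=> y; exact: Lx.
have [r [w [hr hw Mw]]] := Sg _ L1; rewrite mulr1 in Mw.
have [c [Vc rE]] := adjoin_lt_sum VP hr.
have /choice[b bP] j : exists b, pbd b /\ c j = h b.
  by have [b hb ->] := Vc j; exists b.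
exists b; split; first by move=> j; case: (bP j).
exists (w + w'); first exact: (subringD OP).
have -> : \sum_(j < d) h (b j) * x ^+ j = r.
  by rewrite rE; apply: eq_bigr => j _; case: (bP j) => _ ->.
rewrite (_ : _ - _ = g - r - h u * w) //.
by rewrite -[f](subrK g) gE expr1; ring.
Qed.
End WeierstrassFinite.

(** Evaluation at the two groups of variables has dense image on unit balls, so
    [topological_nakayama] applies with the zero ideal and the single generator 1. Surjectivity
    suffices to view a rational localization of A<T> as a quotient of a Tate algebra over A. *)
Lemma tate_tate_surj (R : realType) (A : banachTateType R) (n k : nat) :
  exists psi : {rmorphism tate A (n + k) -> tate (tate A n) k},
    (forall a, psi (tateC (n + k) a) = tateC k (tateC n a)) /\
    forall y, exists x, y = psi x.
Proof.
have [u [v U]] := pseudo_unif_exists A.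
pose Q : banachTateType R := tate (tate A n) k.
pose th : {rmorphism A -> Q} := tateC k \o tateC n.
pose y (i : 'I_(n + k)) : Q := match fintype.split i with
  | inl i => tateC k (tateX A i) | inr j => tateX (tate A n) j end.
have UP := pseudo_unif_tateC (n + k) U.
have Un := pseudo_unif_tateC n U.
have UQ : pseudo_unif (th u) (th v) := pseudo_unif_tateC k Un.
have [||psi [psiC psiX psiO]] := @tate_eval R A (n + k) u v U Q th y UQ.
- by move=> a ha; do 2! apply: pbd_tateC.
- by move=> i; rewrite /y; case: fintype.split => j; [apply/pbd_tateC|]; exact: pbd_tateX.
exists psi; split=> // z.
have OQ := pbd_subring Q; have OP := pbd_subring (tate A (n + k)).
have uvQ : th u * th v = 1 by case: UQ.
have OuQ : pbd (th u) by case: UQ.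
have [Z ZE] : exists Z : ideal Q, forall x, Z x <-> x = 0.
  have Z0 : (0 : Q) = 0 by [].
  have ZD (a b : Q) : a = 0 -> b = 0 -> a + b = 0 by move=> -> ->; rewrite addr0.
  have ZM (a x : Q) : x = 0 -> a * x = 0 by move=> ->; rewrite mulr0.
  by exists (@Ideal Q (fun x => x = 0) Z0 ZD ZM).
pose im (x : Q) := exists2 c, pbd c & x = psi c.
have imP : subring_pred im.
  split.
  - by exists 1; rewrite ?rmorph1 //; exact: (subring1 OP).
  - move=> _ _ [a ha ->] [b hb ->]; exists (a - b); rewrite ?rmorphB //.
    exact: (subringB OP).
  - move=> _ _ [a ha ->] [b hb ->]; exists (a * b); rewrite ?rmorphM //.
    exact: (subringM OP).
have imX i : im (y i) by exists (tateX A i); rewrite ?psiX //; exact: pbd_tateX.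
pose S (x : Q) := exists2 c, im c & small (@pbd R Q) (th u) 1 (x - c).
have imO c : im c -> pbd c by move=> [b hb ->]; exact: psiO.
have SP : subring_pred S.
  split.
  - by exists 1; [exact: (subring1 imP)|rewrite subrr; exact: (small0 _ OQ)].
  - move=> a b [c hc ac] [d hd bd]; exists (c - d); first exact: (subringB imP).
    rewrite (_ : _ - _ = (a - c) - (b - d)); last by ring.
    exact: (smallB OQ uvQ).
  - move=> a b [c hc ac] [d hd bd]; exists (c * d); first exact: (subringM imP).
    rewrite (_ : _ - _ = c * (b - d) + d * (a - c) + (a - c) * (b - d)); last by ring.
    apply: (smallD OQ uvQ).
      by apply: (smallD OQ uvQ); apply: (small_mulO OQ uvQ) => //; exact: imO.
    by apply: (small_leq OQ OuQ (l := 2%N)) => //; exact: (smallM OQ uvQ ac bd).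
have imS c : im c -> S c.
  by move=> hc; exists c => //; rewrite subrr; exact: (small0 _ OQ).
have SC (a : tate A n) : pbd a -> S (tateC k a).
  move=> ha; pose S' (a' : tate A n) := im (tateC k a').
  have S'P : subring_pred S'.
    split; rewrite /S'.
    - by rewrite rmorph1; exact: (subring1 imP).
    - by move=> b c hb hc; rewrite rmorphB; exact: (subringB imP).
    - by move=> b c hb hc; rewrite rmorphM; exact: (subringM imP).
  have [||g hg [w hw wE]] := poly_dense_pbd U S'P _ _ 1 ha.
  - move=> b hb; exists (tateC (n + k) b); first exact: pbd_tateC.
    by rewrite psiC.
  - move=> i; have := imX (lshift k i); rewrite /y.
    by case: (split_ordP (lshift k i)) => j /eqP; rewrite ?eq_lshift ?eq_lrshift // => /eqP->.
  exists (tateC k g) => //; rewrite -rmorphB wE rmorphM rmorphXn.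
  by apply: small_exp; exact: pbd_tateC.
have nak f : exists c : nat -> tate A (n + k), Z (f - \sum_(j < 1) psi (c j) * 1).
  apply: (@topological_nakayama R (tate A (n + k)) Q psi
    (tateC (n + k) u) (tateC (n + k) v) Z 1
    (fun=> 1)).
  - exact: UP.
  - by rewrite !psiC.
  - exact: psiO.
  - move=> x hx; apply/ZE/(small_sep UQ) => j; have [w hw /ZE e] := hx j.
    by exists w => //; have := subr0_eq e; rewrite psiC.
  - by move=> _; exact: (subring1 OQ).
  move=> {}f hf; have [|g [_ [c hc ->] gc] fg] :=
    @poly_dense_pbd R (tate A n) k _ _ S Un SP SC _ f 1 hf.
    move=> i; apply: imS; have := imX (rshift n i); rewrite /y.
    by case: (split_ordP (rshift n i)) => j /eqP; rewrite ?eq_rshift ?eq_rlshift // => /eqP->.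
  have [w hw e] : small (@pbd R Q) (th u) 1 (f - psi c).
    by rewrite -(subrKA g); exact: (smallD OQ uvQ).
  exists (fun=> c); split=> //; exists w => //; apply/ZE.
  by rewrite big_ord1 mulr1 psiC e expr1 subrr.
have [c /ZE e] := nak z; exists (c 0%N).
by move: e; rewrite big_ord1 mulr1 => /subr0_eq.
Qed.

(** * Dominant terms and rational localizations *)

Lemma seq_total_max (T : eqType) (r : T -> T -> Prop) (s : seq T) :
  (forall x, r x x) -> (forall x y z, r x y -> r y z -> r x z) ->
  (forall x y, r x y \/ r y x) -> s != [::] ->
  exists2 x, x \in s & forall y, y \in s -> r y x.
Proof.
move=> rr rt rtot; elim: s => [//|a [|b s] IH] _.
  by exists a; rewrite ?mem_head // => y; rewrite inE => /eqP->.
have [//|x xs hx] := IH; have [xa|ax] := rtot x a.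
  exists a; first exact: mem_head.
  by move=> y; rewrite inE => /orP[/eqP->//|/hx yx]; exact: rt xa.
exists x; first by rewrite inE xs orbT.
by move=> y; rewrite inE => /orP[/eqP->//|]; exact: hx.
Qed.

(** Uniqueness of base D digits: exponents bounded by D are told apart by their weights. *)
Lemma digits_inj D n (a b : 'I_n -> nat) :
  (forall i, (a i < D)%N) -> (forall i, (b i < D)%N) ->
  (\sum_(i < n) D ^ i * a i = \sum_(i < n) D ^ i * b i)%N -> forall i, a i = b i.
Proof.
elim: n a b => [|n IH] a b ha hb; first by move=> _ [].
rewrite !big_ord_recl /= !expn0 !mul1n.
have tl c : (\sum_(i < n) D ^ bump 0 i * c (lift ord0 i) =
    (\sum_(i < n) D ^ i * c (lift ord0 i)) * D)%N.
  by rewrite big_distrl; apply: eq_bigr => i _; rewrite /= /bump add1n expnS; lia.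
rewrite !tl => e; have e0 : a ord0 = b ord0.
  have := congr1 (modn^~ D) e.
  by rewrite /= ![(_ + _ * D)%N]addnC !modnMDl !modn_small.
have D0 : (0 < D)%N by apply: leq_ltn_trans (ha ord0).
have eI i : a (lift ord0 i) = b (lift ord0 i).
  apply: (IH (fun i => a (lift ord0 i)) (fun i => b (lift ord0 i))) => //.
  move: e; rewrite e0 => /addnI/eqP; rewrite eqn_pmul2r // => /eqP; exact.
by move=> i; case: (unliftP ord0 i) => [j|] ->.
Qed.

Section Fractions.
Variables (A K : comPzRingType) (th : {rmorphism A -> K}).
Hypothesis Kfield : forall x : K, x <> 0 -> exists y, x * y = 1.
Hypothesis K1 : (1 : K) <> 0.

Lemma field_mul_neq0 (x y : K) : x <> 0 -> y <> 0 -> x * y <> 0.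
Proof.
move=> /Kfield[x' xx'] /Kfield[y' yy'] xy; apply: K1.
by rewrite -[1]mulr1 -{1}xx' -yy' mulrACA xy mul0r.
Qed.

(** The fraction field of the image of A in K, whose elements a rational localization of A can
    adjoin. *)
Definition is_frac (z : K) : Prop := exists a b, th b <> 0 /\ z * th b = th a.

Lemma is_frac_th a : is_frac (th a).
Proof. by exists a, 1; rewrite rmorph1 mulr1. Qed.
Lemma is_fracD x y : is_frac x -> is_frac y -> is_frac (x + y).
Proof.
move=> [a [b [b0 e]]] [a' [b' [b'0 e']]]; exists (a * b' + a' * b), (b * b').
split; first by rewrite rmorphM; exact: field_mul_neq0.
by rewrite rmorphD !rmorphM -e -e'; ring.
Qed.
Lemma is_fracM x y : is_frac x -> is_frac y -> is_frac (x * y).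
Proof.
move=> [a [b [b0 e]]] [a' [b' [b'0 e']]]; exists (a * a'), (b * b').
split; first by rewrite rmorphM; exact: field_mul_neq0.
by rewrite !rmorphM -e -e'; ring.
Qed.
Lemma is_fracX x n : is_frac x -> is_frac (x ^+ n).
Proof.
move=> hx; elim: n => [|n IH]; first by rewrite expr0 -(rmorph1 th); exact: is_frac_th.
by rewrite exprS; exact: is_fracM.
Qed.
Lemma is_fracV x y : is_frac x -> x * y = 1 -> is_frac y.
Proof.
move=> [a [b [b0 e]]] xy; exists b, a; split.
  rewrite -e; apply: field_mul_neq0 => // x0; apply: K1.
  by rewrite -xy x0 mul0r.
by rewrite -e; ring: xy.
Qed.
Lemma is_frac_sum (I : Type) (s : seq I) (P : pred I) (F : I -> K) :
  (forall i, P i -> is_frac (F i)) -> is_frac (\sum_(i <- s | P i) F i).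
Proof.
move=> h; apply: big_ind => //; last exact: is_fracD.
by rewrite -(rmorph0 th); exact: is_frac_th.
Qed.
Lemma is_frac_prod (I : Type) (s : seq I) (P : pred I) (F : I -> K) :
  (forall i, P i -> is_frac (F i)) -> is_frac (\prod_(i <- s | P i) F i).
Proof.
move=> h; apply: big_ind => //; last exact: is_fracM.
by rewrite -(rmorph1 th); exact: is_frac_th.
Qed.

Lemma common_denominator (ys : seq K) : (forall y, y \in ys -> is_frac y) ->
  exists G, th G <> 0 /\ forall y, y \in ys -> exists q, y * th G = th q.
Proof.
elim: ys => [|z ys IH] h; first by exists 1; rewrite rmorph1.
have [|G [G0 hG]] := IH; first by move=> y yys; apply: h; rewrite inE yys orbT.
have [a [b [b0 e]]] := h z (mem_head _ _).
exists (G * b); split; first by rewrite rmorphM; exact: field_mul_neq0.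
move=> y; rewrite inE => /orP[/eqP->|/hG[q qe]].
  by exists (G * a); rewrite !rmorphM -e; ring.
by exists (q * b); rewrite !rmorphM -qe; ring.
Qed.

Variables (V : K -> Prop) (u v : A).
Hypothesis uv : u * v = 1.
Hypothesis Vbnd : forall z, exists k, V (th u ^+ k * z).

(* Adding [u ^+ N / G] to the family makes its numerators generate the unit   *)
(* ideal.                                                                     *)
Lemma rational_family (ys : seq K) : (forall y, y \in ys -> V y /\ is_frac y) ->
  exists k (y : 'I_k -> K) (q : 'I_k -> A) (G : A) (idx : K -> 'I_k),
    [/\ forall i, V (y i), forall i, y i * th G = th (q i),
        exists (c : 'I_k -> A) (d : A), \sum_i c i * q i + d * G = 1 &
        forall z, z \in ys -> y (idx z) = z].
Proof.
move=> h; have [G [G0 hG]] := common_denominator (fun y yys => (h y yys).2).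
have [g' Gg'] := Kfield G0; have [N hN] := Vbnd g'.
pose ys' := (th u ^+ N * g') :: ys.
pose y (i : 'I_(size ys).+1) := nth 0 ys' i.
have /choice[q qP] (i : 'I_(size ys).+1) : exists q, y i * th G = th q /\
    (i = ord0 -> q = u ^+ N).
  case: (unliftP ord0 i) => [j|] ->.
    have [|q qe] := hG (y (lift ord0 j)); first by rewrite /y lift0; exact: (@mem_nth _ 0 ys).
    by exists q; split.
  by exists (u ^+ N); split=> //; rewrite /y /= rmorphXn; ring: Gg'.
exists (size ys).+1, y, q, G, (fun z => inord (index z ys')); split.
- move=> i; have : y i \in ys' by rewrite mem_nth.
  by rewrite inE => /orP[/eqP->//|/h[]].
- by move=> i; case: (qP i).
- exists (fun i => if i == ord0 then v ^+ N else 0), 0.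
  rewrite mul0r addr0 (bigD1 ord0) //= big1 => [|i /negbTE->]; last by rewrite mul0r.
  by case: (qP ord0) => _ ->//; rewrite addr0 mulrC -exprMn uv expr1n.
- move=> z zys; have zys' : z \in ys' by rewrite inE zys orbT.
  by rewrite /y inordK ?nth_index // -[X in (_ < X)%N]/(size ys') index_mem.
Qed.
End Fractions.

Section NilpotentModulo.
Variables (Q : comPzRingType) (O : Q -> Prop) (u : Q) (M : ideal Q).
Hypothesis OP : subring_pred O.

Definition in_Mu (x : Q) : Prop := exists2 w, O w & M (x - u * w).
(** The radical of M + u O inside O; it is an ideal of O by [nil_modM] and [nil_modD]. *)
Definition nil_mod (x : Q) : Prop := O x /\ exists s, in_Mu (x ^+ s).

Lemma in_Mu0 : in_Mu 0.
Proof. by exists 0; [exact: subring0|rewrite mulr0 subrr; exact: ideal0]. Qed.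
Lemma in_MuD x y : in_Mu x -> in_Mu y -> in_Mu (x + y).
Proof.
move=> [w hw Mw] [z hz Mz]; exists (w + z); first exact: subringD.
have -> : x + y - u * (w + z) = (x - u * w) + (y - u * z) by ring.
exact: idealD.
Qed.
Lemma in_MuM a x : O a -> in_Mu x -> in_Mu (a * x).
Proof.
move=> Oa [w hw Mw]; exists (a * w); first exact: subringM.
by rewrite mulrCA -mulrBr; exact: idealM.
Qed.
Lemma in_Mu_mulrn x n : in_Mu x -> in_Mu (x *+ n).
Proof.
by move=> hx; elim: n => [|n IH]; [exact: in_Mu0|rewrite mulrS; exact: in_MuD].
Qed.

Lemma nil_mod_in x : O x -> in_Mu x -> nil_mod x.
Proof. by move=> Ox hx; split=> //; exists 1%N. Qed.
Lemma nil_modM a x : O a -> nil_mod x -> nil_mod (a * x).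
Proof.
move=> Oa [Ox [s hs]]; split; first exact: subringM.
by exists s; rewrite exprMn; apply: in_MuM => //; exact: subringX.
Qed.
Lemma nil_modN x : nil_mod x -> nil_mod (- x).
Proof.
by rewrite -mulN1r; apply: nil_modM; apply: (subringN OP); exact: subring1.
Qed.
Lemma nil_modD x y : nil_mod x -> nil_mod y -> nil_mod (x + y).
Proof.
move=> [Ox [s hs]] [Oy [t ht]]; split; first exact: subringD.
exists (s + t)%N; rewrite exprDn; apply: big_ind; [exact: in_Mu0|exact: in_MuD|].
move=> i _; apply: in_Mu_mulrn; have [it|ti] := leqP i t.
  rewrite -(addnBA _ it) exprD -mulrA mulrC; apply: in_MuM => //.
  by apply: (subringM OP); exact: subringX.
rewrite -(subnK (ltnW ti)) exprD mulrA; apply: in_MuM => //.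
by apply: (subringM OP); exact: subringX.
Qed.
Lemma nil_mod_sum (I : Type) (r : seq I) (P : pred I) (F : I -> Q) :
  (forall i, P i -> nil_mod (F i)) -> nil_mod (\sum_(i <- r | P i) F i).
Proof.
move=> h; apply: big_ind => //; last exact: nil_modD.
by apply: nil_mod_in; [exact: subring0|exact: in_Mu0].
Qed.
End NilpotentModulo.

(* [a] has the largest weight among the indices where [b] has the largest     *)
(* absolute value; rank one makes the ratios of heavier terms topologically   *)
(* nilpotent.                                                                 *)
Lemma dominant_term (K : comPzRingType) (V : K -> Prop) (u : K) (T : eqType)
    (s : seq T) (b : T -> K) (w : T -> nat) (a0 : T) :
  (forall x : K, x <> 0 -> exists y, x * y = 1) ->
  subring_pred V -> (forall x y, x * y = 1 -> V x \/ V y) ->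
  (forall x y, x * y = 1 -> ~ V x -> exists d z, V z /\ y ^+ d = u * z) ->
  a0 \in s -> b a0 = 1 -> (1 : K) <> 0 ->
  exists2 a, a \in s & exists2 c, b a * c = 1 &
    forall a', a' \in s -> V (b a' * c) /\
      ((w a < w a')%N -> exists d z, V z /\ (b a' * c) ^+ d = u * z).
Proof.
move=> Kfield VP val rank1 a0s ba0 K1.
pose dvd (x y : K) := exists2 c, V c & x = c * y.
have dvdR x : dvd x x by exists 1; rewrite ?mul1r //; exact: subring1.
have dvdT x y z : dvd x y -> dvd y z -> dvd x z.
  move=> [c hc ->] [d hd ->]; exists (c * d); rewrite ?mulrA //.
  exact: subringM.
have dvd_tot x y : dvd x y \/ dvd y x.
  have [->|x0] := pselect (x = 0).
    by left; exists 0; rewrite ?mul0r //; exact: subring0.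
  have [->|y0] := pselect (y = 0).
    by right; exists 0; rewrite ?mul0r //; exact: subring0.
  have [x' xx'] := Kfield _ x0; have [y' yy'] := Kfield _ y0.
  have [h|h] := val (x * y') (y * x') ltac:(ring: xx' yy').
    by left; exists (x * y') => //; ring: yy'.
  by right; exists (y * x') => //; ring: xx'.
have s0 : s != [::] by case: (s) a0s.
have [a1 a1s ha1] := @seq_total_max _ (fun a a' => dvd (b a) (b a')) s
  (fun a => dvdR _) (fun a a' a'' => @dvdT _ _ _) (fun a a' => dvd_tot _ _) s0.
pose s' := [seq a <- s | `[< dvd (b a1) (b a) >]].
have a1s' : a1 \in s' by rewrite mem_filter a1s andbT; apply/asboolP.
have [||||a] := @seq_total_max _ (fun a a' => (w a <= w a')%N) s'.
- by [].
- by move=> x y z; exact: leq_trans.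
- by move=> x y; case: (leqP (w x) (w y)) => [|/ltnW]; [left|right].
- by case: (s') a1s'.
rewrite mem_filter => /andP[/asboolP da1 as_ ] amax.
exists a => //; have [|c bc] := Kfield (b a).
  move=> ba; have [d _ e] := dvdT _ _ _ (ha1 _ a0s) da1; apply: K1.
  by rewrite -ba0 e ba mulr0.
exists c => // a' a's.
have [d Vd ba'] := dvdT _ _ _ (ha1 _ a's) da1.
have -> : b a' * c = d by rewrite ba'; ring: bc.
split=> // wa.
have [d0|d0] := pselect (d = 0).
  by exists 1%N, 0; rewrite d0 mulr0 expr1; split=> //; exact: subring0.
have [d' dd'] := Kfield _ d0.
(* If the inverse of the ratio d were in V, then [b a'] would also have the largest absolute value,
   against the choice of a as heaviest among those. *)
apply: (rank1 d'); first by rewrite mulrC.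
move=> Vd'; suff : a' \in s' by move=> /amax; rewrite leqNgt wa.
rewrite mem_filter a's andbT; apply/asboolP; apply: dvdT da1 _.
by exists d' => //; rewrite ba'; ring: dd'.
Qed.

(** * The induction on the number of variables *)

Definition join_family (T : Type) (k n : nat) (y : 'I_k -> T) (t : 'I_n -> T)
    (i : 'I_(k + n)) : T :=
  match fintype.split i with inl j => y j | inr j => t j end.

Lemma join_familyL (T : Type) (k n : nat) (y : 'I_k -> T) (t : 'I_n -> T) i :
  join_family y t (lshift n i) = y i.
Proof. by rewrite /join_family; have -> := unsplitK (inl i : 'I_k + 'I_n). Qed.
Lemma join_familyR (T : Type) (k n : nat) (y : 'I_k -> T) (t : 'I_n -> T) i :
  join_family y t (rshift k i) = t i.
Proof. by rewrite /join_family; have -> := unsplitK (inr i : 'I_k + 'I_n). Qed.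
Lemma join_familyP (T : Type) (k n : nat) (y : 'I_k -> T) (t : 'I_n -> T)
    (P : T -> Prop) :
  (forall i, P (y i)) -> (forall i, P (t i)) -> forall i, P (join_family y t i).
Proof. by move=> hy ht i; rewrite /join_family; case: fintype.split. Qed.

Section Shear.
Variables (R : realType) (A : banachTateType R) (k n : nat).
Local Notation C := (tate A (k + n)).
Local Notation P := (tate A (k + n.+1)).
Local Notation X i := (tateX A (lshift n.+1 i) : P).
Local Notation T j := (tateX A (rshift k j) : P).
Local Notation tau := (tateX A (rshift k (@ord0 n)) : P).

Lemma tate_eval_base (u v : A) m m' (y : 'I_m -> tate A m') :
  pseudo_unif u v -> (forall i, pbd (y i)) ->
  exists ev : {rmorphism tate A m -> tate A m'},
  [/\ forall a, ev (tateC m a) = tateC m' a, forall i, ev (tateX A i) = y i &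
      forall f, pbd f -> pbd (ev f)].
Proof.
move=> U hy; apply: (@tate_eval R A m u v U (tate A m') (tateC m')) => //.
  exact: pseudo_unif_tateC.
by move=> a; exact: pbd_tateC.
Qed.

(** In place of an automorphism of P, this maps a ring with one variable less into P. Over its
    image, P is topologically generated by tau, since T_(j+1) is the image of T_j plus tau^(e j). *)
Lemma shear_map (e : 'I_n -> nat) : exists h : {rmorphism C -> P},
  [/\ forall a, h (tateC (k + n) a) = tateC (k + n.+1) a,
      forall i, h (tateX A (lshift n i)) = X i,
      forall j, h (tateX A (rshift k j)) = T (lift ord0 j) - tau ^+ e j &
      forall f, pbd f -> pbd (h f)].
Proof.
have [u [v U]] := pseudo_unif_exists A.
have OP := pbd_subring P.
pose y := join_family (fun i => X i) (fun j => T (lift ord0 j) - tau ^+ e j).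
have [|h [hC hX hO]] := tate_eval_base U (y := y).
  apply: join_familyP => i; first exact: pbd_tateX.
  by apply: (subringB OP); [|apply: (subringX OP)]; exact: pbd_tateX.
exists h; split=> // i; first by rewrite hX /y join_familyL.
by rewrite hX /y join_familyR.
Qed.

Variables (e : 'I_n -> nat) (h : {rmorphism C -> P}).
Hypothesis hC : forall a, h (tateC (k + n) a) = tateC (k + n.+1) a.
Hypothesis hX : forall i, h (tateX A (lshift n i)) = X i.
Hypothesis hT : forall j, h (tateX A (rshift k j)) = T (lift ord0 j) - tau ^+ e j.
Hypothesis hO : forall f, pbd f -> pbd (h f).

Definition shear_image (z : P) : Prop := exists2 c, pbd c & z = h c.

Lemma shear_image_subring : subring_pred shear_image.
Proof.
have OC := pbd_subring C; split.
- by exists 1; rewrite ?rmorph1 //; exact: (subring1 OC).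
- move=> _ _ [a ha ->] [b hb ->]; exists (a - b); rewrite ?rmorphB //.
  exact: (subringB OC).
- move=> _ _ [a ha ->] [b hb ->]; exists (a * b); rewrite ?rmorphM //.
  exact: (subringM OC).
Qed.

Lemma shear_imageX i : shear_image (X i).
Proof. by exists (tateX A (lshift n i)); rewrite ?hX //; exact: pbd_tateX. Qed.

Lemma shear_monic_var (w : 'I_n.+1 -> nat) : w ord0 = 1%N ->
  (forall j, w (lift ord0 j) = e j) -> (forall j, 0 < e j)%N ->
  forall j, monic_in shear_image tau (w j) (T j).
Proof.
move=> w0 we e0 j; have VP := shear_image_subring.
case: (unliftP ord0 j) => [i|] ->; last first.
  by rewrite w0 -{2}(expr1 tau); exact: monic_in_pow.
rewrite we /monic_in -hT.
case: (e i) (e0 i) => // d _; apply: (adjoinV _ VP).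
by exists (tateX A (rshift k i)) => //; exact: pbd_tateX.
Qed.

(** The weight of an exponent is thus the degree in tau of its monomial after shearing. *)
Lemma shear_monic_mon (w : 'I_n.+1 -> nat) : w ord0 = 1%N ->
  (forall j, w (lift ord0 j) = e j) -> (forall j, 0 < e j)%N ->
  forall nu : mon n.+1,
  monic_in shear_image tau (\sum_j w j * nu j)%N (\prod_j T j ^+ nu j).
Proof.
move=> w0 we e0 nu; apply: (monic_in_prod shear_image_subring) => j.
by apply: (monic_inX shear_image_subring); exact: shear_monic_var.
Qed.

(** Such an M amounts to a maximal ideal of B<T_1, ..., T_m>, where B is the rational localization
    of A with parameters f and g. *)
Definition finite_residue (m : nat) : Prop :=
  forall l (f : 'I_l -> A) (g : A),
  (exists (c : 'I_l -> A) (d : A), \sum_i c i * f i + d * g = 1) ->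
  forall M : ideal (tate A (l + m)), maximal_ideal M ->
  (forall i, M (tateC (l + m) g * tateX A (lshift m i) - tateC (l + m) (f i))) ->
  fin_mod (tateC (l + m)) M.

(** Weierstrass division makes P / M finite over C. The preimage of M in C is then maximal, and it
    still contains the relations because h fixes the X_i, so the case of n variables finishes the
    tower. *)
Lemma shear_finite (u v : A) (M : ideal P) (f : 'I_k -> A) (g : A) d W :
  pseudo_unif u v -> finite_residue n ->
  (exists (c : 'I_k -> A) (d : A), \sum_i c i * f i + d * g = 1) ->
  maximal_ideal M ->
  (forall i, M (tateC (k + n.+1) g * X i - tateC (k + n.+1) (f i))) ->
  monic_in shear_image tau d W ->
  in_Mu (@pbd R P) (tateC (k + n.+1) u) M W ->
  fin_mod (tateC (k + n.+1)) M.
Proof.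
move=> U fr unit maxM rel Wm WM.
have UC := pseudo_unif_tateC (k + n) U.
have UP : pseudo_unif (h (tateC (k + n) u)) (h (tateC (k + n) v)).
  by rewrite !hC; exact: pseudo_unif_tateC.
have fin : fin_mod h M.
  apply: (@weierstrass_finite R C P h _ _ M d tau W UC UP) => //.
  - exact: pbd_tateX.
  - by rewrite hC.
  move=> S SP Sh St p hp; rewrite hC.
  apply: (@poly_dense_pbd R A (k + n.+1) u v) => //.
  - by move=> a ha; rewrite -hC; apply: Sh; exact: pbd_tateC.
  move=> i; case: (split_ordP i) => j ->.
    by rewrite -hX; apply: Sh; exact: pbd_tateX.
  case: (unliftP ord0 j) => [i'|] -> //.
  rewrite -(subrK (tau ^+ e i') (T (lift ord0 i'))) -hT.
  apply: (subringD SP); last exact: (subringX SP).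
  by apply: Sh; exact: pbd_tateX.
apply: (fin_mod_comp (f := tateC (k + n)) (g := h)) => //.
apply: (fr k f g) => //; first exact: preim_maximal_fin.
by move=> i; rewrite /= /preimage /= rmorphB rmorphM !hC hX; exact: rel.
Qed.
End Shear.

(** * Valuations on residue fields and adjunction of integral elements *)

Section ResidueField.
Variables (R : realType) (Q : banachTateType R) (u v : Q) (M : ideal Q).
Hypotheses (U : pseudo_unif u v) (maxM : maximal_ideal M).
Local Notation phi := (quot_pi M).

Lemma residue_valuation : exists V : quot M -> Prop,
  [/\ subring_pred V, forall p, pbd p -> V (phi p), ~ V (phi v),
      forall x y, x * y = 1 -> V x \/ V y &
      forall x y, x * y = 1 -> ~ V x -> exists d w, V w /\ y ^+ d = phi u * w].
Proof.
have OQ := pbd_subring Q; have [uv Ou _] := U.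
pose D z := exists2 p, pbd p & z = phi p.
have [||||V [VP DV Vv val rank1]] :=
    @valuation_above (quot M) D (phi u) (phi v) (quot_field maxM).
- split.
  + by exists 1; rewrite ?rmorph1 //; exact: (subring1 OQ).
  + move=> _ _ [a ha ->] [b hb ->]; exists (a - b); rewrite ?rmorphB //.
    exact: (subringB OQ).
  + move=> _ _ [a ha ->] [b hb ->]; exists (a * b); rewrite ?rmorphM //.
    exact: (subringM OQ).
- by rewrite -rmorphM uv rmorph1.
- by exists u.
- move=> [p hp /quot_piP Mvp].
  have := idealM u Mvp; rewrite mulrBr uv.
  by apply: (pseudo_unif_not_small U _ hp); case: maxM.
by exists V; split=> // p hp; apply: DV; exists p.
Qed.

Variable V : quot M -> Prop.
Hypothesis phiV : forall p, pbd p -> V (phi p).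

Lemma residue_bounded z : exists k, V (phi u ^+ k * z).
Proof.
have [p ->] := quot_surj z; have [k hk] := pbd_bounded U p.
by exists k; rewrite -rmorphXn -rmorphM; exact: phiV.
Qed.

Lemma small_quot_pi k p : small (@pbd R Q) u k p -> small V (phi u) k (phi p).
Proof.
by move=> [w hw ->]; rewrite rmorphM rmorphXn; apply: small_exp; exact: phiV.
Qed.
End ResidueField.

(* Given finitely many elements [y] of the residue field that are integral    *)
(* for [V], the residue field embeds in a residue field of a Tate algebra     *)
(* with variables mapping to [y], on which polynomial relations persist.      *)
Section Extension.
Variables (R : realType) (A : banachTateType R) (u v : A) (k n : nat).
Hypothesis U : pseudo_unif u v.
Local Notation P := (tate A (k + n)).
Variable M : ideal P.
Hypothesis maxM : maximal_ideal M.
Local Notation phi := (quot_pi M).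
Let th : {rmorphism A -> quot M} := phi \o tateC (k + n).
Variable V : quot M -> Prop.
Hypotheses (VP : subring_pred V) (phiV : forall p, pbd p -> V (phi p)).
Hypothesis Vv : ~ V (th v).
Variables (k1 : nat) (y : 'I_k1 -> quot M) (l : 'I_k -> 'I_k1).
Hypotheses (Vy : forall i, V (y i)).
Hypothesis yl : forall i, y (l i) = phi (tateX A (lshift n i)).
Let yt := join_family y (fun j => phi (tateX A (rshift k j))).
Local Notation P1 := (tate A (k1 + n)).
Local Notation graph := (eval_graph u th yt V).

Lemma residue_extension : exists (M1 : ideal P1) (j : {rmorphism P -> P1}),
  [/\ maximal_ideal M1, forall h, graph h 0 -> M1 h,
      (forall p, graph (j p) (phi p)) /\ (forall p, pbd p -> pbd (j p)),
      forall a, j (tateC (k + n) a) = tateC (k1 + n) a &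
      forall p, M1 (j p) -> M p].
Proof.
have UP := pseudo_unif_tateC (k + n) U.
have uv : u * v = 1 by case: U.
have uvK : th u * th v = 1 by rewrite -rmorphM uv rmorph1.
have Oth a : pbd a -> V (th a) by move=> ha; apply: phiV; exact: pbd_tateC.
have Obnd z : exists k, V (th u ^+ k * z) := residue_bounded UP phiV z.
have Oyt i : V (yt i).
  by apply: join_familyP => // j; apply: phiV; exact: pbd_tateX.
(* M1 will be any maximal ideal above the series with value 0 at the family [yt]; no completion of
   the residue field is formed. *)
pose J := eval_kernel U yt VP Oth Obnd.
(* If 1 had the value 0, then 0 would have the value 1, so 1 would lie in u V and v in V. *)
have J1 : ~ J 1.
  move=> /= h1; have h2 := eval_graphC u th yt VP 1.
  rewrite !rmorph1 in h2.
  have h3 : graph 0 1 by rewrite -(subrr 1) -[X in graph _ X]subr0; exact: (eval_graphB U VP).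
  have [w Vw e] := eval_graph_small U VP Oth Oyt h3 (small0 _ (pbd_subring _) 1).
  apply: Vv; suff -> : th v = w by [].
  by rewrite -[LHS]mulr1 e expr1; ring: uvK.
have [M1 maxM1 JM1] := maximal_above J1.
pose y1 := join_family (fun i => tateX A (lshift n (l i)) : P1)
  (fun j => tateX A (rshift k1 j)).
have [|j [jC jX jO]] := tate_eval_base U (y := y1).
  by apply: join_familyP => i; exact: pbd_tateX.
have jG p : graph (j p) (phi p).
  pose S p := graph (j p) (phi p).
  have SP : subring_pred S.
    split; rewrite /S.
    - by have := eval_graphC u th yt VP 1; rewrite !rmorph1.
    - by move=> a b ha hb; rewrite !rmorphB; exact: (eval_graphB U VP).
    - by move=> a b ha hb; rewrite !rmorphM; exact: (eval_graphM U VP Oth Obnd).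
  apply: (eval_graph_closed U VP) => K.
  have [||g Sg pg] := poly_dense U SP _ _ p K.
  - by move=> a; rewrite /S jC; exact: (eval_graphC u th yt VP).
  - move=> i; rewrite /S jX; case: (split_ordP i) => i' ->.
      rewrite /y1 join_familyL -yl -[y (l i')](join_familyL y
        (fun j => phi (tateX A (rshift k j)))).
      exact: (eval_graphX u th yt VP).
    rewrite /y1 join_familyR -[phi _](join_familyR y
        (fun j => phi (tateX A (rshift k j)))).
    exact: (eval_graphX u th yt VP).
  exists (j g), (phi g); split=> //.
    rewrite -rmorphB; have [w hw ->] := pg; rewrite rmorphM rmorphXn jC.
    by apply: small_exp; exact: jO.
  by rewrite -rmorphB; exact: small_quot_pi.
exists M1, j; split=> // p.
have [M1n1 _] := maxM1; have [_ maxM'] := maxM.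
(* The preimage of M1 is proper and contains M, so it lies in M by maximality. *)
apply: (maxM' (preim_ideal j M1)); last by rewrite /= /preimage /= rmorph1.
move=> q Mq; apply: JM1; have := jG q.
by have -> : phi q = 0 by apply/quot_pi0.
Qed.
End Extension.

Section ResidueStep.
Variables (R : realType) (A : banachTateType R) (u v : A).
Hypothesis U : pseudo_unif u v.

Lemma finite_residueS n : finite_residue A n -> finite_residue A n.+1.
Proof.
move=> fr k f g unit M maxM rel.
have M1 : ~ M 1 by case: maxM.
have uv : u * v = 1 by case: U.
pose P := tate A (k + n.+1).
have UP := pseudo_unif_tateC (k + n.+1) U.
have uvP : tateC (k + n.+1) u * tateC (k + n.+1) v = 1 by case: UP.
have OP := pbd_subring P.
pose tau : P := tateX A (rshift k ord0).
(* If tau is in M, then W = tau is already monic of degree 1 and any shear will do. *)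
have [Mtau|nMtau] := pselect (M tau).
  have [h [hC hX hT hO]] := shear_map A k (fun _ : 'I_n => 1%N).
  apply: (shear_finite hC hX hT hO U fr unit maxM rel (d := 1%N) (W := tau)).
    have := monic_in_pow tau (shear_image_subring h) 1; rewrite expr1; exact.
  by exists 0; [exact: (subring0 OP)|rewrite mulr0 subr0].
pose phi : {rmorphism P -> quot M} := quot_pi M.
pose th : {rmorphism A -> quot M} := phi \o tateC (k + n.+1).
have Kfield := quot_field maxM.
have K1 := quot_one_neq0 M1.
have uvK : th u * th v = 1 by rewrite -rmorphM uv rmorph1.
have [V [VP phiV Vv val rank1]] := residue_valuation UP maxM.
have Vbnd z : exists k, V (th u ^+ k * z) := residue_bounded UP phiV z.
(* As [tau] is invertible modulo [M], some [p = 1 - tau h0] lies in [M]; its  *)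
(* constant coefficient as a series in the [T_j] is 1, hence nonzero in the   *)
(* residue field.                                                             *)
have [p Mp pE] : exists2 p : P, M p & forall nu : mon (k + n.+1),
    nu (rshift k ord0) = 0%N -> p nu = if nu == 0 then 1 else 0.
  have [h0 Mp] := maximal_inv maxM nMtau; exists (1 - tau * h0) => // nu nu0.
  rewrite tcoefB tcoef1 [tau * h0]mulrC.
  rewrite (_ : (h0 * tau) nu = 0) ?subr0 // tcoefM big1_seq // => d /andP[_ _].
  rewrite /tau tmonoX tcoef_tmono; case: eqP => [e|]; last by rewrite mulr0.
  have := congr1 (fun m : mon (k + n.+1) => m (rshift k ord0)) e.
  by rewrite !ffunE nu0 sub0n eqxx.
(* Up to u E with E in the unit ball, p is a polynomial with support s; 0 is added to s to keep the
   constant coefficient. *)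
have [s0 [us0 hs0]] := tate_supp U p 1.
pose s := undup (0 :: s0); have us : uniq s by exact: undup_uniq.
have s_0 : 0 \in s by rewrite mem_undup mem_head.
have hs nu : nu \notin s -> small (@pbd R A) u 1 (p nu).
  by rewrite mem_undup inE negb_or => /andP[_ /hs0].
have [E hE pE'] := trunc_small U us hs.
rewrite expr1 in pE'.
pose tpart (nu : mon (k + n.+1)) : mon n.+1 := [ffun j => nu (rshift k j)].
pose x (i : 'I_k) : quot M := phi (tateX A (lshift n.+1 i)).
pose t (j : 'I_n.+1) : quot M := phi (tateX A (rshift k j)).
(* The coefficient of T^mu in the truncated p, evaluated in the residue field. *)
pose b (mu : mon n.+1) : quot M := \sum_(nu <- s | tpart nu == mu)
  th (p nu) * \prod_i x i ^+ nu (lshift n.+1 i).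
pose T := undup [seq tpart nu | nu <- s].
have uT : uniq T by exact: undup_uniq.
have tpart0 : tpart 0 = 0 by apply/ffunP => j; rewrite !ffunE.
have T0 : 0 \in T by rewrite mem_undup -tpart0 map_f.
have b0 : b 0 = 1.
  rewrite /b -big_filter (bigD1_seq 0) ?filter_uniq //=; last first.
    by rewrite mem_filter tpart0 eqxx.
  rewrite pE ?ffunE // eqxx rmorph1 mul1r big1 => [|i _]; last by rewrite ffunE.
  rewrite big_filter_cond big1 ?addr0 // => nu /andP[/eqP nuT nu0].
  rewrite pE ?(negbTE nu0) ?rmorph0 ?mul0r //.
  by have := congr1 (fun m : mon n.+1 => m ord0) nuT; rewrite !ffunE.
have sum_b : \sum_(mu <- T) b mu * mon_eval t mu = - (th u * phi E).
  have : phi p = 0 by apply/quot_pi0.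
  rewrite -(subrK (\sum_(nu <- s) tmono (p nu) nu) p) pE' rmorphD rmorphM.
  move=> /eqP; rewrite addr_eq0 => /eqP->; rewrite opprK rmorph_sum.
  rewrite (sum_partition _ uT (p := tpart)); last first.
    by move=> nu nus; rewrite mem_undup map_f.
  apply: eq_bigr => mu _; rewrite /b mulr_suml; apply: eq_bigr => nu /eqP <-.
  rewrite tmonoE rmorphM rmorph_prod big_split_ord /= mulrA.
  congr (_ * _ * _); first by apply: eq_bigr => i _; rewrite rmorphXn.
  by apply: eq_bigr => j _; rewrite rmorphXn ffunE.
have frac_x i : is_frac th (x i).
  exists (f i), g; split; last first.
    apply/eqP; rewrite -subr_eq0 /x /th /= -rmorphM -rmorphB; apply/eqP/quot_pi0.
    by rewrite mulrC; exact: rel.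
  have rel' j : x j * th g = th (f j).
    apply/eqP; rewrite -subr_eq0 /x /th /= -rmorphM -rmorphB; apply/eqP/quot_pi0.
    by rewrite mulrC; exact: rel.
  (* If g vanished in the residue field, so would every f_i = x_i g, although f and g generate the
     unit ideal. *)
  move=> g0; have [c [d cd]] := unit; apply: K1.
  rewrite -(rmorph1 th) -cd rmorphD rmorphM g0 mulr0 addr0 rmorph_sum big1 // => j _.
  by rewrite rmorphM -rel' g0 !mulr0.
have frac_b mu : is_frac th (b mu).
  apply: (is_frac_sum Kfield K1) => nu _; apply: (is_fracM Kfield K1).
    exact: is_frac_th.
  apply: (is_frac_prod Kfield K1) => i _; exact: (is_fracX Kfield K1).
have [D [D0 hD]] : exists D, (0 < D)%N /\ forall mu j, mu \in T -> (mu j < D)%N.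
  exists (\max_(mu <- T) \max_j mu j).+1; split=> // mu j muT.
  rewrite ltnS; apply: leq_trans (leq_bigmax_seq _ muT isT).
  exact: (leq_bigmax (F := fun j => mu j)).
pose w (mu : mon n.+1) : nat := (\sum_(j < n.+1) D ^ j * mu j)%N.
have [nu0 nu0T [be bbe dom]] :=
  dominant_term w Kfield VP val rank1 T0 b0 K1.
have frac_be : is_frac th be by exact: (is_fracV Kfield K1 (frac_b nu0)).
(* The z witness the topological nilpotency of the heavier ratios. They are adjoined too, so that
   the relation (b mu / b nu0)^d = u z can be expressed in the new Tate algebra. *)
have /choice[z zP] mu : exists z : quot M, mu \in T -> (w nu0 < w mu)%N ->
    V z /\ exists d, (b mu * be) ^+ d = th u * z.
  have [muT|] := pselect (mu \in T); last by exists 0.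
  have [_ hmu] := dom _ muT.
  have [/hmu[d [z [Vz e]]]|] := pselect (w nu0 < w mu)%N; last by exists 0.
  by exists z => _ _; split=> //; exists d.
pose ys := [seq x i | i <- enum 'I_k] ++ [seq b mu * be | mu <- T] ++
  [seq z mu | mu <- T & (w nu0 < w mu)%N].
have x_ys i : x i \in ys by rewrite mem_cat (map_f x) ?mem_enum.
have b_ys mu : mu \in T -> b mu * be \in ys.
  by move=> muT; rewrite !mem_cat (map_f (fun mu => b mu * be) muT) orbT.
have z_ys mu : mu \in T -> (w nu0 < w mu)%N -> z mu \in ys.
  by move=> muT wmu; rewrite !mem_cat (map_f z) ?orbT // mem_filter wmu.
have ysP a : a \in ys -> V a /\ is_frac th a.
  rewrite !mem_cat => /or3P[] /mapP[i hi ->].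
  - by split=> //; apply: phiV; exact: pbd_tateX.
  - by split; [case: (dom _ hi)|exact: (is_fracM Kfield K1)].
  - move: hi; rewrite mem_filter => /andP[wi iT].
    have [Vz [d e]] := zP _ iT wi; split=> //.
    have -> : z i = th v * (b i * be) ^+ d by rewrite e; ring: uvK.
    apply: (is_fracM Kfield K1); first exact: is_frac_th.
    by apply: (is_fracX Kfield K1); exact: (is_fracM Kfield K1).
have [k1 [y [q [G [idx [Vy yG unit1 yidx]]]]]] :=
  rational_family Kfield K1 uv Vbnd ysP.
have [i|N [j [maxN JN [jG jO] jC jN]]] :=
    residue_extension U maxM VP phiV Vv Vy (l := fun i => idx (x i)).
  by rewrite yidx.
pose yt := join_family y t.
rewrite -/phi -/th -/yt in JN jG.
pose P1 := tate A (k1 + n.+1).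
have OP1 := pbd_subring P1.
(* The residue field at M embeds over A in the one at N, so finiteness descends to it. *)
suff : fin_mod (tateC (k1 + n.+1)) N.
  move=> fin; apply: (fin_mod_le (I := preim_ideal j N)) => //.
  by apply: (fin_mod_sub (f := tateC (k1 + n.+1))) => // a; rewrite jC.
have Oth a : pbd a -> V (th a) by move=> ha; apply: phiV; exact: pbd_tateC.
pose Gr : P1 -> quot M -> Prop := eval_graph u th yt V.
have GD f1 g1 z1 w1 : Gr f1 z1 -> Gr g1 w1 -> Gr (f1 + g1) (z1 + w1).
  exact: (eval_graphD U VP).
have GB f1 g1 z1 w1 : Gr f1 z1 -> Gr g1 w1 -> Gr (f1 - g1) (z1 - w1).
  exact: (eval_graphB U VP).
have GM f1 g1 z1 w1 : Gr f1 z1 -> Gr g1 w1 -> Gr (f1 * g1) (z1 * w1).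
  exact: (eval_graphM U VP Oth Vbnd).
have GX i : Gr (tateX A (lshift n.+1 i)) (y i).
  by rewrite -(join_familyL y t i); exact: (eval_graphX u th yt VP).
have GT i : Gr (tateX A (rshift k1 i)) (t i).
  by rewrite -(join_familyR y t i); exact: (eval_graphX u th yt VP).
have GC a : Gr (tateC (k1 + n.+1) a) (th a).
  exact: (eval_graphC u th yt VP).
(* These are the weights D^j of the variables other than tau, whose weight is D^0 = 1. *)
pose e (i : 'I_n) := (D ^ i.+1)%N.
have [h [hC hX hT hO]] := shear_map A k1 e.
have HP := shear_image_subring h.
pose Y mu : P1 := tateX A (lshift n.+1 (idx (b mu * be))).
pose TT (mu : mon n.+1) : P1 := \prod_i tateX A (rshift k1 i) ^+ mu i.
have GY mu : mu \in T -> Gr (Y mu) (b mu * be).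
  by move=> muT; rewrite -{1}(yidx (b mu * be)) ?b_ys //; exact: GX.
have GTT mu : Gr (TT mu) (mon_eval t mu).
  apply: (eval_graph_prod U VP Oth Vbnd) => i.
  by apply: (eval_graph_exp U VP Oth Vbnd); exact: GT.
have YO mu : pbd (Y mu) by exact: pbd_tateX.
have TTO mu : pbd (TT mu).
  by apply: (subring_prod OP1) => i _; apply: (subringX OP1); exact: pbd_tateX.
(* Dividing [p] by its dominant coefficient gives [F0 + H + EE] in [N]: here  *)
(* [F0] is monic in [tau] after shearing, [H] collects the heavier terms,     *)
(* nilpotent modulo [N + u P1°], and [EE] is divisible by [u]. So a power of  *)
(* [F0] lies in [N + u P1°].                                                  *)
pose F0 := TT nu0 + \sum_(mu <- T | (w mu < w nu0)%N) Y mu * TT mu.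
pose H := \sum_(mu <- T | (w nu0 < w mu)%N) Y mu * TT mu.
pose EE := Y 0 * j (tateC (k + n.+1) u * E).
have w_inj mu : mu \in T -> w mu = w nu0 -> mu = nu0.
  move=> muT /digits_inj ww; apply/ffunP; apply: ww => i; exact: hD.
have split_sum (c : mon n.+1 -> quot M) : \sum_(mu <- T) c mu = c nu0 +
    \sum_(mu <- T | (w mu < w nu0)%N) c mu + \sum_(mu <- T | (w nu0 < w mu)%N) c mu.
  rewrite (bigD1_seq nu0) //= (bigID (fun mu => (w mu < w nu0)%N)) /= addrA.
  congr (_ + _ + _).
    by apply: eq_bigl => mu; rewrite andb_idl // => lt;
      apply: contraTneq lt => ->; rewrite ltnn.
  rewrite big_seq_cond [RHS]big_seq_cond; apply: eq_bigl => mu.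
  case: (boolP (mu \in T)) => //= muT; rewrite -leqNgt.
  rewrite ltn_neqAle; congr (~~ _ && _); apply/eqP/eqP => [->//|].
  by move=> /esym; exact: w_inj.
have graph_sum (Q : pred (mon n.+1)) :
    Gr (\sum_(mu <- T | Q mu) Y mu * TT mu)
      (\sum_(mu <- T | Q mu) b mu * be * mon_eval t mu).
  rewrite big_seq_cond [X in Gr _ X]big_seq_cond.
  by apply: (eval_graph_sum U VP) => mu /andP[muT _]; apply: (GM) => //; exact: GY.
(* The value of F0 + H + EE is p divided by its dominant coefficient, hence 0; TT nu0 has
   coefficient b nu0 * be = 1, and Y 0 stands for be because b 0 = 1. *)
have NF : N (F0 + H + EE).
  have G1 := GD _ _ _ _ (GTT nu0) (graph_sum (fun mu => w mu < w nu0)%N).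
  have G2 := GD _ _ _ _ G1 (graph_sum (fun mu => w nu0 < w mu)%N).
  have G3 := GD _ _ _ _ G2 (GM _ _ _ _ (GY _ T0) (jG (tateC (k + n.+1) u * E))).
  apply: JN; move: G3; set val3 := (X in Gr _ X -> _).
  suff -> : val3 = 0 by [].
  rewrite /val3.
  rewrite b0 mul1r rmorphM -[mon_eval t nu0]mul1r -bbe.
  rewrite -(split_sum (fun mu => b mu * be * mon_eval t mu)).
  have -> : \sum_(mu <- T) b mu * be * mon_eval t mu =
      be * \sum_(mu <- T) b mu * mon_eval t mu.
    by rewrite mulr_sumr; apply: eq_bigr => mu _; ring.
  by rewrite sum_b mulrN addNr.
have F0O : pbd F0.
  apply: (subringD OP1) => //; apply: (subring_sum OP1) => mu _.
  exact: (subringM OP1).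
have jEO : pbd (j E) by exact: jO.
have EEE : EE = tateC (k1 + n.+1) u * (Y 0 * j E) by rewrite /EE rmorphM jC mulrCA.
have u1 : pbd (tateC (k1 + n.+1) u) by apply: pbd_tateC; case: U.
pose nil := nil_mod (@pbd R P1) (tateC (k1 + n.+1) u) N.
have nilH : nil H.
  rewrite /H big_seq_cond; apply: (nil_mod_sum OP1) => mu /andP[muT wmu].
  rewrite mulrC; apply: (nil_modM OP1) => //; split=> //.
  have [Vz [d zE]] := zP _ muT wmu.
  exists d, (tateX A (lshift n.+1 (idx (z mu)))); first exact: pbd_tateX.
  apply: JN; rewrite -(subrr ((b mu * be) ^+ d)) {2}zE; apply: (GB).
    by apply: (eval_graph_exp U VP Oth Vbnd); exact: GY.
  by apply: (GM) => //; rewrite -{2}(yidx (z mu)) ?z_ys //; exact: GX.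
have EEO : pbd EE by rewrite EEE; do 2! apply: (subringM OP1) => //.
have HO : pbd H by case: nilH.
have nilF0 : nil F0.
  have -> : F0 = (F0 + H + EE) + (- H - EE) by ring.
  apply: (nil_modD OP1).
    apply: (nil_mod_in (u := tateC (k1 + n.+1) u)).
      by apply: (subringD OP1) => //; exact: (subringD OP1).
    by exists 0; [exact: (subring0 OP1)|rewrite mulr0 subr0].
  apply: (nil_modD OP1); apply: (nil_modN OP1) => //.
  apply: nil_mod_in => //; exists (Y 0 * j E); first exact: (subringM OP1).
  by rewrite EEE subrr; exact: ideal0.
have [_ [r F0r]] := nilF0.
have monT mu : monic_in (shear_image h) (tateX A (rshift k1 ord0)) (w mu) (TT mu).
  apply: (shear_monic_mon hT (w := fun j => (D ^ j)%N)).
  - by rewrite expn0.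
  - by move=> i; rewrite lift0.
  - by move=> i; rewrite expn_gt0 D0.
have monF0 : monic_in (shear_image h) (tateX A (rshift k1 ord0)) (w nu0) F0.
  rewrite /F0 addrC; apply: (monic_inD HP) => //.
  apply: big_ind => [|a c|mu wmu]; first exact: (adjoin_lt0 _ HP).
    exact: (adjoin_ltD HP).
  apply: (adjoin_ltM HP); first exact: (shear_imageX hX).
  exact: (adjoin_lt_monic HP wmu).
(* The Weierstrass element is F0^r: monic in tau of degree w nu0 * r, and in N + u P1°. *)
apply: (shear_finite hC hX hT hO U fr unit1 maxN _ (monic_inX HP r monF0) F0r).
move=> i; apply: JN; rewrite -(subrr (th (q i))) -{1}yG mulrC.
by apply: (GB) => //; apply: (GM).
Qed.
End ResidueStep.

(** * The weak property and finite algebras over Tate algebras *)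

Section Weak.
Variables (R : realType) (A : banachTateType R).

Lemma rat_ideal_maximal k (f : 'I_k -> A) (g : A) (M : ideal (tate A k)) :
  maximal_ideal M -> (forall i, M (tateC k g * tateX A i - tateC k (f i))) ->
  forall x, rat_ideal f g x -> M x.
Proof.
move=> maxM rel x Ix; have [u [v U]] := pseudo_unif_exists A.
have UP := pseudo_unif_tateC k U.
apply: (maximal_closed UP maxM) => K; have [eps eps0 he] := norm_small UP K.
have [y [c yE] xy] := Ix eps eps0; have [w hw wE] := he _ xy.
exists w => //; rewrite -wE subKr yE.
by apply: ideal_sum => i _; exact: idealM.
Qed.

(** M contains the ideal defining the localization B, so its image m in B is maximal with preimage
    M, and the weak property applies to m. *)
Lemma finite_residue0 : weak_nullstellensatz A -> finite_residue A 0.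
Proof.
move=> weak k f g unit M maxM rel.
(* Padding by an empty family: [k + 0] does not reduce to [k]. *)
pose f' := join_family f (fun _ : 'I_0 => 0).
have IM := rat_ideal_maximal (f := f') (g := g) maxM.
pose B := quot (rat_ideal f' g).
pose pi : {rmorphism tate A (k + 0) -> B} := quot_pi (rat_ideal f' g).
pose h : {rmorphism A -> B} := pi \o tateC (k + 0).
have rel' i : M (tateC (k + 0) g * tateX A i - tateC (k + 0) (f' i)).
  by case: (split_ordP i) => j ->; [rewrite /f' join_familyL|case: j].
have loc : is_rational_localization h.
  exists (k + 0)%N, f', g; split.
    have [c [d cd]] := unit; exists (join_family c (fun=> 0)), d.
    rewrite big_split_ord /= [X in _ + X + _]big_ord0 addr0 -cd; congr (_ + _).
    by apply: eq_bigr => i _; rewrite /f' !join_familyL.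
  by exists idfun => //; exists id.
pose S (b : B) := exists2 x, M x & b = pi x.
have S0 : S 0 by exists 0; rewrite ?rmorph0 //; exact: ideal0.
have SD x y : S x -> S y -> S (x + y).
  move=> [x' Mx ->] [y' My ->]; exists (x' + y'); rewrite ?rmorphD //.
  exact: idealD.
have SM a x : S x -> S (a * x).
  move=> [x' Mx ->]; have [a' ->] := quot_surj a.
  by exists (a' * x'); rewrite ?rmorphM //; exact: idealM.
pose m := Ideal S0 SD SM.
have mM x : m (pi x) -> M x.
  move=> [x' Mx' /quot_piP] /(IM rel') h'.
  by rewrite -(subrK x' x); exact: idealD.
have maxm : maximal_ideal m.
  apply: inv_maximal.
    by rewrite -(rmorph1 pi) => /mM; case: maxM.
  move=> b nmb; have [x bE] := quot_surj b.
  have [|y My] := maximal_inv maxM (x := x).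
    by move=> Mx; apply: nmb; rewrite bE; exists x.
  exists (pi y); exists (1 - x * y) => //.
  by rewrite bE -[quot_pi _ x]/(pi x) -rmorphM -(rmorph1 pi) -rmorphB.
apply: (fin_mod_le (I := preim_ideal pi m)); first exact: mM.
apply/(fin_mod_surj (g := pi) (h := h)) => //; first exact: quot_surj.
by apply/fin_mod_quot_map; exact: weak.
Qed.

Hypothesis weak : weak_nullstellensatz A.

Lemma weak_finite_residue n : finite_residue A n.
Proof.
elim: n => [|n IH]; first exact: finite_residue0.
by have [u [v U]] := pseudo_unif_exists A; exact: (finite_residueS U).
Qed.

Lemma tate_maximal_fin n (M : ideal (tate A n)) :
  maximal_ideal M -> fin_mod (tateC n) M.
Proof.
(* The trivial localization, with no numerators and denominator 1. *)
move=> maxM; apply: (weak_finite_residue (n := n) (l := 0) (f := fun=> 0) (g := 1)) => //.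
  by exists (fun=> 0), 1; rewrite big_ord0 add0r mulr1.
by case.
Qed.

(** A rational localization of A<T> is a quotient of a Tate algebra over A in more variables, so its
    residue fields are finite already over A. *)
Lemma weak_tate n : weak_nullstellensatz (tate A n).
Proof.
move=> B h [k [f [g [_ [psi bij hE]]]]] m maxm; apply/fin_mod_quot_map.
have [chi [chiC chi_surj]] := tate_tate_surj A n k.
pose Psi : {rmorphism tate A (n + k) -> B} :=
  psi \o (quot_pi (rat_ideal f g) \o chi).
have Psi_surj b : exists x, b = Psi x.
  have [psi' _ psiK] := bij; have [y yE] := quot_surj (psi' b).
  by have [x xE] := chi_surj y; exists x; rewrite /= -xE -yE psiK.
apply: (fin_mod_right (f := tateC n) (h := h \o tateC n)) => //.
apply/(fin_mod_surj (f := tateC (n + k)) (g := Psi)) => //.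
  by move=> a; rewrite /= hE chiC.
by apply: tate_maximal_fin; exact: preim_maximal_surj.
Qed.

Lemma tate_finite_fin n (B : comPzRingType) (phi : {rmorphism tate A n -> B}) :
  finite_hom phi -> forall m : ideal B, maximal_ideal m ->
  finite_hom (quot_map (phi \o tateC n) m).
Proof.
move=> fin m maxm; apply/fin_mod_quot_map.
have fphi := finite_fin_mod m fin.
apply: (fin_mod_comp (f := tateC n) (g := phi)) => //.
by apply: tate_maximal_fin; exact: preim_maximal_fin.
Qed.
End Weak.

(** * Norms on finite extensions *)

(* Finite-dimensional spaces over a complete valued field carry a single      *)
(* separated topology; [V] is here the unit ball of the given norm.           *)
Section Lattice.
Variables (R : realType) (A : banachTateType R) (u v : A).
Hypothesis U : pseudo_unif u v.
Variables (L : comPzRingType) (th : {rmorphism A -> L}) (V : L -> Prop).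
Hypotheses (VP : subring_pred V) (thV : forall a, pbd a -> V (th a)).
Hypothesis Vbnd : forall z, exists k, V (th u ^+ k * z).
Hypothesis Vsep : forall z, (forall k, small V (th u) k z) -> z = 0.
Variable j : nat.
Hypothesis bounded_or_inv : forall N c,
  (exists2 b, pbd b & th u ^+ (N + j) * th c = th b) \/
  (exists2 b, pbd b & th c * (th u ^+ N * th v ^+ j * th b) = 1).
Variable s : nat -> L.

Local Notation span r x := (exists c : nat -> A, x = \sum_(i < r) th (c i) * s i).

Let uv : th u * th v = 1.
Proof. by case: U => uv _ _; rewrite -rmorphM uv rmorph1. Qed.
Let Vu : V (th u). Proof. by apply: thV; case: U. Qed.
Let uvX k : th u ^+ k * th v ^+ k = 1. Proof. by rewrite -exprMn uv expr1n. Qed.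

Lemma family_bounded r : exists k, forall i, (i < r)%N -> V (th u ^+ k * s i).
Proof.
elim: r => [|r [k hk]]; first by exists 0%N.
have [l hl] := Vbnd (s r); exists (k + l)%N => i; rewrite ltnS leq_eqVlt.
move=> /orP[/eqP->|ir]; first exact: (bounded_leq VP Vu (leq_addl k l)).
by apply: (bounded_leq VP Vu (leq_addr l k)); exact: hk.
Qed.

Lemma spanZ r a x : span r x -> span r (th a * x).
Proof.
move=> [c ->]; exists (fun i => a * c i); rewrite mulr_sumr.
by apply: eq_bigr => i _; rewrite rmorphM mulrA.
Qed.
Lemma spanB r x y : span r x -> span r y -> span r (x - y).
Proof.
move=> [c ->] [d ->]; exists (fun i => c i - d i); rewrite -sumrB.
by apply: eq_bigr => i _; rewrite rmorphB mulrBl.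
Qed.

(** Elements of V have coordinates bounded up to a fixed power of u. If s_r is not in the span of
    its predecessors, unbounded last coordinates would yield elements of that span converging to
    -s_r. By induction their coordinates converge in the complete ring A, which puts s_r in the
    span. *)
Lemma lattice_bounded r : exists N, forall x, V x -> span r x ->
  exists a : nat -> A, (forall i, pbd (a i)) /\
    th u ^+ N * x = \sum_(i < r) th (a i) * s i.
Proof.
have OA := pbd_subring A.
elim: r => [|r [N IH]].
  exists 0%N => x _ [c ->]; exists (fun=> 0); rewrite !big_ord0 mulr0.
  by split=> // _; exact: (subring0 OA).
have [[c' sE]|nspan] := pselect (span r (s r)).
  exists N => x Vx [c xE]; have [|a [aO aE]] := IH x Vx.
    exists (fun i => c i + c r * c' i); rewrite xE big_ord_recr /= sE mulr_sumr.
    rewrite -big_split; apply: eq_bigr => i _.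
    by rewrite rmorphD rmorphM /=; ring.
  exists (fun i => if (i < r)%N then a i else 0); split.
    by move=> i; case: ifP => // _; exact: (subring0 OA).
  rewrite aE big_ord_recr /= ltnn rmorph0 mul0r addr0.
  by apply: eq_bigr => i _; rewrite ltn_ord.
have [B Bb] : exists B, forall x (c : nat -> A), V x ->
    x = \sum_(i < r.+1) th (c i) * s i ->
    exists2 b, pbd b & th u ^+ B * th (c r) = th b.
  apply: contrapT => nB.
  (* With no bound, some x in V has a last coordinate with inverse u^K v^j b. Scaling x by it turns
     the coefficient of s_r into 1 and leaves u^j times the result in u^K V. *)
  have near K : exists c : nat -> A,
      small V (th u) K (th u ^+ j * (s r + \sum_(i < r) th (c i) * s i)).
    apply: contrapT => h; apply: nB; exists (K + j)%N => x c Vx xE.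
    have [//|[b bO cb]] := bounded_or_inv K (c r).
    case: h; exists (fun i => u ^+ K * v ^+ j * b * c i).
    exists (th b * x); first by apply: (subringM VP) => //; exact: thV.
    rewrite xE big_ord_recr /=.
    have -> : \sum_(i < r) th (u ^+ K * v ^+ j * b * c i) * s i =
        th u ^+ K * th v ^+ j * th b * \sum_(i < r) th (c i) * s i.
      rewrite mulr_sumr; apply: eq_bigr => i _.
      by rewrite !rmorphM !rmorphXn /=; ring.
    set S := \sum_(i < r) _; rewrite -{1}[s r]mul1r -cb.
    rewrite (_ : _ * _ = (th u ^+ j * th v ^+ j) *
        (th u ^+ K * (th b * (S + th (c r) * s r)))).
      by rewrite uvX mul1r.
    by ring.
  have /choice[c hc] := near.
  pose h K := \sum_(i < r) th (c K i) * s i.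
  have /choice[a ha] K : exists a : nat -> A, (forall i, pbd (a i)) /\
      th u ^+ N * (th v ^+ K * (th u ^+ j * (h K.+1 - h K))) =
      \sum_(i < r) th (a i) * s i.
    apply: IH.
      have -> : th u ^+ j * (h K.+1 - h K) =
        th u ^+ j * (s r + h K.+1) - th u ^+ j * (s r + h K) by ring.
      apply/(smallE _ uv); apply: (smallB VP uv); last exact: hc.
      by apply: (small_leq VP Vu (leqnSn K)); exact: hc.
    rewrite -!rmorphXn; do 2! apply: spanZ.
    by apply: spanB; [exists (c K.+1)|exists (c K)].
  have /choice[l hl] i := small_series U (fun K => (ha K).1 i).
  have [k hk] := family_bounded r.
  pose S := \sum_(i < r) th (l i) * s i.
  have hE K : h K = h 0 + th v ^+ (N + j) *
      \sum_(i < r) th (\sum_(i' < K) u ^+ i' * a i' i) * s i.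
    elim: K => [|K IHK].
      rewrite (eq_bigr (fun=> 0)) ?big1_eq ?mulr0 ?addr0 //.
      by move=> i _; rewrite big_ord0 rmorph0 mul0r.
    rewrite (_ : \sum_(i < r) _ =
      \sum_(i < r) th (\sum_(i' < K) u ^+ i' * a i' i) * s i +
      th u ^+ K * \sum_(i < r) th (a K i) * s i).
      rewrite mulrDr addrA -IHK -(ha K).2 exprD.
      rewrite (_ : _ * (th u ^+ K * _) = (th u ^+ N * th v ^+ N) *
        (th u ^+ j * th v ^+ j) * (th u ^+ K * th v ^+ K) * (h K.+1 - h K)).
        by rewrite !uvX; ring.
      by ring.
    rewrite mulr_sumr -big_split; apply: eq_bigr => i _.
    by rewrite big_ord_recr /= rmorphD rmorphM rmorphXn /=; ring.
  (* Passage to the limit: the approximations h K converge to h 0 + v^(N+j) S, and V is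
     separated. *)
  have sr0 : th u ^+ (N + j + k) * (s r + (h 0 + th v ^+ (N + j) * S)) = 0.
    apply: Vsep => K.
    have -> : th u ^+ (N + j + k) * (s r + (h 0 + th v ^+ (N + j) * S)) =
        th u ^+ (N + k) * (th u ^+ j * (s r + h K)) +
        (th u ^+ (N + j) * th v ^+ (N + j)) * (th u ^+ k * \sum_(i < r)
          th (l i - \sum_(i' < K) u ^+ i' * a i' i) * s i).
      rewrite (eq_bigr (fun i : 'I_r => th (l i) * s i -
        th (\sum_(i' < K) u ^+ i' * a i' i) * s i)); last first.
        by move=> i _; rewrite rmorphB mulrBl.
      by rewrite sumrB -/S (hE K) !exprD; ring.
    rewrite uvX mul1r; apply: (smallD VP uv).
      by apply: (small_mulO VP uv); [exact: (subringX VP)|exact: hc].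
    rewrite mulr_sumr; apply: (small_sum VP uv) => i _.
    rewrite mulrCA mulrC; apply: (small_mulO VP uv); first exact: hk.
    have [w hw ->] := hl i K; rewrite rmorphM rmorphXn.
    by apply: small_exp; exact: thV.
  apply: nspan; exists (fun i => - c 0%N i - v ^+ (N + j) * l i).
  have : s r + (h 0 + th v ^+ (N + j) * S) = 0.
    by rewrite -[LHS]mul1r -(uvX (N + j + k)) mulrAC sr0 mul0r.
  move=> /eqP; rewrite addr_eq0 => /eqP->; rewrite opprD mulr_sumr -!sumrN.
  rewrite -big_split; apply: eq_bigr => i _.
  by rewrite rmorphB rmorphN rmorphM rmorphXn /=; ring.
have [m hm] := Vbnd (s r); exists (N + m + B)%N => x Vx [c xE].
have [b bO bE] := Bb x c Vx xE.
have [||a [aO aE]] := IH (th u ^+ m * (th u ^+ B * x - th b * s r)).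
- rewrite (_ : _ * _ = th u ^+ m * th u ^+ B * x - th b * (th u ^+ m * s r)); last by ring.
  apply: (subringB VP); last by apply: (subringM VP) => //; exact: thV.
  by apply: (subringM VP) => //; apply: (subringM VP); exact: (subringX VP).
- rewrite -rmorphXn; apply: spanZ; exists (fun i => u ^+ B * c i).
  rewrite {1}xE big_ord_recr /= mulrDr mulrA bE addrK mulr_sumr.
  by apply: eq_bigr => i _; rewrite rmorphM rmorphXn mulrA.
exists (fun i => if (i < r)%N then a i else u ^+ (N + m) * b); split.
  move=> i; case: ifP => // _; apply: (subringM OA) => //.
  by apply: (subringX OA); case: U.
rewrite big_ord_recr /= ltnn.
rewrite (eq_bigr (fun i : 'I_r => th (a i) * s i)); last by move=> i _; rewrite ltn_ord.
by rewrite -aE rmorphM rmorphXn !exprD; ring.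
Qed.
End Lattice.

(** * The multiplicative norm of a rank-one valuation ring *)

Section ValuationNorm.
Variables (R : realType) (L : comPzRingType) (V : L -> Prop) (u v : L).
Hypothesis Lfield : forall x : L, x <> 0 -> exists y, x * y = 1.
Hypotheses (VP : subring_pred V) (uv : u * v = 1) (Vu : V u) (Vv : ~ V v).
Hypothesis Vval : forall x y, x * y = 1 -> V x \/ V y.
Hypothesis Vbnd : forall z, exists k, V (u ^+ k * z).
Local Notation small := (small V u).

Let uvX k : u ^+ k * v ^+ k = 1. Proof. by rewrite -exprMn uv expr1n. Qed.

Lemma small1 k : small k 1 -> k = 0%N.
Proof.
case: k => [//|k] [w Vw e]; case: Vv; rewrite -[v]mulr1 e exprS.
rewrite (_ : _ * _ = (u * v) * (u ^+ k * w)); last by ring.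
by rewrite uv mul1r; apply: (subringM VP) => //; exact: (subringX VP).
Qed.

Lemma small_pow k x n : small k x -> small (k * n) (x ^+ n).
Proof.
move=> [w Vw ->]; rewrite exprMn -exprM; apply: small_exp.
exact: (subringX VP).
Qed.

Lemma valuation_sep z : (forall k, small k z) -> z = 0.
Proof.
move=> h; apply: contrapT => /Lfield[y zy]; have [k hk] := Vbnd y.
suff /small1 : small 1 1 by [].
rewrite -zy mulrC; apply: (small_mul_bounded VP uv hk); exact: h.
Qed.

(* The rational slopes [(a - c) / b] with [x ^ b] in [u ^ (a - c) V]; their   *)
(* supremum is the additive valuation normalized at [u].                      *)
Definition slopes (x : L) : set R :=
  [set r | exists a b c : nat, [/\ (0 < b)%N, small a (u ^+ c * x ^+ b) &
     r = (a%:R - c%:R) / b%:R]]%classic.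
Definition slope (x : L) : R := sup (slopes x).

Lemma slopes_neq0 x : (slopes x !=set0)%classic.
Proof.
have [k hk] := Vbnd x; exists ((0%:R - k%:R) / 1%:R), 0%N, 1%N, k; split=> //.
by rewrite expr1; apply/(small_O V uv).
Qed.

Lemma slopes_ub x : x <> 0 -> has_ubound (slopes x).
Proof.
move=> /Lfield[y xy]; have [k hk] := Vbnd y.
exists k%:R => r [a [b [c [b0 h ->]]]].
rewrite ler_pdivrMr ?ltr0n // lerBlDr -natrM -natrD ler_nat leqNgt; apply/negP => lt.
have : small a (u ^+ c * (u ^+ (k * b))).
  have -> : u ^+ c * u ^+ (k * b) = (u ^+ k * y) ^+ b * (u ^+ c * x ^+ b).
    rewrite exprMn -exprM -{1}[u ^+ (k * b)]mulr1 -(expr1n _ b) -xy exprMn.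
    by ring.
  by apply: (small_mulO VP uv) => //; exact: (subringX VP).
rewrite -exprD => h'; have : small (a - (k * b + c)) 1.
  apply/(smallE _ uv); move/(smallE _ uv): h'; rewrite mulr1.
  rewrite (_ : v ^+ a * _ = v ^+ (a - (k * b + c))) //.
  rewrite -{1}(subnK (ltnW lt)) exprD -mulrA addnC [v ^+ _ * u ^+ _]mulrC uvX mulr1 //.
by move=> /small1; lia.
Qed.

Lemma slope_ge x r : x <> 0 -> slopes x r -> r <= slope x.
Proof. by move=> /slopes_ub h; exact: ub_le_sup. Qed.

Lemma small_slope k x : x <> 0 -> small k x -> k%:R <= slope x.
Proof.
move=> x0 h; apply: slope_ge => //; exists k, 1%N, 0%N; split=> //.
  by rewrite expr0 mul1r expr1.
by rewrite subr0 divr1.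
Qed.

Lemma slope_superadd x y : x * y <> 0 -> slope x + slope y <= slope (x * y).
Proof.
move=> xy0.
have key r r' : slopes x r -> slopes y r' -> r + r' <= slope (x * y).
  move=> [a [b [c [b0 h ->]]]] [a' [b' [c' [b'0 h' ->]]]]; apply: slope_ge => //.
  exists (a * b' + a' * b)%N, (b * b')%N, (c * b' + c' * b)%N; split.
  - by rewrite muln_gt0 b0.
  - have -> : u ^+ (c * b' + c' * b) * (x * y) ^+ (b * b') =
        (u ^+ c * x ^+ b) ^+ b' * (u ^+ c' * y ^+ b') ^+ b.
      by rewrite exprD !exprMn -!exprM (mulnC b' b); ring.
    by apply: (smallM VP uv); exact: small_pow.
  - rewrite !natrD !natrM.
    have b1 : b%:R != 0 :> R by rewrite pnatr_eq0 -lt0n.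
    have b2 : b'%:R != 0 :> R by rewrite pnatr_eq0 -lt0n.
    by field; rewrite b1 b2.
rewrite -lerBrDr; apply: ge_sup; first exact: slopes_neq0.
move=> r hr; rewrite lerBrDr addrC -lerBrDr; apply: ge_sup; first exact: slopes_neq0.
by move=> r' hr'; rewrite lerBrDr addrC; exact: key.
Qed.

Lemma slope1_le0 : slope 1 <= 0.
Proof.
apply: ge_sup; first exact: slopes_neq0.
move=> r [a [b [c [b0 h ->]]]]; rewrite expr1n mulr1 in h.
rewrite ler_pdivrMr ?ltr0n // mul0r subr_le0 ler_nat leqNgt; apply/negP => lt.
have : small (a - c) 1.
  apply/(smallE _ uv); move/(smallE _ uv): h; rewrite mulr1.
  by rewrite -{1}(subnK (ltnW lt)) exprD -mulrA [v ^+ _ * u ^+ _]mulrC uvX mulr1.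
by move=> /small1; lia.
Qed.

Lemma rational_between (x y : R) : x < y ->
  exists a b c : nat,
    [/\ (0 < b)%N, x < (a%:R - c%:R) / b%:R & (a%:R - c%:R) / b%:R < y].
Proof.
move=> /rat_in_itvoo[q]; rewrite in_itv /= => /andP[xq qy].
have [a [c ac]] : exists a c : nat, (numq q)%:~R = a%:R - c%:R :> R.
  case: (numq q) => m; first by exists m, 0%N; rewrite subr0.
  by exists 0%N, m.+1; rewrite NegzE mulrNz sub0r.
have qE : ratr q = (a%:R - c%:R) / `|denq q|%N%:R :> R.
  by rewrite /ratr ac -[in LHS](gtz0_abs (denq_gt0 q)).
exists a, `|denq q|%N, c; rewrite -qE; split=> //.
by rewrite absz_gt0 gt_eqF ?denq_gt0.
Qed.

Lemma slopeV x y : x * y = 1 -> slope y = - slope x.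
Proof.
move=> xy; have V1 : ~ (1 : L) = 0.
  move=> e; apply: Vv; rewrite -[v]mulr1 e mulr0; exact: (subring0 VP).
have x0 : x <> 0 by move=> e; apply: V1; rewrite -xy e mul0r.
have y0 : y <> 0 by move=> e; apply: V1; rewrite -xy e mulr0.
apply/eqP; rewrite eq_le -subr_ge0 -opprD oppr_ge0; apply/andP; split.
  apply: le_trans slope1_le0; rewrite -xy.
  by apply: slope_superadd; rewrite xy.
(* A rational (a - c) / b strictly between slope x and - slope y would give two mutually inverse
   elements, v^a u^c x^b and v^c u^a y^b, both outside V. *)
rewrite lerNl leNgt; apply/negP => /rational_between[a [b [c [b0 xr ry]]]].
have nx : ~ small a (u ^+ c * x ^+ b).
  move=> h; have : slopes x ((a%:R - c%:R) / b%:R) by exists a, b, c.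
  by move=> /(slope_ge x0); rewrite leNgt xr.
have ny : ~ small c (u ^+ a * y ^+ b).
  move=> h; have : slopes y ((c%:R - a%:R) / b%:R) by exists c, b, a.
  by move=> /(slope_ge y0); rewrite leNgt -opprB mulNr ltrNr ry.
have [|h|h] := @Vval (v ^+ a * (u ^+ c * x ^+ b)) (v ^+ c * (u ^+ a * y ^+ b)).
- rewrite (_ : _ * _ = (u ^+ a * v ^+ a) * (u ^+ c * v ^+ c) * (x * y) ^+ b).
    by rewrite !uvX xy expr1n !mulr1.
  by rewrite exprMn; ring.
- by apply: nx; apply/(smallE _ uv).
- by apply: ny; apply/(smallE _ uv).
Qed.

Lemma slopeM x y : x <> 0 -> y <> 0 -> slope (x * y) = slope x + slope y.
Proof.
move=> x0 y0; have [x' xx'] := Lfield x0; have [y' yy'] := Lfield y0.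
have V1 : ~ (1 : L) = 0.
  move=> e; apply: Vv; rewrite -[v]mulr1 e mulr0; exact: (subring0 VP).
have xy0 : x * y <> 0.
  by move=> e; apply: V1; rewrite -[1]mulr1 -{1}xx' -yy' mulrACA e mul0r.
apply/eqP; rewrite eq_le slope_superadd // andbT.
rewrite -lerBlDl -(slopeV xx') addrC.
have yE : y = x' * (x * y) by ring: xx'.
by rewrite [in leRHS]yE; apply: slope_superadd; rewrite -yE.
Qed.


Definition val_norm (x : L) : R := if x == 0 then 0 else expR (- slope x).

Lemma val_norm0 : val_norm 0 = 0. Proof. by rewrite /val_norm eqxx. Qed.
Lemma val_normE x : x <> 0 -> val_norm x = expR (- slope x).
Proof. by move=> /eqP/negbTE x0; rewrite /val_norm x0. Qed.
Lemma val_norm_ge0 x : 0 <= val_norm x.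
Proof. by rewrite /val_norm; case: ifP => // _; exact: expR_ge0. Qed.
Lemma val_norm_eq0 x : val_norm x = 0 <-> x = 0.
Proof.
split=> [|->]; last exact: val_norm0.
by move=> h; apply: contrapT => x0; have := expR_gt0 (- slope x);
  rewrite -val_normE // h ltxx.
Qed.

Lemma val_normM x y : val_norm (x * y) = val_norm x * val_norm y.
Proof.
have [->|x0] := pselect (x = 0); first by rewrite mul0r val_norm0 mul0r.
have [->|y0] := pselect (y = 0); first by rewrite mulr0 val_norm0 mulr0.
have V1 : ~ (1 : L) = 0.
  move=> e; apply: Vv; rewrite -[v]mulr1 e mulr0; exact: (subring0 VP).
have xy0 : x * y <> 0.
  have [x' xx'] := Lfield x0; have [y' yy'] := Lfield y0.
  by move=> e; apply: V1; rewrite -[1]mulr1 -{1}xx' -yy' mulrACA e mul0r.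
by rewrite !val_normE // slopeM // opprD expRD.
Qed.

Lemma val_norm_small k x : small k x -> val_norm x <= expR (- k%:R).
Proof.
move=> h; have [->|x0] := pselect (x = 0); first by rewrite val_norm0 expR_ge0.
by rewrite val_normE // ler_expR lerN2; exact: small_slope.
Qed.

Lemma val_norm_V x : V x -> val_norm x <= 1.
Proof.
by move=> /(small_O V uv)/val_norm_small; rewrite oppr0 expR0.
Qed.

(** A slope above k puts some power of z = v^k x in V, and z follows because valuation rings are
    integrally closed. *)
Lemma small_val_norm k x : val_norm x < expR (- k%:R) -> small k x.
Proof.
have [->|x0] := pselect (x = 0); first by move=> _; exact: (small0 _ VP).
rewrite val_normE // ltr_expR ltrN2 => /(sup_gt (slopes_neq0 x)).
move=> [r [a [b [c [b0 h ->]]]]]; rewrite ltr_pdivlMr ?ltr0n // ltrBrDr.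
rewrite -natrM -natrD ltr_nat => lt; apply/(smallE _ uv).
pose z := v ^+ k * x.
have Vzb : V (z ^+ b).
  apply/(small_O V uv); apply: (small_leq VP Vu (leq0n (a - (k * b + c)))).
  apply/(smallE _ uv); move/(smallE _ uv): h.
  rewrite -{1}(subnK (ltnW lt)) exprD -mulrA [in X in X -> _]exprD.
  rewrite (_ : v ^+ (k * b) * v ^+ c * (u ^+ c * x ^+ b) = z ^+ b) //.
  rewrite /z exprMn -exprM (_ : _ * _ = (u ^+ c * v ^+ c) * (v ^+ (k * b) * x ^+ b)); last by ring.
  by rewrite uvX mul1r.
have [y xy] := Lfield x0.
have zz' : z * (u ^+ k * y) = 1.
  have -> : z * (u ^+ k * y) = (u ^+ k * v ^+ k) * (x * y) by rewrite /z; ring.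
  by rewrite uvX xy mulr1.
have [//|Vz'] := Vval zz'.
(* If z^-1 is in V, then z = z^b (z^-1)^(b-1) is a product of elements of V. *)
have -> : v ^+ k * x = z ^+ b * (u ^+ k * y) ^+ b.-1.
  case: b b0 {h lt Vzb} => // b _; rewrite /= exprS -mulrA -exprMn zz' expr1n mulr1 //.
by apply: (subringM VP) => //; exact: (subringX VP).
Qed.

Lemma val_normN x : val_norm (- x) = val_norm x.
Proof.
have le y : val_norm (- y) <= val_norm y.
  rewrite -mulN1r val_normM ler_piMl ?val_norm_ge0 //.
  by apply: val_norm_V; apply: (subringN VP); exact: (subring1 VP).
by apply/eqP; rewrite eq_le le /= -{1}[x]opprK le.
Qed.

Lemma val_normP : nonarch_norm val_norm.
Proof.
split; [exact: val_norm_ge0|exact: val_norm_eq0|].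
have key x y z : x = y * z -> V z -> val_norm (x - y) <= val_norm y.
  move=> -> Vz; rewrite -{2}[y]mulr1 -mulrBr val_normM ler_piMr ?val_norm_ge0 //.
  by apply: val_norm_V; apply: (subringB VP) => //; exact: (subring1 VP).
move=> x y; have [->|x0] := pselect (x = 0).
  by rewrite sub0r val_normN le_max lexx orbT.
have [->|y0] := pselect (y = 0); first by rewrite subr0 le_max lexx.
have [x' xx'] := Lfield x0; have [y' yy'] := Lfield y0.
have [|Vz|Vz] := @Vval (x * y') (y * x').
- have -> : x * y' * (y * x') = (x * x') * (y * y') by ring.
  by rewrite xx' yy' mulr1.
- by rewrite le_max; apply/orP; right; apply: (key _ _ (x * y')) => //; ring: yy'.
- rewrite -val_normN opprB le_max; apply/orP; left.
  by apply: (key _ _ (y * x')) => //; ring: xx'.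
Qed.
End ValuationNorm.

(** * The strong property *)

Section Strong.
Variables (R : realType) (A : banachTateType R).

Lemma pbd_image_open (n : ideal A) :
  quot_open (fun z : quot n => exists2 b, pbd b & z = quot_pi n b).
Proof.
have OA := pbd_subring A.
move=> p [b hb pb]; exists 1 => // q /ltW/pbd_norm1 qp.
exists (q - p + b); first exact: (subringD OA).
apply/quot_piP; have -> : q - (q - p + b) = p - b by ring.
by move/quot_piP: pb.
Qed.

(** By multiplicativity, either u^N c or its inverse has alpha at most 1. The unit ball of alpha,
    scaled by u^j, lies in the image of the bounded elements because that image is open for
    alpha. *)
Lemma bounded_or_inverse (u v : A) (n : ideal A) (alpha : quot n -> R) :
  pseudo_unif u v -> maximal_ideal n ->
  nonarch_norm alpha -> (forall x y, alpha (x * y) = alpha x * alpha y) ->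
  (forall W : set (quot n), quot_open W <-> norm_open alpha W) ->
  exists j, forall N c,
    (exists2 b, pbd b & n (u ^+ (N + j) * c - b)) \/
    (exists2 b, pbd b & n (c * (u ^+ N * v ^+ j * b) - 1)).
Proof.
move=> U maxn aP aM aO; have uv : u * v = 1 by case: U.
have uvX k : u ^+ k * v ^+ k = 1 by rewrite -exprMn uv expr1n.
pose pi : {rmorphism A -> quot n} := quot_pi n.
have n1 : (1 : quot n) <> 0 by apply: quot_one_neq0; case: maxn.
have a1 : alpha 1 = 1.
  have a10 : alpha 1 != 0 by apply/eqP => /(nnorm_eq0 aP).
  by apply: (mulfI a10); rewrite -aM !mulr1.
have [|eps eps0 heps] := (aO _).1 (@pbd_image_open n) 0.
  by exists 0; [exact: (subring0 (pbd_subring A))|rewrite rmorph0].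
have [j hj] : exists j, alpha (pi (u ^+ j)) < eps.
  pose W : set (quot n) := [set z | alpha z < eps]%classic.
  have Wo : norm_open alpha W.
    move=> z Wz; exists eps => // y yz; rewrite /W /= -(subrK z y).
    by rewrite (le_lt_trans (nnormD aP _ _)) // gt_max yz.
  have [|e e0 he] := (aO W).2 Wo 0.
    by rewrite /preimage /= rmorph0 /W /= (nnorm0 aP).
  case: U => _ _ /(_ e e0)[K hK]; exists K.
  by apply: (he (u ^+ K)); rewrite subr0; exact: hK.
have ball c : alpha (pi c) <= 1 -> exists2 b, pbd b & n (u ^+ j * c - b).
  move=> c1; have [|b hb /quot_piP e] := heps (pi (u ^+ j * c)); last by exists b.
  rewrite subr0 rmorphM aM (le_lt_trans _ hj) //.
  by rewrite ler_piMr // (nnorm_ge0 aP).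
exists j => N c; have [c1|c1] := leP (alpha (pi (u ^+ N * c))) 1.
  by left; have [b hb nb] := ball _ c1; exists b => //; rewrite addnC exprD -mulrA.
have nc : ~ n c.
  move=> nc; have : pi (u ^+ N * c) = 0 by apply/quot_pi0; exact: idealM.
  by move=> e; move: c1; rewrite e (nnorm0 aP) ltr10.
have [c' nc'] := maximal_inv maxn nc.
have cc' : pi c * pi c' = 1.
  by rewrite -rmorphM -(rmorph1 pi); apply/esym/quot_piP.
have [|b hb nb] := ball (v ^+ N * c').
  have : alpha (pi (u ^+ N * c)) * alpha (pi (v ^+ N * c')) = 1.
    rewrite -aM -rmorphM (_ : _ * _ = (u ^+ N * v ^+ N) * (c * c')); last by ring.
    by rewrite uvX mul1r rmorphM cc' a1.
  move=> e; rewrite leNgt; apply/negP => lt.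
  by have := ltr_pM ler01 ler01 c1 lt; rewrite e mulr1 ltxx.
right; exists b => //.
have -> : c * (u ^+ N * v ^+ j * b) - 1 =
    - (c * u ^+ N * v ^+ j) * (u ^+ j * (v ^+ N * c') - b) +
    ((u ^+ N * v ^+ N) * (u ^+ j * v ^+ j) * (c * c') - 1) by ring.
rewrite !uvX !mul1r; apply: idealD; first exact: idealM.
by rewrite -opprB; exact: idealN.
Qed.

(** The norm is [val_norm] of a valuation ring V of the residue field. The unit ball of A<T> maps
    into V, and [hN] below is the reverse comparison; together they identify the two topologies. *)
Lemma strong_tate n : strong_nullstellensatz A -> strong_nullstellensatz (tate A n).
Proof.
move=> [weak strong]; split; first exact: weak_tate.
move=> M maxM; have [u [v U]] := pseudo_unif_exists A.
have UP := pseudo_unif_tateC n U.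
have uv : u * v = 1 by case: U.
have OP := pbd_subring (tate A n).
have fin := tate_maximal_fin weak maxM.
have maxn := preim_maximal_fin fin maxM.
have [alpha [aP aM aO]] := strong _ maxn.
have [j hj] := bounded_or_inverse U maxn aP aM aO.
pose phi : {rmorphism tate A n -> quot M} := quot_pi M.
pose th : {rmorphism A -> quot M} := phi \o tateC n.
have Lfield := quot_field maxM.
have uvL : th u * th v = 1 by rewrite -rmorphM uv rmorph1.
have [V [VP phiV Vv val _]] := residue_valuation UP maxM.
have Vbnd z : exists k, V (th u ^+ k * z) := residue_bounded UP phiV z.
have thV a : pbd a -> V (th a) by move=> ha; apply: phiV; exact: pbd_tateC.
have Vu : V (th u) by apply: thV; case: U.
have thE a b : preim_ideal (tateC n) M (a - b) -> th a = th b.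
  by rewrite /= /preimage /= rmorphB => /quot_piP.
have hjL N c : (exists2 b, pbd b & th u ^+ (N + j) * th c = th b) \/
    (exists2 b, pbd b & th c * (th u ^+ N * th v ^+ j * th b) = 1).
  have [[b hb /thE e]|[b hb /thE e]] := hj N c; [left|right]; exists b => //.
    by rewrite -e rmorphM rmorphXn.
  by rewrite -[RHS](rmorph1 th) -e !rmorphM !rmorphXn.
have [N hN] : exists N, forall x, V x -> exists2 p, pbd p & th u ^+ N * x = phi p.
  have [r [s hs]] := fin.
  pose s0 k := if insub k is Some i then s i else 0.
  pose s1 k := phi (s0 k).
  (* The generators of the residue field need not lift to bounded elements; u^k makes the chosen
     lifts bounded. *)
  have [k hk] :=
    family_bounded U OP (fun a => @pbd_tateC R A n a) (pbd_bounded UP) s0 r.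
  have [N hN] := lattice_bounded U VP thV Vbnd
    (valuation_sep Lfield VP uvL Vu Vv Vbnd) hjL s1 r.
  exists (k + N)%N => x Vx; have [|a [aO1 aE]] := hN x Vx.
    have [p xE] := quot_surj x; have [c Mc] := hs p.
    exists (fun i => if insub i is Some i' then c i' else 0).
    rewrite xE (_ : \sum_(i < r) _ = phi (\sum_i tateC n (c i) * s i)).
      by apply/quot_piP.
    by rewrite rmorph_sum; apply: eq_bigr => i _; rewrite /s1 /s0 valK rmorphM.
  exists (\sum_(i < r) tateC n (a i) * (tateC n u ^+ k * s0 i)).
    apply: (subring_sum OP) => i _; apply: (subringM OP); last exact: hk.
    exact: pbd_tateC.
  rewrite exprD -mulrA aE mulr_sumr rmorph_sum; apply: eq_bigr => i _.
  by rewrite !rmorphM rmorphXn /s1 /=; ring.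
exists (val_norm R V (th u)); split.
- exact: (val_normP R Lfield VP uvL Vu Vv val Vbnd).
- exact: (val_normM R Lfield VP uvL Vu Vv val Vbnd).
move=> W; split=> Wo.
  move=> z Wz; have [p zE] := quot_surj z.
  have [|e e0 he] := Wo p; first by rewrite /preimage /= -zE.
  have [K hK] := small_norm UP e0.
  exists (expR (- (K + N)%:R)); first exact: expR_gt0.
  move=> y /(small_val_norm Lfield VP uvL Vu val Vbnd)[w Vw yE].
  have [p' hp' wE] := hN _ Vw.
  have -> : y = phi (p + tateC n u ^+ K * p').
    have zE' : phi p = z by rewrite zE.
    rewrite rmorphD rmorphM rmorphXn -wE zE'.
    by rewrite -[y](subrK z) yE exprD addrC mulrA.
  apply: he; rewrite addrAC subrr add0r; apply: hK; exact: small_exp.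
move=> p Wp; have [e e0 he] := Wo _ Wp.
(* From exp x >= 1 + x, with K the integer part of 1 / e. *)
have [K hK] : exists K : nat, expR (- K%:R) < e.
  exists (Num.truncn e^-1); rewrite expRN invf_plt ?posrE ?expR_gt0 //.
  apply: lt_le_trans (expR_ge1Dx _).
  by rewrite addrC natr1 truncnS_gt.
have [eps eps0 hs] := norm_small UP K.
exists eps => // q /hs qp; apply: he; rewrite -rmorphB.
apply: le_lt_trans hK.
apply: (val_norm_small R Lfield VP uvL Vu Vv Vbnd).
exact: (small_quot_pi phiV qp).
Qed.
End Strong.

Theorem theorem2p6 (R : realType) (A : banachTateType R) :
  (weak_nullstellensatz A ->
   forall n : nat,
     weak_nullstellensatz (tate A n) /\
     (forall (B : comPzRingType) (phi : {rmorphism tate A n -> B}),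
        finite_hom phi ->
        forall m : ideal B, maximal_ideal m ->
          finite_hom (quot_map (phi \o tateC n) m))) /\
  (strong_nullstellensatz A ->
   forall n : nat,
     strong_nullstellensatz (tate A n) /\
     (forall (B : comPzRingType) (phi : {rmorphism tate A n -> B}),
        finite_hom phi ->
        forall m : ideal B, maximal_ideal m ->
          finite_hom (quot_map (phi \o tateC n) m))).
Proof.
split=> [weak n|strong n].
  by split; [exact: weak_tate|move=> B phi; exact: tate_finite_fin].
split; first exact: strong_tate.
by case: strong => weak _ B phi; exact: tate_finite_fin.
Qed.
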